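(* (a) Let $[f_n],[g_n]\in\mathcal{H}$. Then $[f_n]\ast[g_n]=[f_n\ast g_n]$. (b) Let $[f_n],[g_n],[k_n]\in\mathcal{H}$ and $\alpha\in\mathbb{N}_0$. Then $$[f_n]\ast[g_n]=[g_n]\ast[f_n],\qquad D^\alpha([f_n]\ast[g_n])=(D^\alpha[f_n])\ast[g_n],$$ $$([f_n]\ast[g_n])\ast[k_n]=[f_n]\ast([g_n]\ast[k_n]).$$ (c) Let $[f_n],[g_n]\in\mathcal{H}$. Then $$\mathcal{F}([f_n]\cdot[g_n])=\frac{1}{\sqrt{2\pi}}\mathcal{F}([f_n])\ast\mathcal{F}([g_n]),\qquad \mathcal{F}([f_n]\ast[g_n])=\sqrt{2\pi}\,\mathcal{F}([f_n])\cdot\mathcal{F}([g_n]).$$ (d) Let $T\in\mathcal{S}'$ and $\varphi\in\mathcal{S}$. Then $\iota(T)\ast\iota(\varphi)\approx\iota(T\ast\varphi)$.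
   Context: $\mathbb{N}_0=\mathbb{N}\cup\{0\}$. $\mathcal{S}$ is the Schwartz space of rapidly decreasing smooth complex-valued functions on $\mathbb{R}$, with norms $\|\varphi\|_m=\big(\int_{\mathbb{R}}|(N+1)^m\varphi(x)|^2dx\big)^{1/2}$, $m\in\mathbb{N}_0$, where $N+1=\frac12\big(-\frac{d^2}{dx^2}+x^2+1\big)$; $\mathcal{S}'$ is the space of tempered distributions. Write $\langle f,\varphi\rangle=\int_{\mathbb{R}} f(x)\varphi(x)\,dx$. The Hermite functions are $h_n(x)=(\sqrt{2\pi}\,n!)^{-1/2}e^{-x^2/4}H_n(x)$ with $H_n(x)=(-1)^ne^{x^2/2}\frac{d^n}{dx^n}e^{-x^2/2}$, $n\in\mathbb{N}_0$. $\mathbf{s}$ is the space of sequences $(a_n)_{n\in\mathbb{N}_0}$ with $\sum_n (n+1)^{2m}|a_n|^2<\infty$ for all $m\in\mathbb{N}_0$. $\mathbf{s}'$ is the space of sequences $(b_n)$ for which there are $C\in\mathbb{R}$, $m\in\mathbb{N}_0$ with $|b_n|\le C(n+1)^m$ for all $n$. $\mathcal{H}_{\mathbf{s}'}$ (resp. $\mathcal{H}_{\mathbf{s}}$) is the set of sequences $(f_n)\in\mathcal{S}^{\mathbb{N}_0}$ such that $(\|f_n\|_m)_n\in\mathbf{s}'$ (resp. $\in\mathbf{s}$) for every $m\in\mathbb{N}_0$. The tempered algebra is $\mathcal{H}=\mathcal{H}_{\mathbf{s}'}/\mathcal{H}_{\mathbf{s}}$ with termwise operations; $[f_n]$ is the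 class of $(f_n)$ and $D[f_n]=[Df_n]$. The map $\iota:\mathcal{S}'\to\mathcal{H}$ is $\iota(T)=[T_n]$ with $T_n=\sum_{j=0}^nT(h_j)h_j$; functions $\varphi\in\mathcal{S}$ are regarded as tempered distributions. On $\mathcal{S}$: $\mathcal{F}(\varphi)(t)=\frac{1}{\sqrt{2\pi}}\int_{\mathbb{R}}e^{-itx}\varphi(x)\,dx$ and $(\varphi\ast\psi)(t)=\int_{\mathbb{R}}\varphi(t-x)\psi(x)\,dx$. On $\mathcal{H}$: $\mathcal{F}([f_n])=[\mathcal{F}(f_n)]$, $\mathcal{F}^{-1}([f_n])=[\mathcal{F}^{-1}(f_n)]$, and the convolution is defined by $[f_n]\ast[g_n]=\mathcal{F}^{-1}\big(\sqrt{2\pi}\,\mathcal{F}([f_n])\cdot\mathcal{F}([g_n])\big)$. $T\ast\varphi$ for $T\in\mathcal{S}'$, $\varphi\in\mathcal{S}$ is the usual convolution, a tempered distribution. Association: $[f_n]\approx[g_n]$ means $\lim_{n\to\infty}\langle f_n-g_n,\varphi\rangle=0$ for all $\varphi\in\mathcal{S}$. *)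

(* Defs.v *)
From mathcomp Require Import all_boot all_order all_algebra.
From mathcomp Require Import complex.
From mathcomp Require Import all_classical all_reals all_analysis.
Import Order.TTheory GRing.Theory Num.Theory.
Import numFieldNormedType.Exports.
Set Implicit Arguments.
Unset Strict Implicit.
Unset Printing Implicit Defensive.
Local Open Scope classical_set_scope.
Local Open Scope ring_scope.
Local Open Scope complex_scope.

Notation normc := ComplexField.Normc.normc.

Section ComplexValuedFunctions.
Variable R : realType.
Implicit Types (f g phi psi : R -> R[i]).

(* R[i] carries no normed R-module structure in the library, so derivatives and
   Lebesgue integrals of complex-valued functions are taken componentwise. *)
Definition cderivable f (x : R) : Prop :=
  derivable (fun y => complex.Re (f y)) x 1 /\ derivable (fun y => complex.Im (f y)) x 1.

Definition cderive f : R -> R[i] :=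
  fun x => derive1 (fun y => complex.Re (f y)) x
    +i* derive1 (fun y => complex.Im (f y)) x.

Definition cintegral f : R[i] :=
  (\int[lebesgue_measure]_x complex.Re (f x)) +i* (\int[lebesgue_measure]_x complex.Im (f x)).

Definition smooth f : Prop := forall k x, cderivable (iter k cderive f) x.

Definition schwartz f : Prop :=
  smooth f /\
  forall k l : nat, exists M : R,
    forall x : R, `|x| ^+ k * normc (iter l cderive f x) <= M.

(* The operator N + 1 = (- d^2/dx^2 + x^2 + 1) / 2. *)
Definition number_op1 f : R -> R[i] :=
  fun x => (2^-1)%:C *
    (- cderive (cderive f) x + (x ^+ 2)%:C * f x + f x).

(* The integral is finite for f in the Schwartz space, the only place where
   this is used. *)
Definition snorm (m : nat) f : R :=
  Num.sqrt (\int[lebesgue_measure]_x (normc (iter m number_op1 f x) ^+ 2)).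

Definition pairing f phi : R[i] := cintegral (fun x => f x * phi x).

Definition fourier phi : R -> R[i] := fun t =>
  ((Num.sqrt (2 * pi))^-1)%:C *
  cintegral (fun x => (cos (t * x) -i* sin (t * x)) * phi x).

Definition inv_fourier phi : R -> R[i] := fun t =>
  ((Num.sqrt (2 * pi))^-1)%:C *
  cintegral (fun x => (cos (t * x) +i* sin (t * x)) * phi x).

Definition convolution phi psi : R -> R[i] :=
  fun t => cintegral (fun x => phi (t - x) * psi x).

End ComplexValuedFunctions.

Section Hermite.
Variable R : realType.

Definition hermite_poly (n : nat) (x : R) : R :=
  (-1) ^+ n * expR (x ^+ 2 / 2) *
    derive1n n (fun y : R => expR (- (y ^+ 2 / 2))) x.

Definition hermite (n : nat) : R -> R[i] := fun x =>
  ((Num.sqrt (Num.sqrt (2 * pi) * n`!%:R))^-1 * expR (- (x ^+ 2 / 4))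
   * hermite_poly n x)%:C.

End Hermite.

Section TemperedDistributions.
Variable R : realType.
Implicit Types (T : (R -> R[i]) -> R[i]) (phi psi : R -> R[i]).

(* A distribution is a functional defined on all functions, of which only the
   values on the Schwartz space matter. Continuity is with respect to the
   topology generated by the norms snorm m. *)
Definition tempered_distribution T : Prop :=
  (forall (c : R[i]) phi psi, schwartz phi -> schwartz psi ->
     T (fun x => c * phi x + psi x) = c * T phi + T psi) /\
  (forall phi, schwartz phi -> forall e : R, 0 < e ->
     exists m : nat, exists2 d : R, 0 < d &
       forall psi, schwartz psi ->
         (forall k, (k <= m)%N -> snorm k (fun x => psi x - phi x) < d) ->
         normc (T psi - T phi) < e).

Definition distribution_of phi : (R -> R[i]) -> R[i] :=
  fun psi => pairing phi psi.

(* <T * phi, psi> = <T, phi~ * psi> with phi~ x = phi (- x). *)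
Definition distribution_convolution T phi : (R -> R[i]) -> R[i] :=
  fun psi => T (convolution (fun x => phi (- x)) psi).

End TemperedDistributions.

Section TemperedAlgebra.
Variable R : realType.

Definition seq_s (a : nat -> R) : Prop :=
  forall m : nat, cvgn (series (fun n => n.+1%:R ^+ (2 * m) * `|a n| ^+ 2)).

Definition seq_s' (b : nat -> R) : Prop :=
  exists (C : R) (m : nat), forall n, `|b n| <= C * n.+1%:R ^+ m.

Local Notation fseq := (nat -> R -> R[i]).
Implicit Types (f g : fseq) (X Y : set fseq).

Definition H_s' f : Prop :=
  (forall n, schwartz (f n)) /\ forall m, seq_s' (fun n => snorm m (f n)).

Definition H_s f : Prop :=
  (forall n, schwartz (f n)) /\ forall m, seq_s (fun n => snorm m (f n)).

(* Elements of the quotient H_s' / H_s are the cosets f + H_s, f in H_s'. *)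
Definition tclass f : set fseq := [set g | H_s (fun n x => g n x - f n x)].

Definition tempered_algebra : set (set fseq) :=
  [set X | exists2 f, H_s' f & X = tclass f].

(* The operations below are defined on arbitrary sets of sequences, so an
   equation in the algebra also says that its two sides belong to it. *)
Definition teq X Y : Prop :=
  [/\ tempered_algebra X, tempered_algebra Y & X = Y].

(* The operation induced on classes: the union of the classes of the results
   over all representatives. This union is a single coset exactly when the
   result does not depend on the representatives. *)
Definition tlift1 (op : fseq -> fseq) X : set fseq :=
  \bigcup_(f in X) tclass (op f).

Definition tlift2 (op : fseq -> fseq -> fseq) X Y : set fseq :=
  \bigcup_(f in X) \bigcup_(g in Y) tclass (op f g).

Definition tscale (c : R[i]) : set fseq -> set fseq :=
  tlift1 (fun f n x => c * f n x).

Definition tmul : set fseq -> set fseq -> set fseq :=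
  tlift2 (fun f g n x => f n x * g n x).

Definition tderive : set fseq -> set fseq :=
  tlift1 (fun f n => cderive (f n)).

Definition tfourier : set fseq -> set fseq :=
  tlift1 (fun f n => fourier (f n)).

Definition tinv_fourier : set fseq -> set fseq :=
  tlift1 (fun f n => inv_fourier (f n)).

Definition tconv X Y : set fseq :=
  tinv_fourier
    (tmul (tscale (Num.sqrt (2 * pi))%:C (tfourier X)) (tfourier Y)).

Definition tiota (T : (R -> R[i]) -> R[i]) : set fseq :=
  tclass (fun n x => \sum_(j < n.+1) T (hermite j) * hermite j x).

Definition tassociated X Y : Prop :=
  exists f g, [/\ H_s' f, H_s' g, X = tclass f, Y = tclass g &
    forall phi : R -> R[i], schwartz phi ->
      (fun n => normc (pairing (fun x => f n x - g n x) phi)) @ \oo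
        --> (0 : R)].

End TemperedAlgebra.

(* Main.v *)
(* The Fourier transform is treated through its real parts, the cosine and sine
   transforms, and everything rests on the Hermite expansion. A Schwartz function f
   orthogonal to h_0 is in the image of the creation operator x/2 - d/dx; this gives
   by induction the spectral gap <A f, f> >= n |f|^2, A = - d^2/dx^2 + x^2/4 - 1/2,
   for f orthogonal to h_0, ..., h_(n-1), hence the convergence of Hermite expansions
   in all norms of S, with rate n^(-1/2).
   The square of the Fourier transform composed with a reflection is continuous,
   commutes with x and d/dx and fixes the Gaussian h_0, so it fixes all h_n, hence it
   is the identity: this is Fourier inversion. Together with <F f, g> = <f, F g>
   (Fubini) it yields the convolution theorem on S, and (a)-(c) follow because the
   operations on S are continuous, hence well defined on classes.
   For (d), pairing a representative of the difference with psi gives the value of T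
   at a function that tends to 0 in S, by the convergence of Hermite expansions. *)

Require Import Defs.
From mathcomp Require Import all_boot all_order all_algebra.
From mathcomp Require Import complex ring lra zify.
From mathcomp Require Import all_classical all_reals all_analysis measurable_realfun.
Import Order.TTheory GRing.Theory Num.Theory.
Import numFieldNormedType.Exports.
Local Open Scope classical_set_scope.
Local Open Scope ring_scope.
Local Open Scope complex_scope.
Set Implicit Arguments.
Unset Strict Implicit.
Unset Printing Implicit Defensive.

(** * Real Schwartz functions *)

Section RealSchwartz.
Variable R : realType.
Implicit Types (u v w : R -> R).

(** Two oscillators are in play. The [h_n], with weight exp(-x^2/4), diagonalise A, whereas the
    norms of S are powers of [N + 1], which comes from - d^2/dx^2 + x^2. A norm of an expansion can
    therefore not be read off its coefficients: the norms of [h_n] grow polynomially in n, and this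
    growth is paid for by the rapid decay of the coefficients, which powers of A + 1 provide. The
    gap by itself gives a rate in L2 only; since [N + 1] is symmetric, the m-th norm is interpolated
    between L2 and the norm of index 2m, and the square root taken there is the origin of the
    exponent 1/2. In return, [N + 1] is symmetric in x^2 and - d^2/dx^2, so it commutes with the
    cosine and sine transforms, and their continuity in all norms reduces to a single L2 estimate.
    Completeness of the [h_n] is often deduced from properties of the Fourier transform. Here it
    comes from the gap, hence from an explicit solution of a first order equation, so that inversion
    can be deduced from it without circularity. *)

Definition has_deriv u u' := forall x : R, is_derive x 1 u (u' x).

Lemma has_derivE u u' : has_deriv u u' -> derive1 u = u'.
Proof.
by move=> h; apply/funext => x; rewrite derive1E; have [_ ->] := h x.
Qed.

Lemma has_deriv_eq u u' v' : has_deriv u u' -> (forall x, u' x = v' x) ->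
  has_deriv u v'.
Proof. by move=> h /funext <-. Qed.

Lemma has_deriv_derivable u u' : has_deriv u u' -> forall x, derivable u x 1.
Proof. by move=> h x; have [] := h x. Qed.

Lemma derivable_has_deriv u : (forall x, derivable u x 1) ->
  has_deriv u (derive1 u).
Proof. by move=> h x; apply: DeriveDef => //; rewrite derive1E. Qed.

Lemma has_deriv_continuous u u' : has_deriv u u' -> continuous u.
Proof.
by move=> h x; apply: differentiable_continuous; apply/derivable1_diffP; have [] := h x.
Qed.

Lemma has_derivD u u' v v' : has_deriv u u' -> has_deriv v v' ->
  has_deriv (fun x => u x + v x) (fun x => u' x + v' x).
Proof. by move=> hu hv x; have := hu x; have := hv x => *; apply: is_deriveD. Qed.

Lemma has_derivM u u' v v' : has_deriv u u' -> has_deriv v v' ->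
  has_deriv (fun x => u x * v x) (fun x => u' x * v x + u x * v' x).
Proof.
move=> hu hv x; have hux := hu x; have hvx := hv x.
apply: (is_derive_eq (is_deriveM hux hvx)).
by rewrite /GRing.scale /=; ring.
Qed.

Lemma has_deriv_cst (c : R) : has_deriv (fun=> c) (fun=> 0).
Proof. by move=> x; apply: is_derive_cst. Qed.

Lemma has_deriv_id : has_deriv (fun x => x) (fun=> 1).
Proof. by move=> x; apply: is_derive_id. Qed.

Lemma has_derivN u u' : has_deriv u u' -> has_deriv (fun x => - u x) (fun x => - u' x).
Proof. by move=> hu x; have := hu x => ?; apply: is_deriveN. Qed.

Lemma has_derivB u u' v v' : has_deriv u u' -> has_deriv v v' ->
  has_deriv (fun x => u x - v x) (fun x => u' x - v' x).
Proof. by move=> hu hv; apply: has_derivD hu (has_derivN hv). Qed.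

Lemma has_derivZ (c : R) u u' : has_deriv u u' ->
  has_deriv (fun x => c * u x) (fun x => c * u' x).
Proof.
move=> hu; apply: has_deriv_eq (has_derivM (has_deriv_cst c) hu) _ => x.
by ring.
Qed.

Lemma has_deriv_comp u u' v v' : has_deriv u u' -> has_deriv v v' ->
  has_deriv (fun x => u (v x)) (fun x => v' x * u' (v x)).
Proof.
move=> hu hv x; have hux := hu (v x); have hvx := hv x.
apply: (is_derive_eq (is_derive1_comp hux hvx)).
by rewrite /GRing.scale /=; ring.
Qed.

Lemma has_deriv_expR : has_deriv expR expR.
Proof. by move=> x; apply: is_derive_expR. Qed.

Lemma has_deriv_cos : has_deriv cos (fun x => - sin x).
Proof. by move=> x; apply: is_derive_cos. Qed.

Lemma has_deriv_sin : has_deriv sin cos.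
Proof. by move=> x; apply: is_derive_sin. Qed.

Lemma has_deriv_horner (p : {poly R}) : has_deriv (fun x => p.[x]) (fun x => (p^`()).[x]).
Proof. by move=> x; apply: is_derive_poly. Qed.

Lemma has_deriv_gauss (c : R) :
  has_deriv (fun x => expR (- (c * x ^+ 2))) (fun x => - (2 * c * x) * expR (- (c * x ^+ 2))).
Proof.
have h1 : has_deriv (fun x => - (c * x ^+ 2)) (fun x => - (2 * c * x)).
  apply: has_derivN; apply: has_deriv_eq.
    by apply/has_derivZ/has_derivM; apply: has_deriv_id.
  by move=> x /=; ring.
exact: has_deriv_eq (has_deriv_comp has_deriv_expR h1) _.
Qed.

Definition rapid u := forall k : nat, exists M : R, forall x, `|x| ^+ k * `|u x| <= M.

Definition rschwartz u : Prop :=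
  (forall k x, derivable (iter k (fun w => derive1 w) u) x 1) /\
  (forall l, rapid (iter l (fun w => derive1 w) u)).

Lemma rschwartz_rapid u : rschwartz u -> rapid u.
Proof. by move=> [_ /(_ 0%N)]. Qed.

Lemma rschwartz_deriv u : rschwartz u -> has_deriv u (derive1 u).
Proof. by move=> [h _]; apply: derivable_has_deriv; apply: (h 0%N). Qed.

Lemma rschwartz_derive u : rschwartz u -> rschwartz (derive1 u).
Proof. by move=> [h1 h2]; split=> k; [move=> x|]; rewrite -iterSr. Qed.

(** Avoids formulas for iterated derivatives: it suffices to name a class of rapidly decreasing
    functions that contains the derivatives of its members. Products, trigonometric multiples,
    Gaussians, transforms and the preimage under the creation operator all enter S this way. *)
Lemma rschwartz_coind (P : (R -> R) -> Prop) :
  (forall u, P u -> exists2 u', has_deriv u u' & P u') ->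
  (forall u, P u -> rapid u) -> forall u, P u -> rschwartz u.
Proof.
move=> dP rP u Pu.
have Pk k : P (iter k (fun w => derive1 w) u).
  by elim: k => // k /dP[u' hu' Pu'] /=; rewrite (has_derivE hu').
split=> [k|l]; last exact/rP.
have [u' hu' _] := dP _ (Pk k); exact: has_deriv_derivable hu'.
Qed.

Lemma rapid_le u v (C : R) : rapid v -> (forall x, `|u x| <= C * `|v x|) -> rapid u.
Proof.
move=> rv uv k; have [M hM] := rv k; exists (`|C| * M) => x.
have h : `|u x| <= `|C| * `|v x|.
  by apply: le_trans (uv x) _; apply: ler_wpM2r => //; exact: ler_norm.
apply: (@le_trans _ _ (`|x| ^+ k * (`|C| * `|v x|))).
  by apply: ler_wpM2l => //; exact: exprn_ge0.
rewrite mulrCA; exact: ler_wpM2l.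
Qed.

Lemma rapidD u v : rapid u -> rapid v -> rapid (fun x => u x + v x).
Proof.
move=> ru rv k; have [M hM] := ru k; have [N hN] := rv k; exists (M + N) => x.
apply: le_trans (lerD (hM x) (hN x)); rewrite -mulrDr.
by apply: ler_wpM2l (ler_normD _ _); exact: exprn_ge0.
Qed.

Lemma rapidX u : rapid u -> rapid (fun x => x * u x).
Proof.
move=> ru k; have [M hM] := ru k.+1; exists M => x.
by rewrite normrM mulrA -exprSr.
Qed.

Lemma rapid_bounded u : rapid u -> exists M, forall x, `|u x| <= M.
Proof. by move=> /(_ 0%N)[M hM]; exists M => x; have := hM x; rewrite expr0 mul1r. Qed.

Lemma rapidZ (c : R) u : rapid u -> rapid (fun x => c * u x).
Proof. by move=> ru; apply: (@rapid_le _ _ `|c| ru) => x; rewrite normrM. Qed.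

Lemma rapid_horner (p : {poly R}) u : rapid u -> rapid (fun x => p.[x] * u x).
Proof.
move=> ru; elim/poly_ind: p => [|p c IH].
  by apply: rapid_le ru _ => x; rewrite horner0 mul0r normr0 -(mul0r `|u x|).
have -> : (fun x => (p * 'X + c%:P).[x] * u x) =
    (fun x => x * (p.[x] * u x) + c * u x).
  by apply/funext => x; rewrite hornerD hornerMX hornerC; ring.
by apply: rapidD; [exact: rapidX | exact: rapidZ].
Qed.

Lemma rapidM_bounded (M : R) u v : (forall x, `|u x| <= M) -> rapid v ->
  rapid (fun x => u x * v x).
Proof.
by move=> hM rv; apply: (rapid_le (C := M) rv) => x; rewrite normrM ler_wpM2r.
Qed.

Lemma rschwartzD u v : rschwartz u -> rschwartz v -> rschwartz (fun x => u x + v x).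
Proof.
move=> su sv.
apply: (@rschwartz_coind (fun w => exists u, exists2 v, rschwartz u /\ rschwartz v &
    w = fun x => u x + v x)); last by exists u, v.
- move=> _ [a [b [sa sb] ->]]; exists (fun x => derive1 a x + derive1 b x).
    by apply: has_derivD; apply: rschwartz_deriv.
  by exists (derive1 a), (derive1 b) => //; split; apply: rschwartz_derive.
- by move=> _ [a [b [sa sb] ->]]; apply: rapidD; apply: rschwartz_rapid.
Qed.

Lemma rschwartzZ (c : R) u : rschwartz u -> rschwartz (fun x => c * u x).
Proof.
move=> su.
apply: (@rschwartz_coind (fun w => exists2 u, rschwartz u & w = fun x => c * u x)); last by exists u.
- move=> _ [a sa ->]; exists (fun x => c * derive1 a x).
    by apply: has_derivZ; apply: rschwartz_deriv.
  by exists (derive1 a) => //; apply: rschwartz_derive.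
- by move=> _ [a sa ->]; apply: rapidZ; apply: rschwartz_rapid.
Qed.

Lemma rschwartzN u : rschwartz u -> rschwartz (fun x => - u x).
Proof.
move=> /(rschwartzZ (-1)); congr rschwartz.
by apply/funext => x; rewrite mulN1r.
Qed.

Lemma rschwartzB u v : rschwartz u -> rschwartz v -> rschwartz (fun x => u x - v x).
Proof. by move=> su /rschwartzN; apply: rschwartzD. Qed.

Lemma rschwartz0 : rschwartz (fun=> 0).
Proof.
apply: (@rschwartz_coind (fun w => w = fun=> 0)) => // _ ->.
  by exists (fun=> 0) => //; exact: has_deriv_cst.
by move=> k; exists 0 => x; rewrite normr0 mulr0.
Qed.

Lemma rschwartz_sum n (F : nat -> R -> R) : (forall i, rschwartz (F i)) ->
  rschwartz (fun x => \sum_(i < n) F i x).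
Proof.
move=> sF; elim: n => [|n IH].
  have -> : (fun x => \sum_(i < 0) F i x) = fun=> 0.
    by apply/funext => x; rewrite big_ord0.
  exact: rschwartz0.
have -> : (fun x => \sum_(i < n.+1) F i x) = fun x => \sum_(i < n) F i x + F n x.
  by apply/funext => x; rewrite big_ord_recr.
exact: rschwartzD.
Qed.

Lemma rschwartzX u : rschwartz u -> rschwartz (fun x => x * u x).
Proof.
move=> su.
(* The summand v closes the class: the derivative of x u + v is x u' + (u + v'). *)
apply: (@rschwartz_coind (fun w => exists u, exists2 v, rschwartz u /\ rschwartz v &
    w = fun x => x * u x + v x)).
- move=> _ [a [b [sa sb] ->]]; eexists.
    by apply: has_derivD; [apply: (has_derivM has_deriv_id)|]; apply: rschwartz_deriv.
  exists (derive1 a), (fun x => a x + derive1 b x).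
    by split; [|apply: rschwartzD => //]; apply: rschwartz_derive.
  by apply/funext => x; ring.
- by move=> _ [a [b [sa sb] ->]]; apply: rapidD; [apply: rapidX|]; apply: rschwartz_rapid.
- exists u, (fun=> 0); first by split=> //; exact: rschwartz0.
  by apply/funext => x; rewrite addr0.
Qed.

(** Single products are not stable under d/dx; by the Leibniz rule their finite sums are. *)
Inductive sum_of_products : (R -> R) -> Prop :=
| sum_of_products_mul u v : rschwartz u -> rschwartz v ->
    sum_of_products (fun x => u x * v x)
| sum_of_products_add u v : sum_of_products u -> sum_of_products v ->
    sum_of_products (fun x => u x + v x).

Lemma rschwartzM u v : rschwartz u -> rschwartz v -> rschwartz (fun x => u x * v x).
Proof.
move=> su sv; apply: (@rschwartz_coind sum_of_products); last by constructor.
- move=> w; elim=> [a b sa sb|a b _ [a' ha sa] _ [b' hb sb]].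
    eexists; first by apply: has_derivM; apply: rschwartz_deriv.
    by do 2 constructor => //; apply: rschwartz_derive.
  by eexists; [exact: has_derivD ha hb|constructor].
- move=> w; elim=> [a b sa sb|a b _ ra _ rb]; last exact: rapidD.
  have [M hM] := rapid_bounded (rschwartz_rapid sa).
  exact: rapidM_bounded hM (rschwartz_rapid sb).
Qed.

Lemma rschwartz_horner (p : {poly R}) u : rschwartz u -> rschwartz (fun x => p.[x] * u x).
Proof.
move=> su; elim/poly_ind: p => [|p c IH].
  have -> : (fun x => (0 : {poly R}).[x] * u x) = fun=> 0.
    by apply/funext => x; rewrite horner0 mul0r.
  exact: rschwartz0.
have -> : (fun x => (p * 'X + c%:P).[x] * u x) =
    (fun x => x * (p.[x] * u x) + c * u x).
  by apply/funext => x; rewrite hornerD hornerMX hornerC; ring.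
by apply: rschwartzD; [exact: rschwartzX | exact: rschwartzZ].
Qed.

Lemma has_deriv_cosM (t : R) : has_deriv (fun x => cos (t * x)) (fun x => - (t * sin (t * x))).
Proof.
apply: has_deriv_eq (has_deriv_comp has_deriv_cos (has_derivZ t has_deriv_id)) _ => x.
by ring.
Qed.

Lemma has_deriv_sinM (t : R) : has_deriv (fun x => sin (t * x)) (fun x => t * cos (t * x)).
Proof.
apply: has_deriv_eq (has_deriv_comp has_deriv_sin (has_derivZ t has_deriv_id)) _ => x.
by ring.
Qed.

Lemma norm_cos_le1 (x : R) : `|cos x| <= 1.
Proof. by rewrite ler_norml cos_le1 cos_geN1. Qed.

Lemma norm_sin_le1 (x : R) : `|sin x| <= 1.
Proof. by rewrite ler_norml sin_le1 sin_geN1. Qed.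

(** Differentiation mixes the two terms: the pair (u, v) becomes (u' + t v, v' - t u). Cosine and
    sine multiples are the cases where v or u is 0. *)
Lemma rschwartz_trig (t : R) u v : rschwartz u -> rschwartz v ->
  rschwartz (fun x => cos (t * x) * u x + sin (t * x) * v x).
Proof.
move=> su sv.
apply: (@rschwartz_coind (fun w => exists u, exists2 v, rschwartz u /\ rschwartz v &
    w = fun x => cos (t * x) * u x + sin (t * x) * v x)); last by exists u, v.
- move=> _ [a [b [sa sb] ->]]; eexists.
    apply: has_derivD; apply: has_derivM; try exact: rschwartz_deriv.
      exact: has_deriv_cosM.
    exact: has_deriv_sinM.
  exists (fun x => derive1 a x + t * b x), (fun x => derive1 b x - t * a x).
    split.
      exact: rschwartzD (rschwartz_derive sa) (rschwartzZ t sb).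
    exact: rschwartzB (rschwartz_derive sb) (rschwartzZ t sa).
  by apply/funext => x; ring.
- move=> _ [a [b [sa sb] ->]]; apply: rapidD; apply: (@rapidM_bounded 1).
  + by move=> x; exact: norm_cos_le1.
  + exact: rschwartz_rapid.
  + by move=> x; exact: norm_sin_le1.
  + exact: rschwartz_rapid.
Qed.

Lemma rschwartz_cosM (t : R) u : rschwartz u -> rschwartz (fun x => cos (t * x) * u x).
Proof.
move=> su; have := rschwartz_trig t su rschwartz0; congr rschwartz.
by apply/funext => x; rewrite mulr0 addr0.
Qed.

Lemma rschwartz_sinM (t : R) u : rschwartz u -> rschwartz (fun x => sin (t * x) * u x).
Proof.
move=> su; have := rschwartz_trig t rschwartz0 su; congr rschwartz.
by apply/funext => x; rewrite mulr0 add0r.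
Qed.

Lemma rschwartz_reflect (t : R) u : rschwartz u -> rschwartz (fun x => u (t - x)).
Proof.
move=> su.
apply: (@rschwartz_coind (fun w => exists2 u, rschwartz u & w = fun x => u (t - x)));
    last by exists u.
- move=> _ [a sa ->]; eexists.
    apply: (has_deriv_comp (rschwartz_deriv sa)).
    by apply: has_derivB; [exact: has_deriv_cst|exact: has_deriv_id].
  exists (fun x => - derive1 a x); first exact/rschwartzN/rschwartz_derive.
  by apply/funext => x; rewrite sub0r mulN1r.
- move=> _ [a sa ->] k; elim: k => [|k IH] in a sa *.
    have [M hM] := rapid_bounded (rschwartz_rapid sa); exists M => x.
    by rewrite expr0 mul1r.
  (* One factor x is written as t - (t - x); the second part is absorbed into the Schwartz function
     x a(x), to which the induction hypothesis applies as well. *)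
  have [M hM] := IH _ sa; have [N hN] := IH _ (rschwartzX sa).
  exists (`|t| * M + N) => x.
  have : `|x| * `|a (t - x)| <= `|t| * `|a (t - x)| + `|(t - x) * a (t - x)|.
    rewrite normrM -mulrDl ler_wpM2r //.
    by rewrite [X in `|X| <= _](_ : x = t - (t - x)); [exact: ler_normB|ring].
  move=> /(ler_wpM2l (exprn_ge0 k (normr_ge0 x))) h.
  rewrite exprSr -mulrA; apply: le_trans h _.
  rewrite mulrDr mulrCA; apply: lerD; last exact: hN.
  by apply: ler_wpM2l.
Qed.

Lemma rapid_gauss (c : R) : 0 < c -> rapid (fun x => expR (- (c * x ^+ 2))).
Proof.
move=> c0 k; exists (1 + k.+1`!%:R / c ^+ k.+1) => x.
rewrite (ger0_norm (expR_ge0 _)) expRN.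
rewrite ler_pdivrMr ?expR_gt0//.
have h0 : 0 <= c * x ^+ 2 by apply: mulr_ge0 (ltW c0) (sqr_ge0 x).
(* One term of the exponential series, of degree k + 1 in c x^2, is compared with |x|^k <= 1 + x^(2
   (k + 1)); hence the constant 1 + (k + 1)! / c^(k + 1). *)
have := expR_ge1Dxn k h0; rewrite exprMn => h.
have e1 : 1 <= expR (c * x ^+ 2) by rewrite -expR0 ler_expR.
have hk : `|x| ^+ k <= 1 + (x ^+ 2) ^+ k.+1.
  have [x1|x1] := lerP `|x| 1.
    apply: (@le_trans _ _ 1); first exact: exprn_ile1.
    by rewrite lerDl exprn_ge0 // sqr_ge0.
  rewrite -(real_normK (num_real x)) -exprM.
  apply: (@le_trans _ _ (`|x| ^+ (2 * k.+1))); last by rewrite lerDr.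
  by rewrite ler_weXn2l ?ltW // (leq_trans (leqnSn k)) // leq_pmull.
apply: le_trans hk _; rewrite mulrDl mul1r; apply: lerD => //.
have ck : 0 < c ^+ k.+1 by exact: exprn_gt0.
have fk : 0 < (k.+1`!%:R : R) by rewrite ltr0n fact_gt0.
rewrite mulrAC ler_pdivlMr // mulrC -ler_pdivrMl // mulrC.
by apply: le_trans h; rewrite [leLHS](_ : _ = c ^+ k.+1 * (x ^+ 2) ^+ k.+1 / k.+1`!%:R) ?lerDr //; ring.
Qed.

Lemma rschwartz_horner_gauss (c : R) (p : {poly R}) : 0 < c ->
  rschwartz (fun x => p.[x] * expR (- (c * x ^+ 2))).
Proof.
move=> c0.
apply: (@rschwartz_coind (fun w => exists p : {poly R},
    w = fun x => p.[x] * expR (- (c * x ^+ 2)))); last by exists p.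
- move=> _ [q ->]; eexists.
    by apply: has_derivM; [exact: has_deriv_horner|exact: has_deriv_gauss].
  exists (q^`() - (2 * c) *: ('X * q)); apply/funext => x.
  by rewrite hornerD hornerN hornerZ hornerM hornerX; ring.
- by move=> _ [q ->]; apply/rapid_horner/rapid_gauss.
Qed.

Lemma rschwartz_gauss (c : R) : 0 < c -> rschwartz (fun x => expR (- (c * x ^+ 2))).
Proof.
move=> /(rschwartz_horner_gauss 1); congr rschwartz.
by apply/funext => x; rewrite hornerC mul1r.
Qed.

End RealSchwartz.

(** * Decay and integration by parts *)

Section RealIntegral.
Variable R : realType.
Implicit Types (u v w : R -> R).
Local Notation mu := (@lebesgue_measure R).

(** Schwartz functions are dominated by multiples of 1 / (1 + x^2), so this integral gives all the
    L1 bounds and is the origin of [pi] in the later constants. *)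
Lemma oneDsqrV_integral :
  (\int[mu]_x ((1 + x ^+ 2)^-1)%:E = pi%:E)%E.
Proof.
rewrite ge0_symfun_integralT /=.
- have -> : [set x : R | 0 <= x] = `[0, +oo[%classic.
    by apply/seteqP; split => x /=; rewrite in_itv /= andbT.
  by rewrite (@integral0y_oneDsqr R) -EFinM mulrCA divff ?mulr1.
- by move=> x; rewrite invr_ge0 addr_ge0 ?sqr_ge0.
- exact: continuous_oneDsqrV.
- by move=> x /=; rewrite sqrrN.
Qed.

Lemma oneDsqr_gt0 (x : R) : 0 < 1 + x ^+ 2.
Proof. by rewrite ltr_pwDl ?sqr_ge0. Qed.

Lemma oneDsqrV_integrable : mu.-integrable setT (EFin \o (fun x => (1 + x ^+ 2)^-1)).
Proof.
apply/integrableP; split.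
  apply/measurable_EFinP; apply: continuous_measurable_fun.
  exact: continuous_oneDsqrV.
apply: (@le_lt_trans _ _ pi%:E); last exact: ltry.
rewrite -oneDsqrV_integral le_eqVlt; apply/orP; left; apply/eqP.
apply: eq_integral => x _ /=.
by rewrite ger0_norm // invr_ge0 ltW // oneDsqr_gt0.
Qed.

Lemma Rintegrable_scale (c : R) (A : set R) u : measurable A ->
  mu.-integrable A (EFin \o u) -> mu.-integrable A (EFin \o (fun x => c * u x)).
Proof. by move=> mA iu; exact (@integrableZl _ _ _ mu _ mA c _ iu). Qed.

Lemma Rintegrable_add u v : mu.-integrable setT (EFin \o u) ->
  mu.-integrable setT (EFin \o v) ->
  mu.-integrable setT (EFin \o (fun x => u x + v x)).
Proof. exact: integrableD. Qed.

Section Decay.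
Variables (u : R -> R) (M : R).
Hypothesis mu_u : measurable_fun setT u.
Hypothesis decay_u : forall x, (1 + x ^+ 2) * `|u x| <= M.

Lemma decay_le x : `|u x| <= M * (1 + x ^+ 2)^-1.
Proof. by rewrite ler_pdivlMr ?oneDsqr_gt0 // mulrC. Qed.

Lemma decay_ge0 : 0 <= M.
Proof. by apply: le_trans (decay_u 0); rewrite mulr_ge0 // ltW // oneDsqr_gt0. Qed.

Lemma decay_integrable : mu.-integrable setT (EFin \o u).
Proof.
apply: (@le_integrable _ _ _ mu _ _ _ (EFin \o (fun x => M * (1 + x ^+ 2)^-1))) => //.
- exact/measurable_EFinP.
- move=> x _ /=; rewrite lee_fin normrM (ger0_norm decay_ge0).
  rewrite [X in _ <= _ * X]ger0_norm ?decay_le //.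
  by rewrite invr_ge0 ltW // oneDsqr_gt0.
- by apply: Rintegrable_scale => //; exact: oneDsqrV_integrable.
Qed.

Lemma decay_norm_integral : \int[mu]_x `|u x| <= M * pi.
Proof.
have -> : M * pi = \int[mu]_x (M * (1 + x ^+ 2)^-1).
  rewrite RintegralZl //; last exact: oneDsqrV_integrable.
  by rewrite /Rintegral oneDsqrV_integral.
apply: le_Rintegral => //.
- by have := integrable_norm decay_integrable.
- by apply: Rintegrable_scale => //; exact: oneDsqrV_integrable.
- by move=> x _; exact: decay_le.
Qed.

Lemma decay_integral_norm : `|\int[mu]_x u x| <= M * pi.
Proof.
apply: le_trans decay_norm_integral.
by apply: le_normr_Rintegral => //; exact: decay_integrable.
Qed.

End Decay.

Lemma rapid_decay u : rapid u -> exists M, forall x, (1 + x ^+ 2) * `|u x| <= M.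
Proof.
move=> ru; have [M hM] := ru 0%N; have [N hN] := ru 2%N; exists (M + N) => x.
rewrite mulrDl -(real_normK (num_real x)); apply: lerD => //.
exact: hM.
Qed.

Lemma rschwartz_continuous u : rschwartz u -> continuous u.
Proof. by move=> su; apply: has_deriv_continuous (rschwartz_deriv su). Qed.

Lemma rschwartz_measurable u : rschwartz u -> measurable_fun setT u.
Proof. by move=> su; apply: continuous_measurable_fun; exact: rschwartz_continuous. Qed.

Lemma rschwartz_decay u : rschwartz u -> exists M, forall x, (1 + x ^+ 2) * `|u x| <= M.
Proof. by move=> su; apply/rapid_decay/rschwartz_rapid. Qed.

Lemma rschwartz_integrable u : rschwartz u -> mu.-integrable setT (EFin \o u).
Proof.
move=> su; have [M hM] := rschwartz_decay su.
exact: decay_integrable (rschwartz_measurable su) hM.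
Qed.

Lemma FTC_has_deriv w w' (a b : R) : has_deriv w w' -> continuous w' -> a < b ->
  \int[mu]_(x in `[a, b]) w' x = w b - w a.
Proof.
move=> hw cw ab; rewrite /Rintegral (@continuous_FTC2 _ w' w) //=.
- by apply: continuous_subspaceT.
- split.
  + by move=> x _; apply: has_deriv_derivable hw x.
  + by apply: cvg_at_right_filter; exact: has_deriv_continuous hw a.
  + by apply: cvg_at_left_filter; exact: has_deriv_continuous hw b.
- by move=> x _; rewrite (has_derivE hw).
Qed.

Lemma subset_le_Rintegral u (A : set R) : measurable A ->
  mu.-integrable setT (EFin \o u) -> \int[mu]_(x in A) `|u x| <= \int[mu]_x `|u x|.
Proof.
move=> mA iu; have iuA : mu.-integrable A (EFin \o u) by apply: integrableS iu.
rewrite /Rintegral fine_le //.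
- by apply: integrable_fin_num => //; apply: (integrable_norm iuA).
- by apply: integrable_fin_num => //; apply: (integrable_norm iu).
- apply: ge0_subset_integral => //.
  by have /measurable_int := integrable_norm iu.
Qed.

Lemma norm_sub_le_integral w w' (x y : R) : has_deriv w w' -> continuous w' ->
  mu.-integrable setT (EFin \o w') -> `|w x - w y| <= \int[mu]_z `|w' z|.
Proof.
move=> hw cw iw.
wlog xy : x y / y < x.
  move=> H; have [yx|xy|->] := ltgtP y x; first exact: H.
    by rewrite distrC; exact: H.
  by rewrite subrr normr0; apply: Rintegral_ge0.
rewrite -(FTC_has_deriv hw cw xy).
have iwS : mu.-integrable `[y, x] (EFin \o w').
  by apply: integrableS iw.
apply: le_trans (le_normr_Rintegral _ iwS) _ => //.
by apply: subset_le_Rintegral iw.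
Qed.

Lemma rapid_small u (e : R) : rapid u -> 0 < e -> exists x, `|u x| < e.
Proof.
move=> /rapid_decay[M hM] e0.
(* As x <= 1 + x^2, it is enough that x e > M. *)
exists (`|M| / e + 1); set x := _ + 1.
have x1 : 1 <= x by rewrite lerDr divr_ge0 // ltW.
have hx : x <= 1 + x ^+ 2.
  by rewrite -subr_ge0; apply: le_trans (sqr_ge0 (x - 1)) _; nra.
have := hM x; rewrite -ler_pdivlMl ?oneDsqr_gt0 // => h.
apply: le_lt_trans h _; rewrite ltr_pdivrMl ?oneDsqr_gt0 //.
apply: (@lt_le_trans _ _ (x * e)); last by rewrite ler_pM2r.
rewrite /x mulrDl mul1r divfK ?gt_eqF //.
by apply: (le_lt_trans (ler_norm M)); rewrite ltrDl.
Qed.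

(** The oscillation bound is used with a second point at which [w] is arbitrarily small. *)
Lemma rschwartz_le_integral w x : rschwartz w -> `|w x| <= \int[mu]_z `|derive1 w z|.
Proof.
move=> sw; apply/ler_addgt0Pr => e e0.
have [y hy] := rapid_small (rschwartz_rapid sw) e0.
have sw' := rschwartz_derive sw.
have h := norm_sub_le_integral x y (rschwartz_deriv sw) (rschwartz_continuous sw')
  (rschwartz_integrable sw').
rewrite -[X in `|X|](subrK (w y)); apply: le_trans (ler_normD _ _) _.
by apply: lerD => //; exact: ltW.
Qed.

(** Takes the place of a passage to the limit, first for the boundary terms and tails behind
    integration by parts, then for the Hermite approximation of a commuting operator. *)
Lemma eq0_of_decay (A K : R) : (forall r : R, 0 < r -> (1 + r ^+ 2) * `|A| <= K) -> A = 0.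
Proof.
move=> h; apply/eqP; apply: contraT => A0.
have nA : 0 < `|A| by rewrite normr_gt0.
have K0 : 0 <= K by apply: le_trans (h 1 ltr01); rewrite mulr_ge0 // ltW // oneDsqr_gt0.
pose r := K / `|A| + 1.
have r0 : 0 < r by rewrite ltr_wpDl // divr_ge0.
have hx : r <= 1 + r ^+ 2.
  by rewrite -subr_ge0; apply: le_trans (sqr_ge0 (r - 1)) _; nra.
have := le_trans (ler_wpM2r (ltW nA) hx) (h r r0).
by rewrite /r mulrDl mul1r divfK ?gt_eqF // gerDl leNgt nA.
Qed.

Lemma rschwartz_integral_derive w : rschwartz w -> \int[mu]_x derive1 w x = 0.
Proof.
move=> sw; have sw' := rschwartz_derive sw.
have [M hM] := rschwartz_decay sw.
(* [N1] and [N2] bound (1 + x^2)|w'| and (1 + x^2) x^2 |w'|, so their sum bounds (1 + x^2)^2 |w'|.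
   Outside [-r, r] one factor dominates 1 + r^2 and the other makes the tail integrable. *)
have [N1 hN1] := rschwartz_decay sw'.
have [N2 hN2] := rschwartz_decay (rschwartzX (rschwartzX sw')).
apply: (@eq0_of_decay _ (M + M + (N1 + N2) * pi)) => r r0.
have iw := rschwartz_integrable sw'.
have rr : - r < r by lra.
have mI : measurable (`[(- r), r]%classic : set R) by exact: measurable_itv.
have split_int : \int[mu]_x derive1 w x =
    \int[mu]_(x in `[(- r), r]) derive1 w x + \int[mu]_x (derive1 w \_ (~` `[(- r), r])) x.
  rewrite -[in LHS](setUv `[(- r), r]%classic) Rintegral_setU //; last 3 first.
  - exact: measurableC.
  - by rewrite setUv.
  - by apply/disj_setPS; rewrite setICr.
  by congr (_ + _); rewrite Rintegral_mkcond.
rewrite split_int (FTC_has_deriv (rschwartz_deriv sw) (rschwartz_continuous sw') rr).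
apply: le_trans (ler_wpM2l (ltW (oneDsqr_gt0 r)) (ler_normD _ _)) _.
rewrite mulrDr; apply: lerD.
  apply: le_trans (ler_wpM2l (ltW (oneDsqr_gt0 r)) (ler_normB _ _)) _.
  by rewrite mulrDr; apply: lerD => //; have := hM (- r); rewrite sqrrN.
rewrite -(ger0_norm (ltW (oneDsqr_gt0 r))) -normrM.
rewrite -RintegralZl //; last first.
  rewrite -restrict_EFin; apply/integrable_restrict => //; first exact: measurableC.
  by rewrite setTI; apply: integrableS iw => //; exact: measurableC.
apply: decay_integral_norm.
  apply: measurable_funM => //.
  apply/(measurable_restrictT _ _).1; first exact: measurableC.
  by apply: measurable_funTS; exact: rschwartz_measurable.
move=> x; rewrite patchE; case: ifPn => [|_]; last first.
  rewrite mulr0 normr0 mulr0; have := decay_ge0 hN1; have := decay_ge0 hN2; lra.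
rewrite inE /= in_itv /= => /negP hx.
have rx : r ^+ 2 <= x ^+ 2.
  have [h|h] := lerP r `|x|.
    by rewrite -(real_normK (num_real x)) lerXn2r // nnegrE // ltW.
  by case/negP: hx; rewrite -ler_norml ltW.
rewrite normrM (ger0_norm (ltW (oneDsqr_gt0 r))).
have a0 := normr_ge0 (derive1 w x).
have := hN1 x; have := hN2 x; rewrite !normrM mulrA -expr2 real_normK ?num_real //.
set a := `|derive1 w x| in a0 *; move=> h2 h1.
have r2 := sqr_ge0 r; have x2 := sqr_ge0 x.
have key : (1 + r ^+ 2) * a <= (1 + x ^+ 2) * a by apply: ler_wpM2r => //; lra.
have := ler_wpM2l (ltW (oneDsqr_gt0 x)) key; nra.
Qed.

Lemma rschwartz_ibp u v : rschwartz u -> rschwartz v ->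
  \int[mu]_x (derive1 u x * v x) = - \int[mu]_x (u x * derive1 v x).
Proof.
move=> su sv; have := rschwartz_integral_derive (rschwartzM su sv).
rewrite (has_derivE (has_derivM (rschwartz_deriv su) (rschwartz_deriv sv))).
rewrite RintegralD //; last 2 first.
- by apply/rschwartz_integrable/rschwartzM => //; exact: rschwartz_derive.
- by apply/rschwartz_integrable/rschwartzM => //; exact: rschwartz_derive.
by move/eqP; rewrite addr_eq0 => /eqP.
Qed.

End RealIntegral.

(** * Cosine and sine transforms *)

Section Transforms.
Variable R : realType.
Implicit Types (u v w : R -> R).
Local Notation mu := (@lebesgue_measure R).

Definition cos_transform u (t : R) : R := \int[mu]_x (cos (t * x) * u x).
Definition sin_transform u (t : R) : R := \int[mu]_x (sin (t * x) * u x).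

(** The t-derivative k'(t x) x u(x) of the integrand is dominated by |x u(x)| uniformly in t, which
    allows differentiation under the integral sign. The cosine and sine transforms are two
    instances. *)
Lemma under_integral_bounded (k k' : R -> R) u : has_deriv k k' ->
  continuous k' -> (forall x, `|k' x| <= 1) ->
  (forall t, mu.-integrable setT (EFin \o (fun x => k (t * x) * u x))) ->
  rschwartz u ->
  has_deriv (fun t => \int[mu]_x (k (t * x) * u x))
            (fun t => \int[mu]_x (k' (t * x) * (x * u x))).
Proof.
move=> hk ck k1 ik su.
have dk x : has_deriv (fun t => k (t * x) * u x) (fun t => k' (t * x) * (x * u x)).
  apply: has_deriv_eq.
    apply: has_derivM; last exact: has_deriv_cst.
    apply: (has_deriv_comp hk); apply: has_derivM; last exact: has_deriv_cst.
    exact: has_deriv_id.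
  by move=> t /=; ring.
have sXu := rschwartzX su.
have IG : mu.-integrable [set: R] (EFin \o (fun x => `|x * u x|)).
  exact: (integrable_norm (rschwartz_integrable sXu)).
move=> t.
pose f (s : R) (x : R) := k (s * x) * u x.
have Ia : `]t - 1, t + 1[%classic t by rewrite /= in_itv /=; apply/andP; split; lra.
have d1f s x : partial1of2 f s x = k' (s * x) * (x * u x).
  by rewrite /partial1of2 (has_derivE (dk x)).
have derf s x : `]t - 1, t + 1[%classic s -> [set: R] x -> derivable (f ^~ x) s 1.
  by move=> _ _; apply: has_deriv_derivable (dk x) s.
have Gub s x : `]t - 1, t + 1[%classic s -> [set: R] x ->
    `|partial1of2 f s x| <= `|x * u x|.
  by move=> _ _; rewrite d1f normrM ler_piMl.
have G0 (x : R) : 0 <= `|x * u x| by [].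
have D := derivable_under_integral measurableT Ia (fun s _ => ik s) derf G0 IG Gub.
apply: DeriveDef; first exact: D.
rewrite -derive1E.
have -> := differentiation_under_integral measurableT Ia (fun s _ => ik s) derf G0 IG Gub.
by apply: eq_Rintegral => x _; rewrite d1f.
Qed.

Lemma has_deriv_cos_transform u : rschwartz u ->
  has_deriv (cos_transform u) (fun t => - sin_transform (fun x => x * u x) t).
Proof.
move=> su; apply: has_deriv_eq.
  apply: (under_integral_bounded (k := cos) (k' := fun x => - sin x)) => //.
  - exact: has_deriv_cos.
  - by move=> x; apply: continuousN; exact: continuous_sin.
  - by move=> x; rewrite normrN norm_sin_le1.
  - by move=> t; apply/rschwartz_integrable/rschwartz_cosM.
move=> t; rewrite /sin_transform -mulN1r -RintegralZl //; last first.
  by apply/rschwartz_integrable/rschwartz_sinM/rschwartzX.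
by apply: eq_Rintegral => x _; ring.
Qed.

Lemma has_deriv_sin_transform u : rschwartz u ->
  has_deriv (sin_transform u) (cos_transform (fun x => x * u x)).
Proof.
move=> su; apply: (under_integral_bounded (k := sin) (k' := cos)) => //.
- exact: has_deriv_sin.
- exact: continuous_cos.
- exact: norm_cos_le1.
- by move=> t; apply/rschwartz_integrable/rschwartz_sinM.
Qed.

(** The derivative of cos(t x) u(x) has integral 0; expand it. *)
Lemma cos_transform_derive u t : rschwartz u ->
  cos_transform (derive1 u) t = t * sin_transform u t.
Proof.
move=> su; have := rschwartz_integral_derive (rschwartz_cosM t su).
rewrite (has_derivE (has_derivM (has_deriv_cosM t) (rschwartz_deriv su))).
have sc := rschwartz_cosM t (rschwartz_derive su).
have ss := rschwartzZ (- t) (rschwartz_sinM t su).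
rewrite (_ : (fun x => _) = (fun x => - t * (sin (t * x) * u x) + cos (t * x) * derive1 u x));
  last by apply/funext => x; ring.
rewrite RintegralD ?RintegralZl //; do ?exact: rschwartz_integrable.
  by move/eqP; rewrite mulNr addrC subr_eq0 => /eqP.
exact/rschwartz_integrable/rschwartz_sinM.
Qed.

Lemma sin_transform_derive u t : rschwartz u ->
  sin_transform (derive1 u) t = - (t * cos_transform u t).
Proof.
move=> su; have := rschwartz_integral_derive (rschwartz_sinM t su).
rewrite (has_derivE (has_derivM (has_deriv_sinM t) (rschwartz_deriv su))).
have sc := rschwartz_sinM t (rschwartz_derive su).
have ss := rschwartzZ t (rschwartz_cosM t su).
rewrite (_ : (fun x => _) = (fun x => t * (cos (t * x) * u x) + sin (t * x) * derive1 u x));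
  last by apply/funext => x; ring.
rewrite RintegralD ?RintegralZl //; do ?exact: rschwartz_integrable.
  by move/eqP; rewrite addrC addr_eq0 => /eqP.
exact/rschwartz_integrable/rschwartz_cosM.
Qed.

Lemma cos_transformD u v t : rschwartz u -> rschwartz v ->
  cos_transform (fun x => u x + v x) t = cos_transform u t + cos_transform v t.
Proof.
move=> su sv; rewrite /cos_transform -RintegralD //.
- by apply: eq_Rintegral => x _; rewrite mulrDr.
- by apply/rschwartz_integrable/rschwartz_cosM.
- by apply/rschwartz_integrable/rschwartz_cosM.
Qed.

Lemma cos_transformZ (c : R) u t : rschwartz u ->
  cos_transform (fun x => c * u x) t = c * cos_transform u t.
Proof.
move=> su; rewrite /cos_transform -RintegralZl //.
- by apply: eq_Rintegral => x _; rewrite mulrCA.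
- by apply/rschwartz_integrable/rschwartz_cosM.
Qed.

Lemma sin_transformD u v t : rschwartz u -> rschwartz v ->
  sin_transform (fun x => u x + v x) t = sin_transform u t + sin_transform v t.
Proof.
move=> su sv; rewrite /sin_transform -RintegralD //.
- by apply: eq_Rintegral => x _; rewrite mulrDr.
- by apply/rschwartz_integrable/rschwartz_sinM.
- by apply/rschwartz_integrable/rschwartz_sinM.
Qed.

Lemma sin_transformZ (c : R) u t : rschwartz u ->
  sin_transform (fun x => c * u x) t = c * sin_transform u t.
Proof.
move=> su; rewrite /sin_transform -RintegralZl //.
- by apply: eq_Rintegral => x _; rewrite mulrCA.
- by apply/rschwartz_integrable/rschwartz_sinM.
Qed.

Lemma trig_bounded (k : R -> R) u : (forall x, `|k x| <= 1) -> continuous k ->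
  rschwartz u -> forall t, `|\int[mu]_x (k (t * x) * u x)| <= \int[mu]_x `|u x|.
Proof.
move=> k1 ck su t.
have kb : forall x, `|k (t * x) * u x| <= `|u x| by move=> x; rewrite normrM ler_piMl.
have iu := rschwartz_integrable su.
have ku : mu.-integrable setT (EFin \o (fun x => k (t * x) * u x)).
  apply: (@le_integrable _ _ _ mu _ _ _ (EFin \o u)) => //.
  - apply/measurable_EFinP; apply: measurable_funM.
      apply: measurableT_comp; first exact: continuous_measurable_fun.
      by apply: measurable_funM => //; exact: measurable_id.
    exact: rschwartz_measurable.
  - by move=> x _ /=; rewrite lee_fin.
apply: le_trans (le_normr_Rintegral _ ku) _ => //.
apply: le_Rintegral => //.
- exact: (integrable_norm ku).
- exact: (integrable_norm iu).
Qed.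

Lemma cos_transform_bounded u t : rschwartz u -> `|cos_transform u t| <= \int[mu]_x `|u x|.
Proof. by move=> su; apply: (trig_bounded (@norm_cos_le1 R) (@continuous_cos R) su). Qed.

Lemma sin_transform_bounded u t : rschwartz u -> `|sin_transform u t| <= \int[mu]_x `|u x|.
Proof. by move=> su; apply: (trig_bounded (@norm_sin_le1 R) (@continuous_sin R) su). Qed.

Let transform_class w := exists2 u, rschwartz u & w = cos_transform u \/ w = sin_transform u.

(** A power of the variable is traded for a derivative of [u], at the price of exchanging the two
    transforms; hence the joint induction. *)
Let transform_rapid k u : rschwartz u ->
  (exists M, forall x, `|x| ^+ k * `|cos_transform u x| <= M) /\
  (exists M, forall x, `|x| ^+ k * `|sin_transform u x| <= M).
Proof.
elim: k u => [|k IH] u su.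
  by split; exists (\int[mu]_x `|u x|) => t; rewrite expr0 mul1r;
    [apply: cos_transform_bounded|apply: sin_transform_bounded].
have [[M hM] [N hN]] := IH _ (rschwartz_derive su); split.
  by exists N => t; have := hN t; rewrite sin_transform_derive // normrN normrM mulrA -exprSr.
by exists M => t; have := hM t; rewrite cos_transform_derive // normrM mulrA -exprSr.
Qed.

Let transform_class_rschwartz w : transform_class w -> rschwartz w.
Proof.
apply: rschwartz_coind => {}w [u su [->|->]].
- eexists; first exact: has_deriv_cos_transform.
  exists (fun x => - 1 * (x * u x)); first exact/rschwartzZ/rschwartzX.
  by right; apply/funext => t; rewrite sin_transformZ ?mulN1r //; exact: rschwartzX.
- eexists; first exact: has_deriv_sin_transform.
  by exists (fun x => x * u x); [exact/rschwartzX|left].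
- by move=> k; case: (transform_rapid k su).
- by move=> k; case: (transform_rapid k su).
Qed.

Lemma rschwartz_cos_transform u : rschwartz u -> rschwartz (cos_transform u).
Proof. by move=> su; apply: transform_class_rschwartz; exists u => //; left. Qed.

Lemma rschwartz_sin_transform u : rschwartz u -> rschwartz (sin_transform u).
Proof. by move=> su; apply: transform_class_rschwartz; exists u => //; right. Qed.

(** The kernel k(t x) is symmetric in t and x and bounded by 1, so |u(t)| |v(x)| dominates the
    double integrand and the order of integration can be exchanged. *)
Lemma fubini_kernel (k : R -> R) u v : (forall x, `|k x| <= 1) -> continuous k ->
  rschwartz u -> rschwartz v ->
  \int[mu]_t (u t * \int[mu]_x (k (t * x) * v x)) =
  \int[mu]_x ((\int[mu]_t (k (x * t) * u t)) * v x).
Proof.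
move=> k1 ck su sv.
pose F (z : R * R) : \bar R := (u z.1 * (k (z.1 * z.2) * v z.2))%:E.
have mF : measurable_fun setT F.
  apply/measurable_EFinP; apply: measurable_funM.
    by apply: measurableT_comp => //; exact: rschwartz_measurable.
  apply: measurable_funM; last by apply: measurableT_comp => //; exact: rschwartz_measurable.
  by apply: measurableT_comp; [exact: continuous_measurable_fun|exact: measurable_funM].
have ku t : mu.-integrable setT (EFin \o (fun x => k (t * x) * v x)).
  apply: (@le_integrable _ _ _ mu _ _ _ (EFin \o v)) => //.
  - apply/measurable_EFinP; apply: measurable_funM.
      apply: measurableT_comp; first exact: continuous_measurable_fun.
      by apply: measurable_funM => //; exact: measurable_id.
    exact: rschwartz_measurable.
  - by move=> x _ /=; rewrite lee_fin normrM ler_piMl.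
  - exact: rschwartz_integrable.
have kv x : mu.-integrable setT (EFin \o (fun t => k (x * t) * u t)).
  apply: (@le_integrable _ _ _ mu _ _ _ (EFin \o u)) => //.
  - apply/measurable_EFinP; apply: measurable_funM.
      apply: measurableT_comp; first exact: continuous_measurable_fun.
      by apply: measurable_funM => //; exact: measurable_id.
    exact: rschwartz_measurable.
  - by move=> t _ /=; rewrite lee_fin normrM ler_piMl.
  - exact: rschwartz_integrable.
have iF : (mu \x mu)%E.-integrable setT F.
  apply/integrable12ltyP => //.
  apply: (@le_lt_trans _ _ (\int[mu]_t (`|u t| * \int[mu]_x `|v x|)%:E)%E); last first.
    rewrite -ge0_fin_numE; last first.
      by apply: integral_ge0 => t _; rewrite lee_fin mulr_ge0 // Rintegral_ge0.
    apply: integrable_fin_num => //.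
    under eq_fun do rewrite EFinM.
    by apply: integrableZr => //; exact: (integrable_norm (rschwartz_integrable su)).
  apply: ge0_le_integral => //.
  - by move=> t _; apply: integral_ge0.
  - apply: (@measurable_fun_fubini_tonelli_F _ _ _ _ _ mu (fun z => `|F z|%E)) => //.
    exact: measurableT_comp.
  - apply/measurable_EFinP; apply: measurable_funM => //.
    by apply: measurableT_comp => //; exact: rschwartz_measurable.
  - move=> t _; rewrite EFinM /Rintegral fineK; last first.
      by apply: integrable_fin_num => //; exact: (integrable_norm (rschwartz_integrable sv)).
    rewrite -ge0_integralZl //; last first.
      by apply/measurable_EFinP/measurableT_comp => //; exact: rschwartz_measurable.
    apply: ge0_le_integral => //.
    + by apply: measurableT_comp => //; apply: measurableT_comp mF _; exact: measurable_pair1.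
    + apply/measurable_EFinP; apply: measurable_funM => //.
      by apply: measurableT_comp => //; exact: rschwartz_measurable.
    + by move=> x _; rewrite /F /= lee_fin !normrM ler_wpM2l // ler_piMl.
have := Fubini iF.
rewrite /Rintegral => E.
transitivity (fine (\int[mu]_x \int[mu]_y F (x, y))%E).
  congr fine; apply: eq_integral => t _.
  rewrite EFinM fineK; last exact: (integrable_fin_num _ (ku t)).
  rewrite -(integralZl _ (ku t)) //.
rewrite E; congr fine; apply: eq_integral => x _.
rewrite EFinM fineK; last exact: (integrable_fin_num _ (kv x)).
rewrite -(integralZr _ (kv x)) //.
by apply: eq_integral => t _; rewrite /F /= -EFinM (mulrC t x) mulrCA mulrA.
Qed.

Lemma cos_transform_sym u v : rschwartz u -> rschwartz v ->
  \int[mu]_t (u t * cos_transform v t) = \int[mu]_x (cos_transform u x * v x).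
Proof. exact: fubini_kernel (@norm_cos_le1 R) (@continuous_cos R). Qed.

Lemma sin_transform_sym u v : rschwartz u -> rschwartz v ->
  \int[mu]_t (u t * sin_transform v t) = \int[mu]_x (sin_transform u x * v x).
Proof. exact: fubini_kernel (@norm_sin_le1 R) (@continuous_sin R). Qed.

End Transforms.

(** * The norms of the Schwartz space *)

(* Otherwise failed unifications unfold derivatives and integrals. *)
#[local] Opaque derive1 Rintegral rschwartz.

Section NumberOperator.
Variable R : realType.
Implicit Types (u v w : R -> R).
Local Notation mu := (@lebesgue_measure R).

Lemma has_deriv_sqr : has_deriv (fun x : R => x ^+ 2) (fun x => 2 * x).
Proof.
by apply: has_deriv_eq (has_derivM (@has_deriv_id R) (@has_deriv_id R)) _ => x; ring.
Qed.

End NumberOperator.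

Ltac solve_rschwartz :=
  lazymatch goal with
  | |- rschwartz (derive1 _) => apply: rschwartz_derive; solve_rschwartz
  | |- _ => assumption
  end.

Ltac compute_deriv :=
  lazymatch goal with
  | |- has_deriv (fun x => x) _ => apply: has_deriv_id
  | |- has_deriv (fun x => x ^+ 2) _ => apply: has_deriv_sqr
  | |- has_deriv (fun x => @?u x + @?v x) _ =>
      apply: (@has_derivD _ u _ v _); compute_deriv
  | |- has_deriv (fun x => - @?u x) _ => apply: (@has_derivN _ u _); compute_deriv
  | |- has_deriv (fun x => @?u x * @?v x) _ =>
      apply: (@has_derivM _ u _ v _); compute_deriv
  | |- has_deriv (fun x => ?u x) _ => apply: (@rschwartz_deriv _ u); solve_rschwartz
  | |- _ => exact: has_deriv_cst
  end.

(* [ring] and [field] compare atoms up to conversion, which unfolds derivatives. *)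
Ltac generalize_derive :=
  repeat match goal with
  | |- context [derive1 ?f ?x] => let d := fresh "d" in move: (derive1 f x) => d
  end.

Section NumberOperator.
Variable R : realType.
Implicit Types (u v w : R -> R).
Local Notation mu := (@lebesgue_measure R).

Definition rnumber_op1 u : R -> R :=
  fun x => 2^-1 * (- derive1 (derive1 u) x + x ^+ 2 * u x + u x).

Definition inner u v : R := \int[mu]_x (u x * v x).

Definition l2norm u : R := Num.sqrt (inner u u).

Definition rsnorm (m : nat) u : R := l2norm (iter m rnumber_op1 u).

Lemma rschwartz_sqrX u : rschwartz u -> rschwartz (fun x => x ^+ 2 * u x).
Proof.
move=> su; have := rschwartzX (rschwartzX su); congr rschwartz.
by apply/funext => x; ring.
Qed.

Lemma rschwartz_number_op1 u : rschwartz u -> rschwartz (rnumber_op1 u).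
Proof.
move=> su; apply: rschwartzZ; apply: rschwartzD => //; apply: rschwartzD.
  by apply: rschwartzN; do 2 apply: rschwartz_derive.
exact: rschwartz_sqrX.
Qed.

Lemma rschwartz_iter_number_op1 m u : rschwartz u -> rschwartz (iter m rnumber_op1 u).
Proof. by move=> su; elim: m => //= m; apply: rschwartz_number_op1. Qed.

Lemma derive1_D u v : rschwartz u -> rschwartz v ->
  derive1 (fun x => u x + v x) = fun x => derive1 u x + derive1 v x.
Proof. by move=> su sv; apply: has_derivE; compute_deriv. Qed.

Lemma derive1_Z (c : R) u : rschwartz u ->
  derive1 (fun x => c * u x) = fun x => c * derive1 u x.
Proof. by move=> su; apply: has_derivE; apply: has_derivZ; exact: rschwartz_deriv. Qed.

Lemma rnumber_op1D u v : rschwartz u -> rschwartz v ->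
  rnumber_op1 (fun x => u x + v x) = fun x => rnumber_op1 u x + rnumber_op1 v x.
Proof.
move=> su sv; apply/funext => x; rewrite /rnumber_op1 !derive1_D //; try solve_rschwartz.
by generalize_derive; ring.
Qed.

Lemma rnumber_op1Z (c : R) u : rschwartz u ->
  rnumber_op1 (fun x => c * u x) = fun x => c * rnumber_op1 u x.
Proof.
move=> su; apply/funext => x; rewrite /rnumber_op1 !derive1_Z //; try solve_rschwartz.
by generalize_derive; ring.
Qed.

Lemma iter_number_op1D m u v : rschwartz u -> rschwartz v ->
  iter m rnumber_op1 (fun x => u x + v x) =
  fun x => iter m rnumber_op1 u x + iter m rnumber_op1 v x.
Proof.
move=> su sv; elim: m => //= m ->.
by rewrite rnumber_op1D //; exact: rschwartz_iter_number_op1.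
Qed.

Lemma iter_number_op1Z m (c : R) u : rschwartz u ->
  iter m rnumber_op1 (fun x => c * u x) = fun x => c * iter m rnumber_op1 u x.
Proof.
move=> su; elim: m => //= m ->.
by rewrite rnumber_op1Z //; exact: rschwartz_iter_number_op1.
Qed.

(** * The inner product of L2 *)

Lemma innerC u v : inner u v = inner v u.
Proof. by apply: eq_Rintegral => x _; rewrite mulrC. Qed.

Lemma innerDl u v w : rschwartz u -> rschwartz v -> rschwartz w ->
  inner (fun x => u x + v x) w = inner u w + inner v w.
Proof.
move=> su sv sw; rewrite /inner -RintegralD //;
  try by apply: rschwartz_integrable; apply: rschwartzM.
by apply: eq_Rintegral => x _; rewrite mulrDl.
Qed.

Lemma innerZl (c : R) u v : rschwartz u -> rschwartz v ->
  inner (fun x => c * u x) v = c * inner u v.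
Proof.
move=> su sv; rewrite /inner -RintegralZl //; last first.
  by apply: rschwartz_integrable; apply: rschwartzM.
by apply: eq_Rintegral => x _; rewrite mulrA.
Qed.

Lemma innerDr u v w : rschwartz u -> rschwartz v -> rschwartz w ->
  inner u (fun x => v x + w x) = inner u v + inner u w.
Proof. by move=> su sv sw; rewrite innerC innerDl // ![inner _ u]innerC. Qed.

Lemma innerZr (c : R) u v : rschwartz u -> rschwartz v ->
  inner u (fun x => c * v x) = c * inner u v.
Proof. by move=> su sv; rewrite innerC innerZl // innerC. Qed.

Lemma inner_ge0 u : 0 <= inner u u.
Proof. by apply: Rintegral_ge0 => x _; rewrite -expr2 sqr_ge0. Qed.

Lemma l2norm_ge0 u : 0 <= l2norm u.
Proof. exact: sqrtr_ge0. Qed.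

Lemma sqr_l2norm u : l2norm u ^+ 2 = inner u u.
Proof. by rewrite sqr_sqrtr // inner_ge0. Qed.

Lemma cauchy_schwarz u v : rschwartz u -> rschwartz v ->
  `|inner u v| <= l2norm u * l2norm v.
Proof.
move=> su sv.
have q (t : R) : 0 <= inner u u + 2 * t * inner u v + t ^+ 2 * inner v v.
  have stv := rschwartzZ t sv; have := inner_ge0 (fun x => u x + t * v x).
  rewrite innerDl ?innerDr //; try exact: rschwartzD.
  rewrite !innerZl ?innerZr // (innerC v u) => h.
  by apply: le_trans h _; rewrite le_eqVlt; apply/orP; left; apply/eqP; generalize_derive; ring.
have h2 : inner u v ^+ 2 <= inner u u * inner v v.
  have [v0|v0] := eqVneq (inner v v) 0.
    rewrite v0 mulr0; suff -> : inner u v = 0 by rewrite expr0n.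
    apply/eqP; apply: contraT => uv0.
    (* With <v, v> = 0 the polynomial of [q] is affine in t, and this t makes it equal to -1. *)
    have := q (- (inner u u + 1) / (2 * inner u v)).
    rewrite v0 mulr0 addr0.
    have -> : 2 * (- (inner u u + 1) / (2 * inner u v)) * inner u v = - (inner u u + 1).
      by generalize_derive; field.
    by lra.
  have vv : 0 < inner v v by rewrite lt_neqAle eq_sym v0 inner_ge0.
  (* The point where the quadratic polynomial is minimal. *)
  have := q (- inner u v / inner v v).
  have -> : inner u u + 2 * (- inner u v / inner v v) * inner u v +
     (- inner u v / inner v v) ^+ 2 * inner v v =
     (inner u u * inner v v - inner u v ^+ 2) / inner v v.
    by generalize_derive; field.
  by rewrite pmulr_lge0 ?invr_gt0 // subr_ge0.
rewrite -sqrtr_sqr /l2norm -sqrtrM ?inner_ge0 //.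
exact: ler_wsqrtr.
Qed.

Lemma l2normD u v : rschwartz u -> rschwartz v ->
  l2norm (fun x => u x + v x) <= l2norm u + l2norm v.
Proof.
move=> su sv; rewrite -(@ler_pXn2r _ 2) ?nnegrE ?addr_ge0 ?l2norm_ge0 //.
rewrite sqr_l2norm innerDl ?innerDr //; try exact: rschwartzD.
rewrite (innerC v u) sqrrD !sqr_l2norm.
have := le_trans (ler_norm _) (cauchy_schwarz su sv).
by rewrite mulr2n; lra.
Qed.

Lemma l2normZ (c : R) u : rschwartz u -> l2norm (fun x => c * u x) = `|c| * l2norm u.
Proof.
move=> su; rewrite /l2norm innerZl ?innerZr //; last exact: rschwartzZ.
by rewrite mulrA -expr2 sqrtrM ?sqr_ge0 // sqrtr_sqr.
Qed.

Lemma l2norm_le u (M : R) : 0 <= M -> inner u u <= M ^+ 2 -> l2norm u <= M.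
Proof.
by move=> M0 h; rewrite -(@ler_pXn2r _ 2) ?nnegrE ?l2norm_ge0 // sqr_l2norm.
Qed.

(* Annihilation and creation operators of the oscillator [- d^2/dx^2 + c^2 x^2]. *)
Definition lower (c : R) u : R -> R := fun x => c * x * u x + derive1 u x.
Definition raise (c : R) u : R -> R := fun x => c * x * u x - derive1 u x.

Lemma rschwartz_cX (c : R) u : rschwartz u -> rschwartz (fun x => c * x * u x).
Proof.
move=> su; have := rschwartzZ c (rschwartzX su); congr rschwartz.
by apply/funext => x; generalize_derive; ring.
Qed.

Lemma rschwartz_lower c u : rschwartz u -> rschwartz (lower c u).
Proof.
by move=> su; apply: rschwartzD; [exact: rschwartz_cX|exact: rschwartz_derive].
Qed.

Lemma rschwartz_raise c u : rschwartz u -> rschwartz (raise c u).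
Proof.
by move=> su; apply: rschwartzB; [exact: rschwartz_cX|exact: rschwartz_derive].
Qed.

Lemma inner_raise c u v : rschwartz u -> rschwartz v ->
  inner (raise c u) v = inner u (lower c v).
Proof.
move=> su sv; have su' := rschwartz_derive su; have sv' := rschwartz_derive sv.
have sx := rschwartz_cX c su; have sy := rschwartz_cX c sv.
rewrite innerDl ?innerDr //; last exact: rschwartzN.
congr (_ + _); first by apply: eq_Rintegral => x _; generalize_derive; ring.
rewrite -[RHS]opprK -(rschwartz_ibp su sv) /inner -mulN1r -RintegralZl //.
  by apply: eq_Rintegral => x _; generalize_derive; ring.
by apply/rschwartz_integrable/rschwartzM.
Qed.

Lemma derive1_lower c u : rschwartz u ->
  derive1 (lower c u) = fun x => lower c (derive1 u) x + c * u x.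
Proof.
move=> su; apply: has_derivE; apply: has_deriv_eq; first by rewrite /lower; compute_deriv.
by move=> x; rewrite /lower /=; generalize_derive; ring.
Qed.

Lemma derive1_raise c u : rschwartz u ->
  derive1 (raise c u) = fun x => raise c (derive1 u) x + c * u x.
Proof.
move=> su; apply: has_derivE; apply: has_deriv_eq; first by rewrite /raise; compute_deriv.
by move=> x; rewrite /raise /=; generalize_derive; ring.
Qed.

Lemma raise_lower c u x : rschwartz u ->
  raise c (lower c u) x = c ^+ 2 * x ^+ 2 * u x - derive1 (derive1 u) x - c * u x.
Proof.
by move=> su; rewrite {1}/raise derive1_lower // /lower; generalize_derive; ring.
Qed.

Lemma lower_raise c u x : rschwartz u ->
  lower c (raise c u) x = c ^+ 2 * x ^+ 2 * u x - derive1 (derive1 u) x + c * u x.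
Proof.
by move=> su; rewrite {1}/lower derive1_raise // /raise; generalize_derive; ring.
Qed.

(** For c = 1 the ladder operators factor the operator that defines the norms. Their L2 bounds and
    the symmetry of [N + 1] rest on this factorisation and the next one. *)
Lemma raise_lower1 u : rschwartz u ->
  raise 1 (lower 1 u) = fun x => 2 * rnumber_op1 u x + (- 2) * u x.
Proof. by move=> su; apply/funext => x; rewrite raise_lower // /rnumber_op1; generalize_derive; field. Qed.

Lemma lower_raise1 u : rschwartz u ->
  lower 1 (raise 1 u) = fun x => 2 * rnumber_op1 u x.
Proof. by move=> su; apply/funext => x; rewrite lower_raise // /rnumber_op1; generalize_derive; field. Qed.

Lemma derive1_number_op1 u : rschwartz u ->
  derive1 (rnumber_op1 u) = fun x => rnumber_op1 (derive1 u) x + x * u x.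
Proof.
move=> su; apply: has_derivE; apply: has_deriv_eq; first by rewrite /rnumber_op1; compute_deriv.
by move=> x; rewrite /rnumber_op1 /=; generalize_derive; field.
Qed.

Lemma number_op1_lower u : rschwartz u ->
  rnumber_op1 (lower 1 u) = fun x => lower 1 (rnumber_op1 u) x + (-1) * lower 1 u x.
Proof.
move=> su; have su' := rschwartz_derive su; have sl := rschwartz_lower 1 su'.
apply/funext => x.
rewrite {1}/rnumber_op1 derive1_lower // derive1_D ?derive1_lower ?derive1_Z //; last exact: rschwartzZ.
by rewrite /lower derive1_number_op1 // /rnumber_op1; generalize_derive; field.
Qed.

Lemma number_op1_raise u : rschwartz u ->
  rnumber_op1 (raise 1 u) = fun x => raise 1 (rnumber_op1 u) x + raise 1 u x.
Proof.
move=> su; have su' := rschwartz_derive su; have sl := rschwartz_raise 1 su'.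
apply/funext => x.
rewrite {1}/rnumber_op1 derive1_raise // derive1_D ?derive1_raise ?derive1_Z //; last exact: rschwartzZ.
by rewrite /raise derive1_number_op1 // /rnumber_op1; generalize_derive; field.
Qed.

Lemma inner_lower1 u : rschwartz u ->
  inner (lower 1 u) (lower 1 u) = 2 * inner (rnumber_op1 u) u - 2 * inner u u.
Proof.
move=> su; have sl := rschwartz_lower 1 su; have sn := rschwartz_number_op1 su.
rewrite -(inner_raise 1 sl su) (raise_lower1 su).
rewrite (innerDl (rschwartzZ 2 sn) (rschwartzZ (-2) su) su).
by rewrite (innerZl 2 sn su) (innerZl (-2) su su) mulNr.
Qed.

Lemma inner_raise1 u : rschwartz u ->
  inner (raise 1 u) (raise 1 u) = 2 * inner (rnumber_op1 u) u.
Proof.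
move=> su; have sl := rschwartz_raise 1 su; have sn := rschwartz_number_op1 su.
by rewrite (inner_raise 1 su sl) (lower_raise1 su) (innerZr 2 su sn) innerC.
Qed.

(** The square norm of [lower 1 u] is nonnegative, which means [N + 1 >= 1]; with Cauchy-Schwarz,
    the norms of S increase with their index. *)
Lemma l2norm_number_op1 u : rschwartz u -> l2norm u <= l2norm (rnumber_op1 u).
Proof.
move=> su; have sn := rschwartz_number_op1 su.
have h : inner u u <= inner (rnumber_op1 u) u.
  by have := inner_ge0 (lower 1 u); rewrite inner_lower1 //; lra.
have := le_trans (ler_norm _) (cauchy_schwarz sn su).
rewrite -sqr_l2norm in h => /(le_trans h); rewrite expr2.
have := l2norm_ge0 u; rewrite le_eqVlt => /predU1P[<- _|u0]; first exact: l2norm_ge0.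
by rewrite ler_pM2r.
Qed.

(** * The norms of S and continuity with respect to them *)

Lemma rsnorm_ge0 m u : 0 <= rsnorm m u.
Proof. exact: l2norm_ge0. Qed.

Lemma rsnormD m u v : rschwartz u -> rschwartz v ->
  rsnorm m (fun x => u x + v x) <= rsnorm m u + rsnorm m v.
Proof.
move=> su sv; rewrite /rsnorm iter_number_op1D //.
by apply: l2normD; apply: rschwartz_iter_number_op1.
Qed.

Lemma rsnormZ m (c : R) u : rschwartz u -> rsnorm m (fun x => c * u x) = `|c| * rsnorm m u.
Proof.
move=> su; rewrite /rsnorm iter_number_op1Z //.
by apply: l2normZ; apply: rschwartz_iter_number_op1.
Qed.

Lemma rsnormN m u : rschwartz u -> rsnorm m (fun x => - u x) = rsnorm m u.
Proof.
move=> su; rewrite (_ : (fun x => - u x) = fun x => (-1) * u x).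
  by rewrite rsnormZ // normrN1 mul1r.
by apply/funext => x; rewrite mulN1r.
Qed.

Lemma rsnormB m u v : rschwartz u -> rschwartz v ->
  rsnorm m (fun x => u x - v x) <= rsnorm m u + rsnorm m v.
Proof.
by move=> su sv; rewrite -(rsnormN m sv); apply: rsnormD => //; exact: rschwartzN.
Qed.

Lemma rsnormS m u : rsnorm m.+1 u = rsnorm m (rnumber_op1 u).
Proof. by rewrite /rsnorm iterSr. Qed.

Lemma rsnorm_le m n u : (m <= n)%N -> rschwartz u -> rsnorm m u <= rsnorm n u.
Proof.
move=> /subnK <- su; elim: (n - m)%N => [//|k IH]; apply: le_trans IH _.
by rewrite addSn; apply: l2norm_number_op1; exact: rschwartz_iter_number_op1.
Qed.

(** As the norms increase with their index, one norm replaces a maximum of finitely many. *)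
Definition dominated (q : (R -> R) -> R) :=
  exists C p, 0 <= C /\ forall u, rschwartz u -> q u <= C * rsnorm p u.

Lemma dominated_rsnorm m : dominated (rsnorm m).
Proof. by exists 1, m; split => // u _; rewrite mul1r. Qed.

Lemma dominated_le q q' : dominated q -> (forall u, rschwartz u -> q' u <= q u) ->
  dominated q'.
Proof.
move=> [C [p [C0 h]]] qq; exists C, p; split => // u su.
by apply: le_trans (qq _ su) (h _ su).
Qed.

Lemma dominatedD q q' : dominated q -> dominated q' -> dominated (fun u => q u + q' u).
Proof.
move=> [C [p [C0 h]]] [C' [p' [C0' h']]]; exists (C + C'), (maxn p p').
split; first exact: addr_ge0.
move=> u su; rewrite mulrDl; apply: lerD.
  apply: le_trans (h _ su) _; apply: ler_wpM2l => //.
  by apply: rsnorm_le => //; exact: leq_maxl.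
apply: le_trans (h' _ su) _; apply: ler_wpM2l => //.
by apply: rsnorm_le => //; exact: leq_maxr.
Qed.

Lemma dominatedZ q (c : R) : 0 <= c -> dominated q -> dominated (fun u => c * q u).
Proof.
move=> c0 [C [p [C0 h]]]; exists (c * C), p; split; first exact: mulr_ge0.
by move=> u su; rewrite -mulrA; apply: ler_wpM2l => //; exact: h.
Qed.

Definition scontinuous (U : (R -> R) -> R -> R) :=
  (forall u, rschwartz u -> rschwartz (U u)) /\
  forall m, dominated (fun u => rsnorm m (U u)).

Lemma dominated_comp q U : dominated q -> scontinuous U -> dominated (fun u => q (U u)).
Proof.
move=> [C [p [C0 h]]] [sU hU].
apply: dominated_le (dominatedZ C0 (hU p)) _ => u su.
by apply: h; exact: sU.
Qed.

Lemma scontinuous_comp U V : scontinuous U -> scontinuous V -> scontinuous (fun u => U (V u)).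
Proof.
move=> cU cV; split=> [u su|m]; first by apply: cU.1; apply: cV.1.
exact: (dominated_comp (cU.2 m) cV).
Qed.

Lemma scontinuousD U V : scontinuous U -> scontinuous V ->
  scontinuous (fun u x => U u x + V u x).
Proof.
move=> cU cV; split=> [u su|m]; first by apply: rschwartzD; [apply: cU.1|apply: cV.1].
apply: dominated_le (dominatedD (cU.2 m) (cV.2 m)) _ => u su.
by apply: rsnormD; [apply: cU.1|apply: cV.1].
Qed.

Lemma scontinuousZ (c : R) U : scontinuous U -> scontinuous (fun u x => c * U u x).
Proof.
move=> cU; split=> [u su|m]; first by apply: rschwartzZ; apply: cU.1.
apply: dominated_le (dominatedZ (normr_ge0 c) (cU.2 m)) _ => u su.
by rewrite rsnormZ //; apply: cU.1.
Qed.

Lemma scontinuous_id : scontinuous id.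
Proof. by split => // m; exact: dominated_rsnorm. Qed.

Lemma scontinuous_number_op1 : scontinuous rnumber_op1.
Proof.
split=> [u|m]; first exact: rschwartz_number_op1.
apply: dominated_le (dominated_rsnorm m.+1) _ => u su.
by rewrite rsnormS.
Qed.

(** Both ladder operators fit the hypothesis. Its right-hand side is at most 2 |(N + 1) u| |u|,
    hence at most 2 |(N + 1) u|^2. *)
Lemma rsnorm0_ladder_le u w : rschwartz u -> inner w w <= 2 * inner (rnumber_op1 u) u ->
  rsnorm 0 w <= 2 * rsnorm 1 u.
Proof.
move=> su h; apply: l2norm_le; first by rewrite mulr_ge0 // rsnorm_ge0.
have sn := rschwartz_number_op1 su.
have := le_trans (ler_norm _) (cauchy_schwarz sn su).
have := l2norm_number_op1 su; have := l2norm_ge0 u; have := l2norm_ge0 (rnumber_op1 u).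
rewrite /rsnorm /= in h *.
set a := l2norm u; set b := l2norm (rnumber_op1 u); set c := inner _ _ in h *.
by move=> b0 a0 ab cab; rewrite exprMn; nra.
Qed.

(** [N + 1] commutes with [lower 1] up to [- lower 1], which reduces the norm of index m + 1 to
    norms of index m. Multiplication by x and d/dx are combinations of the two ladder operators and
    inherit their continuity. *)
Lemma scontinuous_lower : scontinuous (lower 1).
Proof.
split=> [u|m]; first exact: rschwartz_lower.
elim: m => [|m IH].
  apply: dominated_le (dominatedZ (ler0n R 2) (dominated_rsnorm 1)) _ => u su.
  apply: rsnorm0_ladder_le => //; rewrite inner_lower1 //.
  by have := inner_ge0 u; lra.
apply: dominated_le (dominatedD (dominated_comp IH scontinuous_number_op1) IH) _ => u su.
have sl := rschwartz_lower 1 su.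
rewrite rsnormS number_op1_lower //.
have sl2 := rschwartz_lower 1 (rschwartz_number_op1 su).
apply: le_trans (rsnormD _ sl2 (rschwartzZ (-1) sl)) _.
by rewrite rsnormZ // normrN1 mul1r.
Qed.

Lemma scontinuous_raise : scontinuous (raise 1).
Proof.
split=> [u|m]; first exact: rschwartz_raise.
elim: m => [|m IH].
  apply: dominated_le (dominatedZ (ler0n R 2) (dominated_rsnorm 1)) _ => u su.
  by apply: rsnorm0_ladder_le => //; rewrite inner_raise1.
apply: dominated_le (dominatedD (dominated_comp IH scontinuous_number_op1) IH) _ => u su.
rewrite rsnormS number_op1_raise //.
by apply: rsnormD; apply: rschwartz_raise => //; exact: rschwartz_number_op1.
Qed.

Lemma scontinuousX : scontinuous (fun u x => x * u x).
Proof.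
have := scontinuousZ 2^-1 (scontinuousD scontinuous_lower scontinuous_raise).
congr scontinuous; apply/funext => u; apply/funext => x.
by rewrite /lower /raise; generalize_derive; field.
Qed.

Lemma scontinuous_derive : scontinuous (fun u => derive1 u).
Proof.
have := scontinuousZ 2^-1
  (scontinuousD scontinuous_lower (scontinuousZ (-1) scontinuous_raise)).
congr scontinuous; apply/funext => u; apply/funext => x.
by rewrite /lower /raise; generalize_derive; field.
Qed.

(** Sobolev embedding: u^2 is bounded by the integral of |2 u u'|, hence by that of u^2 + u'^2. *)
Lemma sup_dominated : exists C p, 0 <= C /\
  forall u x, rschwartz u -> `|u x| <= C * rsnorm p u.
Proof.
have [C [p [C0 h]]] := dominatedD (dominated_rsnorm 0)
  (dominated_comp (dominated_rsnorm 0) scontinuous_derive).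
exists C, p; split => // u x su; apply: le_trans (h _ su).
have su' := rschwartz_derive su.
have i1 := rschwartz_integrable (rschwartzM su su).
have i2 := rschwartz_integrable (rschwartzM su' su').
have : `|u x * u x| <= inner u u + inner (derive1 u) (derive1 u).
  apply: le_trans (rschwartz_le_integral x (rschwartzM su su)) _.
  rewrite /inner -RintegralD //.
  apply: le_Rintegral => //.
  - by apply: integrable_norm; apply/rschwartz_integrable/rschwartz_derive/rschwartzM.
  - exact: Rintegrable_add.
  - move=> y _; rewrite (has_derivE (has_derivM (rschwartz_deriv su) (rschwartz_deriv su))).
    rewrite ler_norml; have := sqr_ge0 (u y - derive1 u y).
    by have := sqr_ge0 (u y + derive1 u y); rewrite sqrrD sqrrB !mulr2n => *; apply/andP; split; nra.
rewrite -!sqr_l2norm normrM -expr2 /rsnorm /=.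
set a := l2norm u; set b := l2norm _ => hx.
rewrite -(@ler_pXn2r _ 2) ?nnegrE ?addr_ge0 ?l2norm_ge0 //.
apply: le_trans hx _; rewrite sqrrD.
have a0 : 0 <= a by exact: l2norm_ge0.
have b0 : 0 <= b by exact: l2norm_ge0.
by rewrite mulr2n; nra.
Qed.

Lemma decay_dominated : exists C p, 0 <= C /\
  forall u x, rschwartz u -> (1 + x ^+ 2) * `|u x| <= C * rsnorm p u.
Proof.
have [C [p [C0 h]]] := sup_dominated.
have [D [q [D0 k]]] := dominatedZ C0 (dominatedD (dominated_rsnorm p)
  (dominated_comp (dominated_rsnorm p) (scontinuous_comp scontinuousX scontinuousX))).
exists D, q; split => // u x su; apply: le_trans (k _ su).
rewrite mulrDr mulrDl mul1r; apply: lerD; first exact: h.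
rewrite -[x ^+ 2]ger0_norm ?sqr_ge0 // -normrM expr2 -mulrA.
exact: (h (fun x => x * (x * u x)) x (rschwartzX (rschwartzX su))).
Qed.

Lemma L1_dominated : dominated (fun u => \int[mu]_x `|u x|).
Proof.
have [C [p [C0 h]]] := decay_dominated.
exists (C * pi), p; split; first by rewrite mulr_ge0 // pi_ge0.
move=> u su; rewrite mulrAC.
apply: decay_norm_integral; first exact: rschwartz_measurable.
by move=> x; exact: h.
Qed.

(** The integral of u^2 is at most M^2 pi; the factor [1 + pi] is a crude bound for the square root
    of pi. *)
Lemma l2norm_le_decay u (M : R) : rschwartz u -> (forall x, (1 + x ^+ 2) * `|u x| <= M) ->
  l2norm u <= M * (1 + pi).
Proof.
move=> su hM; have M0 := decay_ge0 hM.
have p0 := pi_ge0 R.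
apply: l2norm_le; first by rewrite mulr_ge0 // addr_ge0.
have h : inner u u <= M ^+ 2 * pi.
  apply: le_trans (ler_norm _) _; apply: decay_integral_norm.
    by apply: rschwartz_measurable; exact: rschwartzM.
  move=> x; rewrite normrM -expr2.
  have a0 := normr_ge0 (u x); have := hM x; have := sqr_ge0 x.
  set a := `|u x| in a0 *; set y := x ^+ 2 => y0 h.
  have h1 : ((1 + y) * a) ^+ 2 <= M ^+ 2 by rewrite ler_pXn2r // nnegrE mulr_ge0 // addr_ge0.
  apply: le_trans h1; rewrite exprMn; apply: ler_wpM2r; first exact: sqr_ge0.
  by nra.
apply: le_trans h _; rewrite exprMn; apply: ler_wpM2l; first exact: sqr_ge0.
by nra.
Qed.

End NumberOperator.

(** * Continuity of products and transforms *)

Section Continuity.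
Variable R : realType.
Implicit Types (u v w : R -> R).
Local Notation mu := (@lebesgue_measure R).

Definition bidominated (Q : (R -> R) -> (R -> R) -> R) :=
  exists C p, 0 <= C /\ forall u v, rschwartz u -> rschwartz v ->
    Q u v <= C * (rsnorm p u * rsnorm p v).

Lemma bidominated_le Q Q' : bidominated Q ->
  (forall u v, rschwartz u -> rschwartz v -> Q' u v <= Q u v) -> bidominated Q'.
Proof.
move=> [C [p [C0 h]]] QQ; exists C, p; split => // u v su sv.
exact: le_trans (QQ _ _ su sv) (h _ _ su sv).
Qed.

Lemma bidominated_mono C p q u v : 0 <= C -> (p <= q)%N -> rschwartz u -> rschwartz v ->
  C * (rsnorm p u * rsnorm p v) <= C * (rsnorm q u * rsnorm q v).
Proof.
move=> C0 pq su sv; apply: ler_wpM2l => //.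
by apply: ler_pM; rewrite ?rsnorm_ge0 //; apply: rsnorm_le.
Qed.

Lemma bidominatedD Q Q' : bidominated Q -> bidominated Q' ->
  bidominated (fun u v => Q u v + Q' u v).
Proof.
move=> [C [p [C0 h]]] [C' [p' [C0' h']]]; exists (C + C'), (maxn p p').
split; first exact: addr_ge0.
move=> u v su sv; rewrite mulrDl; apply: lerD.
  by apply: le_trans (h _ _ su sv) _; apply: bidominated_mono => //; exact: leq_maxl.
by apply: le_trans (h' _ _ su sv) _; apply: bidominated_mono => //; exact: leq_maxr.
Qed.

Lemma bidominated_comp Q U V : bidominated Q -> scontinuous U -> scontinuous V ->
  bidominated (fun u v => Q (U u) (V v)).
Proof.
move=> [C [p [C0 h]]] [sU /(_ p)[C1 [p1 [C10 h1]]]] [sV /(_ p)[C2 [p2 [C20 h2]]]].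
exists (C * (C1 * C2)), (maxn p1 p2); split; first by rewrite !mulr_ge0.
move=> u v su sv; apply: le_trans (h _ _ (sU _ su) (sV _ sv)) _.
rewrite -mulrA; apply: ler_wpM2l => //; rewrite mulrACA.
apply: ler_pM; rewrite ?rsnorm_ge0 //.
  apply: le_trans (h1 _ su) _; apply: ler_wpM2l => //.
  by apply: rsnorm_le => //; exact: leq_maxl.
apply: le_trans (h2 _ sv) _; apply: ler_wpM2l => //.
by apply: rsnorm_le => //; exact: leq_maxr.
Qed.

(** The Leibniz rule, arranged so that every term is a product of continuous operators applied to
    [u] and to [v]; this drives the induction on the index for products. *)
Lemma number_op1M u v : rschwartz u -> rschwartz v ->
  rnumber_op1 (fun x => u x * v x) = fun x => u x * rnumber_op1 v x +
    (- 2^-1) * (derive1 (derive1 u) x * v x) + (-1) * (derive1 u x * derive1 v x).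
Proof.
move=> su sv; have su' := rschwartz_derive su; have sv' := rschwartz_derive sv.
apply/funext => x; rewrite {1}/rnumber_op1.
have -> : derive1 (fun x => u x * v x) = fun x => derive1 u x * v x + u x * derive1 v x.
  by apply: has_derivE; apply: has_derivM; exact: rschwartz_deriv.
have -> : derive1 (fun x => derive1 u x * v x + u x * derive1 v x) =
    fun x => (derive1 (derive1 u) x * v x + derive1 u x * derive1 v x) +
             (derive1 u x * derive1 v x + u x * derive1 (derive1 v) x).
  by apply: has_derivE; apply: has_derivD; apply: has_derivM; exact: rschwartz_deriv.
by rewrite /rnumber_op1; generalize_derive; field.
Qed.

Lemma bidominatedM m : bidominated (fun u v => rsnorm m (fun x => u x * v x)).
Proof.
elim: m => [|m IH].
  (* In L2 a product is bounded by the supremum of u times the norm of v. *)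
  have [C [p [C0 h]]] := @sup_dominated R.
  exists C, p; split => // u v su sv.
  have l2v : l2norm v <= rsnorm p v by apply: (rsnorm_le (m := 0)).
  apply: (@le_trans _ _ (C * rsnorm p u * l2norm v)); last first.
    by rewrite -mulrA; apply: ler_wpM2l => //; apply: ler_wpM2l => //; exact: rsnorm_ge0.
  have C1 : 0 <= C * rsnorm p u by rewrite mulr_ge0 // rsnorm_ge0.
  apply: l2norm_le; first by rewrite mulr_ge0 // l2norm_ge0.
  rewrite exprMn sqr_l2norm -RintegralZl //; last by apply/rschwartz_integrable/rschwartzM.
  apply: le_Rintegral => //.
  - by apply/rschwartz_integrable; do 2 apply: rschwartzM => //.
  - by apply: Rintegrable_scale => //; apply/rschwartz_integrable/rschwartzM.
  - move=> x _; have hx := h u x su.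
    rewrite mulrACA -!expr2; apply: ler_wpM2r; first exact: sqr_ge0.
    by rewrite -(real_normK (num_real (u x))) ler_pXn2r // nnegrE.
have h1 := bidominated_comp IH (@scontinuous_id R) (@scontinuous_number_op1 R).
have h2 := bidominated_comp IH (scontinuous_comp (@scontinuous_derive R)
  (@scontinuous_derive R)) (@scontinuous_id R).
have h3 := bidominated_comp IH (@scontinuous_derive R) (@scontinuous_derive R).
apply: bidominated_le (bidominatedD (bidominatedD h1 h2) h3) _ => u v su sv.
have su' := rschwartz_derive su; have sv' := rschwartz_derive sv.
have su'' := rschwartz_derive su'; have sn := rschwartz_number_op1 sv.
have s1 := rschwartzM su sn; have s2 := rschwartzM su'' sv; have s3 := rschwartzM su' sv'.
rewrite rsnormS number_op1M //.
apply: le_trans (rsnormD m (rschwartzD s1 (rschwartzZ (- 2^-1) s2)) (rschwartzZ (-1) s3)) _.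
rewrite (rsnormZ m (-1) s3) normrN1 mul1r; apply: lerD => //.
apply: le_trans (rsnormD m s1 (rschwartzZ (- 2^-1) s2)) _.
rewrite (rsnormZ m _ s2) normrN; apply: lerD => //.
rewrite ger0_norm ?invr_ge0 // ler_piMl ?rsnorm_ge0 //.
by rewrite invf_le1 // ler1n.
Qed.

Lemma scontinuous_iter_number_op1 m : scontinuous (fun u : R -> R => iter m (@rnumber_op1 R) u).
Proof.
elim: m => [|m IH]; first exact: scontinuous_id.
exact: (scontinuous_comp (@scontinuous_number_op1 R) IH).
Qed.

Lemma derive1_cos_transform u : rschwartz u ->
  derive1 (cos_transform u) = fun t => - sin_transform (fun x => x * u x) t.
Proof. by move=> su; apply: has_derivE; exact: has_deriv_cos_transform. Qed.

Lemma derive1_sin_transform u : rschwartz u ->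
  derive1 (sin_transform u) = cos_transform (fun x => x * u x).
Proof. by move=> su; apply: has_derivE; exact: has_deriv_sin_transform. Qed.

Lemma rnumber_op1_split u x : rnumber_op1 u x =
  2^-1 * ((-1) * derive1 (derive1 u) x + x * (x * u x) + u x).
Proof. by rewrite /rnumber_op1; generalize_derive; ring. Qed.

(** The transform exchanges x^2 and - d^2/dx^2, which enter [N + 1] symmetrically. *)
Lemma rnumber_op1_cos_transform u : rschwartz u ->
  rnumber_op1 (cos_transform u) = cos_transform (rnumber_op1 u).
Proof.
move=> su; have su' := rschwartz_derive su; have su'' := rschwartz_derive su'.
have sx := rschwartzX su; have sxx := rschwartzX sx.
have dc : derive1 (derive1 (cos_transform u)) =
    fun t => - cos_transform (fun x => x * (x * u x)) t.
  rewrite derive1_cos_transform //; apply: has_derivE; apply: has_derivN.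
  exact: has_deriv_sin_transform.
have -> : rnumber_op1 u = fun x => 2^-1 * (((-1) * derive1 (derive1 u) x + x * (x * u x)) + u x).
  by apply/funext => x; rewrite rnumber_op1_split.
apply/funext => t; rewrite rnumber_op1_split dc.
have s1 := rschwartzZ (-1) su''; have s2 := rschwartzD s1 sxx.
rewrite (cos_transformZ _ t (rschwartzD s2 su)) (cos_transformD t s2 su).
rewrite (cos_transformD t s1 sxx) (cos_transformZ _ t su'').
rewrite (cos_transform_derive t su') (sin_transform_derive t su).
by ring.
Qed.

Lemma rnumber_op1_sin_transform u : rschwartz u ->
  rnumber_op1 (sin_transform u) = sin_transform (rnumber_op1 u).
Proof.
move=> su; have su' := rschwartz_derive su; have su'' := rschwartz_derive su'.
have sx := rschwartzX su; have sxx := rschwartzX sx.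
have dc : derive1 (derive1 (sin_transform u)) =
    fun t => - sin_transform (fun x => x * (x * u x)) t.
  rewrite derive1_sin_transform //; exact: derive1_cos_transform.
have -> : rnumber_op1 u = fun x => 2^-1 * (((-1) * derive1 (derive1 u) x + x * (x * u x)) + u x).
  by apply/funext => x; rewrite rnumber_op1_split.
apply/funext => t; rewrite rnumber_op1_split dc.
have s1 := rschwartzZ (-1) su''; have s2 := rschwartzD s1 sxx.
rewrite (sin_transformZ _ t (rschwartzD s2 su)) (sin_transformD t s2 su).
rewrite (sin_transformD t s1 sxx) (sin_transformZ _ t su'').
rewrite (sin_transform_derive t su') (cos_transform_derive t su).
by ring.
Qed.

(** The m-th norm of [U u] is the L2 norm of [U] applied to (N + 1)^m u, so one L2 bound yields all
    norms. Applied to both transforms and to reflection. *)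
Lemma scontinuous_commute (U : (R -> R) -> R -> R) :
  (forall u, rschwartz u -> rschwartz (U u)) ->
  (forall u, rschwartz u -> rnumber_op1 (U u) = U (rnumber_op1 u)) ->
  dominated (fun u => l2norm (U u)) -> scontinuous U.
Proof.
move=> sU LU dU; split => // m.
have h := dominated_comp dU (scontinuous_iter_number_op1 m).
apply: dominated_le h _ => u su; rewrite le_eqVlt; apply/orP; left; apply/eqP.
rewrite /rsnorm; congr l2norm; elim: m => //= m ->.
by rewrite LU //; exact: rschwartz_iter_number_op1.
Qed.

(** The expression bounds the L2 norm of a transform of [u]: the transform is bounded by the L1 norm
    of u, and t^2 times it by the L1 norm of u''. *)
Lemma L1_derive2_dominated : dominated (fun u : R -> R =>
  ((\int[mu]_x `|u x|) + \int[mu]_x `|derive1 (derive1 u) x|) * (1 + pi)).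
Proof.
have [C [p [C0 h]]] := dominatedD (@L1_dominated R) (dominated_comp (@L1_dominated R)
  (scontinuous_comp (@scontinuous_derive R) (@scontinuous_derive R))).
exists (C * (1 + pi)), p; split; first by rewrite mulr_ge0 // addr_ge0 // pi_ge0.
move=> u su; rewrite mulrAC; apply: ler_wpM2r; first by rewrite addr_ge0 // pi_ge0.
exact: h.
Qed.

Lemma scontinuous_cos_transform : scontinuous (@cos_transform R).
Proof.
apply: scontinuous_commute.
- exact: rschwartz_cos_transform.
- exact: rnumber_op1_cos_transform.
apply: dominated_le L1_derive2_dominated _ => u su.
have su' := rschwartz_derive su; have su'' := rschwartz_derive su'.
apply: l2norm_le_decay => [|t]; first exact: rschwartz_cos_transform.
rewrite mulrDl mul1r; apply: lerD; first exact: cos_transform_bounded.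
apply: le_trans (cos_transform_bounded t su'').
rewrite (cos_transform_derive t su') (sin_transform_derive t su).
by rewrite mulrN normrN !normrM mulrA -expr2 real_normK ?num_real.
Qed.

Lemma scontinuous_sin_transform : scontinuous (@sin_transform R).
Proof.
apply: scontinuous_commute.
- exact: rschwartz_sin_transform.
- exact: rnumber_op1_sin_transform.
apply: dominated_le L1_derive2_dominated _ => u su.
have su' := rschwartz_derive su; have su'' := rschwartz_derive su'.
apply: l2norm_le_decay => [|t]; first exact: rschwartz_sin_transform.
rewrite mulrDl mul1r; apply: lerD; first exact: sin_transform_bounded.
apply: le_trans (sin_transform_bounded t su'').
rewrite (sin_transform_derive t su') (cos_transform_derive t su).
by rewrite normrN !normrM mulrA -expr2 real_normK ?num_real.
Qed.

Lemma rschwartz_opp u : rschwartz u -> rschwartz (fun x => u (- x)).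
Proof.
move=> /(rschwartz_reflect 0); congr rschwartz.
by apply/funext => x; rewrite sub0r.
Qed.

Lemma has_deriv_opp u u' : has_deriv u u' ->
  has_deriv (fun x => u (- x)) (fun x => - u' (- x)).
Proof.
move=> hu; apply: has_deriv_eq.
  exact: (has_deriv_comp hu (has_derivN (@has_deriv_id R))).
by move=> x; rewrite /= mulN1r.
Qed.

Lemma scontinuous_opp : scontinuous (fun (u : R -> R) x => u (- x)).
Proof.
apply: scontinuous_commute.
- exact: rschwartz_opp.
- move=> u su; have su' := rschwartz_derive su.
  have d1 := has_derivE (has_deriv_opp (rschwartz_deriv su)).
  have d2 := has_derivE (has_derivN (has_deriv_opp (rschwartz_deriv su'))).
  apply/funext => x; rewrite /rnumber_op1 d1 d2 sqrrN.
  by generalize_derive; ring.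
have [C [p [C0 h]]] := @decay_dominated R.
exists (C * (1 + pi)), p; split; first by rewrite mulr_ge0 // addr_ge0 // pi_ge0.
move=> u su; rewrite mulrAC; apply: l2norm_le_decay; first exact: rschwartz_opp.
by move=> x; have := h u (- x) su; rewrite sqrrN.
Qed.

End Continuity.

(** * Hermite functions *)

Section HermiteFunctions.
Variable R : realType.
Implicit Types (u v w f g : R -> R).
Local Notation mu := (@lebesgue_measure R).

Lemma gauss_integral (c : R) : 0 < c ->
  \int[mu]_x expR (- (c * x ^+ 2)) = Num.sqrt (pi / c).
Proof.
(* Up to a constant the Gaussian is the normal density of variance 1 / (2 c). *)
move=> c0; pose s : R := Num.sqrt (2 * c)^-1.
have s2 : s ^+ 2 = (2 * c)^-1 by rewrite sqr_sqrtr // invr_ge0 mulr_ge0 // ltW.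
have s0 : s != 0 by rewrite gt_eqF // sqrtr_gt0 invr_gt0 mulr_gt0.
have h := @integral_normal_pdf R 0 s.
have pk : 0 < normal_peak s by exact: normal_peak_gt0.
have E x : normal_pdf 0 s x = normal_peak s * expR (- (c * x ^+ 2)).
  rewrite normal_pdfE // /normal_fun subr0; congr (_ * expR _).
  by rewrite s2; field; rewrite gt_eqF.
have sg := rschwartz_gauss c0.
have h2 : normal_peak s * \int[mu]_x expR (- (c * x ^+ 2)) = 1.
  rewrite -RintegralZl //; last exact: rschwartz_integrable.
  rewrite -[RHS]/(fine 1%E) -h; congr fine.
  by apply: eq_integral => x _; rewrite E.
have -> : \int[mu]_x expR (- (c * x ^+ 2)) = (normal_peak s)^-1.
  by apply: (mulfI (lt0r_neq0 pk)); rewrite h2 divff // gt_eqF.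
rewrite /normal_peak invrK s2; congr Num.sqrt.
by rewrite -mulr_natr; field; rewrite gt_eqF.
Qed.

(* [hermite_aux n] is [(-1)^n] times the Hermite polynomial [H_n]. *)
Fixpoint hermite_aux (n : nat) : {poly R} :=
  if n is m.+1 then (hermite_aux m)^`() - 'X * hermite_aux m else 1.

Lemma derive1n_gauss n : derive1n n (fun y : R => expR (- (y ^+ 2 / 2))) =
  fun x => (hermite_aux n).[x] * expR (- (2^-1 * x ^+ 2)).
Proof.
elim: n => [|n IH].
  by apply/funext => x; rewrite /= hornerC mul1r mulrC.
rewrite derive1nS IH; apply: has_derivE; apply: has_deriv_eq.
  by apply: has_derivM; [exact: has_deriv_horner|exact: has_deriv_gauss].
by move=> x /=; rewrite hornerD hornerN hornerM hornerX; field.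
Qed.

Definition rhermite (n : nat) (x : R) : R :=
  (Num.sqrt (Num.sqrt (2 * pi) * n`!%:R))^-1 * expR (- (x ^+ 2 / 4)) * hermite_poly n x.

(** The sign makes up for the one carried by [hermite_aux]. *)
Definition hermite_coef (n : nat) : R :=
  (Num.sqrt (Num.sqrt (2 * pi) * n`!%:R))^-1 * (-1) ^+ n.

Lemma rhermiteE n : rhermite n =
  fun x => hermite_coef n * ((hermite_aux n).[x] * expR (- (4^-1 * x ^+ 2))).
Proof.
apply/funext => x; rewrite /rhermite /hermite_poly derive1n_gauss /hermite_coef.
have -> : expR (- (4^-1 * x ^+ 2)) =
    expR (- (x ^+ 2 / 4)) * (expR (x ^+ 2 / 2) * expR (- (2^-1 * x ^+ 2))).
  by rewrite -!expRD; congr expR; field.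
by ring.
Qed.

Lemma rschwartz_hermite n : rschwartz (rhermite n).
Proof.
rewrite rhermiteE; apply: rschwartzZ; apply: rschwartz_horner_gauss.
by rewrite invr_gt0.
Qed.

Lemma hermite_coefS n : hermite_coef n = - (Num.sqrt n.+1%:R * hermite_coef n.+1).
Proof.
rewrite /hermite_coef factS natrM exprS.
have p0 : 0 < Num.sqrt (2 * pi) * (n`!%:R : R).
  by rewrite mulr_gt0 ?ltr0n ?fact_gt0 // sqrtr_gt0 mulr_gt0 // pi_gt0.
rewrite (mulrCA _ n.+1%:R) [Num.sqrt (n.+1%:R * _)]sqrtrM ?ler0n // invfM.
have sn : Num.sqrt (n.+1%:R : R) != 0 by rewrite gt_eqF // sqrtr_gt0 ltr0n.
have sp : Num.sqrt (Num.sqrt (2 * pi) * (n`!%:R : R)) != 0 by rewrite gt_eqF // sqrtr_gt0.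
by field; rewrite sn sp.
Qed.

(** On p(x) exp(-x^2/4) the creation operator acts as p -> x p - p', which is the recurrence of
    [hermite_aux] with the opposite sign. *)
Lemma raise_hermite n :
  raise 2^-1 (rhermite n) = fun x => Num.sqrt n.+1%:R * rhermite n.+1 x.
Proof.
have d := has_derivE (has_derivZ (hermite_coef n)
  (has_derivM (has_deriv_horner (hermite_aux n)) (has_deriv_gauss (4^-1 : R)))).
apply/funext => x; rewrite /raise !rhermiteE d hermite_coefS /=.
rewrite hornerD hornerN hornerM hornerX.
move: (expR _) (Num.sqrt _) (hermite_coef _) (hermite_aux n).[x] ((hermite_aux n)^`()).[x].
by move=> *; field.
Qed.

Lemma lower_raise_comm u : rschwartz u ->
  lower 2^-1 (raise 2^-1 u) = fun x => raise 2^-1 (lower 2^-1 u) x + u x.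
Proof.
move=> su; apply/funext => x; rewrite lower_raise // raise_lower //.
by generalize_derive; field.
Qed.

Lemma raiseZ c (a : R) u : rschwartz u ->
  raise c (fun x => a * u x) = fun x => a * raise c u x.
Proof.
by move=> su; apply/funext => x; rewrite /raise derive1_Z //; generalize_derive; ring.
Qed.

Lemma lowerZ c (a : R) u : rschwartz u ->
  lower c (fun x => a * u x) = fun x => a * lower c u x.
Proof.
by move=> su; apply/funext => x; rewrite /lower derive1_Z //; generalize_derive; ring.
Qed.

Lemma lower_hermite0 : lower 2^-1 (rhermite 0) = fun=> 0.
Proof.
have d := has_derivE (has_derivZ (hermite_coef 0)
  (has_derivM (has_deriv_horner (hermite_aux 0)) (has_deriv_gauss (4^-1 : R)))).
apply/funext => x; rewrite /lower !rhermiteE d /= derivC hornerC horner0.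
by move: (expR _) (hermite_coef _) => *; field.
Qed.

Lemma sqrtn_neq0 n : Num.sqrt (n.+1%:R : R) != 0.
Proof. by rewrite gt_eqF // sqrtr_gt0 ltr0n. Qed.

Lemma sqr_sqrtn n : Num.sqrt (n%:R : R) * Num.sqrt n%:R = n%:R.
Proof. by rewrite -expr2 sqr_sqrtr // ler0n. Qed.

Lemma lower_hermiteS n :
  lower 2^-1 (rhermite n.+1) = fun x => Num.sqrt n.+1%:R * rhermite n x.
Proof.
(* As [raise] sends h_k to sqrt(k + 1) h_(k+1), it is enough that lowering after raising multiplies
   h_k by k + 1; the commutation relation adds 1 to this eigenvalue at each step. *)
have key k : lower 2^-1 (raise 2^-1 (rhermite k)) = (fun x => k.+1%:R * rhermite k x) ->
    lower 2^-1 (rhermite k.+1) = fun x => Num.sqrt k.+1%:R * rhermite k x.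
  rewrite raise_hermite (lowerZ _ _ (rschwartz_hermite k.+1)) => /funeqP h.
  apply/funext => x; apply: (mulfI (sqrtn_neq0 k)).
  rewrite [RHS]mulrA sqr_sqrtn; exact: h.
elim: n => [|n IH]; apply: key; rewrite lower_raise_comm //; try exact: rschwartz_hermite.
  rewrite lower_hermite0; apply/funext => x.
  by rewrite /raise (has_derivE (has_deriv_cst (0 : R))) mulr0 subr0 add0r mul1r.
rewrite IH (raiseZ _ _ (rschwartz_hermite n)) raise_hermite; apply/funext => x.
by rewrite mulrA sqr_sqrtn -[n.+2%:R]natr1 mulrDl mul1r.
Qed.

(** At n = 0 the truncated predecessor is harmless, since the coefficient vanishes. *)
Lemma lower_hermite n :
  lower 2^-1 (rhermite n) = fun x => Num.sqrt n%:R * rhermite n.-1 x.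
Proof.
case: n => [|n]; last exact: lower_hermiteS.
by rewrite lower_hermite0; apply/funext => x; rewrite sqrtr0 mul0r.
Qed.

Lemma inner_hermite00 : inner (rhermite 0) (rhermite 0) = 1.
Proof.
rewrite /inner rhermiteE /hermite_coef expr0 fact0 !mulr1.
set c := Num.sqrt (2 * pi).
have c0 : 0 < c by rewrite sqrtr_gt0 mulr_gt0 // pi_gt0.
have s2 : (Num.sqrt c)^-1 * (Num.sqrt c)^-1 = c^-1.
  by rewrite -invfM -expr2 sqr_sqrtr // ltW.
have g0 : 0 < (2^-1 : R) by rewrite invr_gt0.
transitivity (c^-1 * \int[mu]_x expR (- (2^-1 * x ^+ 2))).
  rewrite -RintegralZl //; last exact: (rschwartz_integrable (rschwartz_gauss g0)).
  apply: eq_Rintegral => x _; rewrite /= hornerC !mul1r mulrACA s2 -expRD; congr (_ * expR _).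
  by field.
rewrite gauss_integral // invrK (mulrC pi) mulVf // gt_eqF //.
Qed.

Lemma inner0r u : rschwartz u -> inner u (fun=> 0) = 0.
Proof.
move=> su.
have E : (fun=> 0) = fun x => 0 * u x by apply/funext => x; rewrite mul0r.
by rewrite [X in inner u X]E innerZr // mul0r.
Qed.

(** Adjointness of the ladder operators lowers both indices at once; when one of them is 0, [lower]
    annihilates h_0. *)
Lemma inner_hermite i j : inner (rhermite i) (rhermite j) = (i == j)%:R.
Proof.
have z j' : inner (rhermite 0) (rhermite j'.+1) = 0.
  apply: (mulfI (sqrtn_neq0 j')); rewrite mulr0.
  rewrite -(innerZr _ (rschwartz_hermite 0) (rschwartz_hermite j'.+1)) -raise_hermite innerC.
  rewrite (inner_raise _ (rschwartz_hermite j') (rschwartz_hermite 0)) lower_hermite0 inner0r //; exact: rschwartz_hermite.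
elim: i j => [|i IH] [|j].
- by rewrite inner_hermite00.
- by rewrite z.
- by rewrite innerC z.
apply: (mulfI (sqrtn_neq0 i)).
rewrite -(innerZl _ (rschwartz_hermite i.+1) (rschwartz_hermite j.+1)) -raise_hermite.
rewrite (inner_raise _ (rschwartz_hermite i) (rschwartz_hermite j.+1)) lower_hermiteS.
rewrite (innerZr _ (rschwartz_hermite i) (rschwartz_hermite j)) IH eqSS.
by case: eqP => [->|_] //; rewrite !mulr0.
Qed.

(* The [h_n] are eigenfunctions of [- d^2/dx^2 + x^2 / 4] but not of [N]: written in
   the ladder operators of the former, [N + 1] also shifts [n] by [2] and [-2]. *)
Lemma number_op1_hermite n : exists a b c : R,
  [/\ `|a| <= 3 * n.+1%:R, `|b| <= 3 * n.+1%:R, `|c| <= 3 * n.+1%:R &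
   rnumber_op1 (rhermite n) =
   fun x => (a * rhermite n.+2 x + b * rhermite n x) + c * rhermite n.-2 x].
Proof.
have sh := rschwartz_hermite.
pose s k : R := Num.sqrt k%:R.
have s_ge0 k : 0 <= s k by exact: sqrtr_ge0.
have sM k l m : (k <= m)%N -> (l <= m)%N -> s k * s l <= m%:R.
  move=> km lm; rewrite -(sqr_sqrtn m); apply: ler_pM => //; apply: ler_wsqrtr;
    by rewrite ler_nat.
have n0 : 1 <= n.+1%:R :> R by rewrite ler1n.
have e1 : n.+2%:R = n.+1%:R + 1 :> R by rewrite natr1.
have e2 : n.+1%:R = n%:R + 1 :> R by rewrite natr1.
have h1 := sM n.+1 n.+2 n.+2 (leqnSn _) (leqnn _).
have h2 := sM n n.-1 n.+1 (leqnSn _) (leq_trans (leq_pred _) (leqnSn _)).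
have h1' : 0 <= s n.+1 * s n.+2 by rewrite mulr_ge0.
have h2' : 0 <= s n * s n.-1 by rewrite mulr_ge0.
have nn : 0 <= n%:R :> R by rewrite ler0n.
(* Write a and b for [lower 2^-1] and [raise 2^-1]. Then x = a + b and d/dx = (a - b) / 2, so
   [N + 1] is 3/8 (a^2 + b^2) + 1/2 (5/4 (a b + b a) + 1), where a b + b a has eigenvalue 2 n + 1 at
   h_n. For n < 2 the truncated index [n.-2] comes with coefficient 0. *)
exists (3 / 8 * (s n.+1 * s n.+2)), (2^-1 * (5 / 4 * (2 * n%:R + 1) + 1)),
  (3 / 8 * (s n * s n.-1)); split.
- by rewrite ger0_norm; lra.
- by rewrite ger0_norm; lra.
- by rewrite ger0_norm; lra.
have ll : lower 2^-1 (lower 2^-1 (rhermite n)) = fun x => s n * (s n.-1 * rhermite n.-2 x).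
  by rewrite lower_hermite lowerZ // lower_hermite.
have rr : raise 2^-1 (raise 2^-1 (rhermite n)) = fun x => s n.+1 * (s n.+2 * rhermite n.+2 x).
  by rewrite raise_hermite raiseZ // raise_hermite.
have lr : lower 2^-1 (raise 2^-1 (rhermite n)) = fun x => n.+1%:R * rhermite n x.
  rewrite raise_hermite lowerZ // lower_hermite; apply/funext => x /=.
  by rewrite mulrA sqr_sqrtn.
apply/funext => x.
have llx := congr1 (@^~ x) ll; have rrx := congr1 (@^~ x) rr; have lrx := congr1 (@^~ x) lr.
move: llx rrx lrx; rewrite /= lower_raise //.
rewrite {1}/lower {1}/raise derive1_lower // derive1_raise // /lower /raise /rnumber_op1.
rewrite e2.
move: (derive1 (derive1 _) _) (derive1 _ _) (rhermite n x) (rhermite n.-2 x) (rhermite n.+2 x).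
move: (s n) (s n.-1) (s n.+1) (s n.+2) => s1 s2 s3 s4 d2 d1 d0 dm dp E1 E2 E3.
have -> : 3 / 8 * (s3 * s4) * dp = 3 / 8 * (s3 * (s4 * dp)) by ring.
have -> : 3 / 8 * (s1 * s2) * dm = 3 / 8 * (s1 * (s2 * dm)) by ring.
have -> : 2^-1 * (5 / 4 * (2 * n%:R + 1) + 1) * d0 =
  2^-1 * (5 / 4 * (2 * ((n%:R + 1) * d0) - d0) + d0) by ring.
by rewrite -E1 -E2 -E3; field.
Qed.

Lemma rsnorm_hermite m : exists C : R, 0 <= C /\
  forall n, rsnorm m (rhermite n) <= C * n.+1%:R ^+ m.
Proof.
have sh := rschwartz_hermite.
elim: m => [|m [C [C0 h]]].
  exists 1; split => // n; rewrite expr0 mulr1 /rsnorm /= /l2norm inner_hermite eqxx.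
  by rewrite sqrtr1.
(* Three terms, each with a coefficient of size at most 3 (n + 1) and an index k such that k + 1 <=
   3 (n + 1), whose m-th power costs 3^m. *)
exists (9 * 3 ^+ m * C); split; first by rewrite !mulr_ge0 // exprn_ge0.
move=> n; rewrite rsnormS; have [a [b [c [ha hb hc ->]]]] := number_op1_hermite n.
apply: le_trans (rsnormD m (rschwartzD (rschwartzZ a (sh n.+2)) (rschwartzZ b (sh n)))
  (rschwartzZ c (sh n.-2))) _.
apply: (@le_trans _ _ (`|a| * rsnorm m (rhermite n.+2) + `|b| * rsnorm m (rhermite n) +
    `|c| * rsnorm m (rhermite n.-2))).
  rewrite -(rsnormZ m a (sh _)) -(rsnormZ m b (sh _)) -(rsnormZ m c (sh _)) lerD2r.
  exact: (rsnormD m (rschwartzZ a (sh n.+2)) (rschwartzZ b (sh n))).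
have n1 : 1 <= n.+1%:R :> R by rewrite ler1n.
have bound k : (k <= 3 * n.+1)%N -> C * k%:R ^+ m <= C * (3 ^+ m * n.+1%:R ^+ m).
  move=> k3; apply: ler_wpM2l => //; rewrite -exprMn; apply: lerXn2r.
  - by rewrite nnegrE ler0n.
  - by rewrite nnegrE mulr_ge0.
  - by rewrite -natrM ler_nat.
have term (d : R) (k : nat) : `|d| <= 3 * n.+1%:R -> (k.+1 <= 3 * n.+1)%N ->
    `|d| * rsnorm m (rhermite k) <= 3 * n.+1%:R * (C * (3 ^+ m * n.+1%:R ^+ m)).
  move=> hd hk; apply: ler_pM => //; first exact: rsnorm_ge0.
  exact: le_trans (h k) (bound _ hk).
have t1 := term a n.+2 ha; have t2 := term b n hb; have t3 := term c n.-2 hc.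
apply: le_trans (lerD (lerD (t1 _) (t2 _)) (t3 _)) _.
- by rewrite mulnS (leq_trans (leq_pmulr n.+3 (isT : 0 < 1)%N)) //; lia.
- by lia.
- by lia.
by rewrite le_eqVlt exprS; apply/orP; left; apply/eqP; ring.
Qed.

End HermiteFunctions.

(** * Hermite expansion *)

Section HermiteExpansion.
Variable R : realType.
Implicit Types (u v w f g : R -> R).
Local Notation mu := (@lebesgue_measure R).
Local Notation h := (@rhermite R).

Lemma has_deriv_primitive w : rschwartz w ->
  has_deriv (fun x => \int[mu]_(t in `]-oo, x]) w t) w.
Proof.
move=> sw x.
have iw : mu.-integrable `]-oo, x + 1] (EFin \o w).
  by apply: integrableS (rschwartz_integrable sw).
have x1 : x < x + 1 by rewrite ltrDl.
have cw : {for x, continuous w} by exact: rschwartz_continuous.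
have [|d1 d2] := @continuous_FTC1 R w -oo%O x (x + 1) x1 iw _ cw.
  exact: ltNyr.
by apply: DeriveDef; rewrite -?derive1E.
Qed.

Lemma rschwartz_integral_setC w (A : set R) : measurable A -> rschwartz w ->
  \int[mu]_x w x = 0 -> \int[mu]_(x in A) w x = - \int[mu]_(x in ~` A) w x.
Proof.
move=> mA sw; rewrite -[in X in X -> _](setUv A) Rintegral_setU //.
- by move/eqP; rewrite addr_eq0 => /eqP.
- exact: measurableC.
- by rewrite setUv; exact: rschwartz_integrable.
- by apply/disj_setPS; rewrite setICr.
Qed.

(** Where |s| >= |x| the quotient exp(x^2/4 - s^2/4) is at most 1 and |x|^k <= |s|^k, so the growing
    Gaussian in front of the integral costs nothing. *)
Lemma le_norm_integral_gauss f (A : set R) (x : R) k : measurable A -> rschwartz f ->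
  (forall s, A s -> `|x| <= `|s|) ->
  `|x| ^+ k * (expR (4^-1 * x ^+ 2) * `|\int[mu]_(s in A) (f s * expR (- (4^-1 * s ^+ 2)))|)
  <= \int[mu]_s `|s ^+ k * f s|.
Proof.
move=> mA sf hA.
have c0 : 0 < (4^-1 : R) by rewrite invr_gt0.
have sw := rschwartzM sf (rschwartz_gauss c0).
have su : rschwartz (fun s => s ^+ k * f s).
  have := rschwartz_horner 'X^k sf; congr rschwartz.
  by apply/funext => s; rewrite hornerXn.
have iu : mu.-integrable setT (EFin \o (fun s => `|s ^+ k * f s|)).
  exact: (integrable_norm (rschwartz_integrable su)).
have iuA : mu.-integrable A (EFin \o (fun s => `|s ^+ k * f s|)).
  by apply: integrableS iu.
have iw : mu.-integrable A (EFin \o (fun s => f s * expR (- (4^-1 * s ^+ 2)))).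
  by apply: integrableS (rschwartz_integrable sw).
have xE : 0 <= `|x| ^+ k * expR (4^-1 * x ^+ 2) by rewrite mulr_ge0 ?exprn_ge0 ?expR_ge0.
rewrite mulrA.
have le1 := ler_wpM2l xE (@le_normr_Rintegral _ _ _ mu _ _ mA iw).
apply: (le_trans le1); clear le1.
rewrite -RintegralZl //; last exact: (integrable_norm iw).
apply: (@le_trans _ _ (\int[mu]_(s in A) `|s ^+ k * f s|)).
  apply: le_Rintegral => //.
  - by apply: (Rintegrable_scale _ mA); exact: (integrable_norm iw).
  - move=> s As; rewrite [X in _ * X]normrM (ger0_norm (expR_ge0 _)).
    have hs := hA s As; rewrite [X in _ <= X]normrM normrX.
    have -> : `|x| ^+ k * expR (4^-1 * x ^+ 2) * (`|f s| * expR (- (4^-1 * s ^+ 2))) =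
      (`|x| ^+ k * `|f s|) * expR (4^-1 * x ^+ 2 - 4^-1 * s ^+ 2).
      by rewrite expRD; ring.
    apply: le_trans (_ : `|x| ^+ k * `|f s| * 1 <= _).
      apply: ler_wpM2l; first by rewrite mulr_ge0 // exprn_ge0.
      rewrite -expR0 ler_expR subr_le0; apply: ler_wpM2l; first exact: ltW.
      by rewrite -(real_normK (num_real x)) -(real_normK (num_real s)) lerXn2r ?nnegrE.
    by rewrite mulr1 ler_wpM2r // lerXn2r ?nnegrE.
exact: subset_le_Rintegral mA (rschwartz_integrable su).
Qed.

(* [g x = - e^(x^2/4) \int_(-oo)^x f(t) e^(-t^2/4) dt]; orthogonality to [h_0] allows to
   replace the integral by minus the one over [(x, +oo)], whence the decay at [+oo]. *)
Lemma raise_surjective f : rschwartz f -> inner f (h 0) = 0 ->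
  exists2 g, rschwartz g & raise 2^-1 g = f.
Proof.
move=> sf f0.
have c0 : 0 < (4^-1 : R) by rewrite invr_gt0.
pose e (x : R) : R := expR (- (4^-1 * x ^+ 2)).
pose E (x : R) : R := expR (4^-1 * x ^+ 2).
have Ee x : E x * e x = 1 by rewrite -expRD subrr expR0.
have sw : rschwartz (fun x => f x * e x) by exact: rschwartzM sf (rschwartz_gauss c0).
have w0 : \int[mu]_x (f x * e x) = 0.
  have k0 : hermite_coef R 0 != 0.
    rewrite /hermite_coef expr0 mulr1 invr_eq0 gt_eqF // sqrtr_gt0 fact0 mulr1 sqrtr_gt0.
    by rewrite mulr_gt0 // pi_gt0.
  apply: (mulfI k0); rewrite mulr0 -f0 -RintegralZl //; last exact: rschwartz_integrable.
  by apply: eq_Rintegral => x _; rewrite rhermiteE /= hornerC /e; ring.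
pose G (x : R) := \int[mu]_(t in `]-oo, x]) (f t * e t).
have hG : has_deriv G (fun x => f x * e x) by exact: (has_deriv_primitive sw).
have hE : has_deriv E (fun x => 2^-1 * x * E x).
  have hq : has_deriv (fun x : R => 4^-1 * x ^+ 2) (fun x => 2^-1 * x).
    by apply: has_deriv_eq (has_derivZ _ (@has_deriv_sqr R)) _ => x; field.
  exact: has_deriv_comp (@has_deriv_expR R) hq.
pose g (x : R) := - (E x * G x).
have hg : has_deriv g (fun x => 2^-1 * x * g x - f x).
  apply: has_deriv_eq; first by apply: has_derivN; exact: has_derivM hE hG.
  by move=> x; rewrite /g /= (mulrCA (E x)) Ee; ring.
have rg : rapid g.
  move=> k; exists (\int[mu]_s `|s ^+ k * f s|) => x.
  rewrite /g normrN normrM (ger0_norm (expR_ge0 _)).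
  have [x0|x0] := lerP x 0.
    apply: le_norm_integral_gauss => //.
    move=> s /=; rewrite in_itv /= => sx.
    by rewrite !ler0_norm ?lerN2 // (le_trans sx).
  have -> : G x = - \int[mu]_(t in ~` `]-oo, x]) (f t * e t).
    by apply: (rschwartz_integral_setC _ sw w0).
  rewrite normrN; apply: le_norm_integral_gauss => //; first exact: measurableC.
  move=> s /=; rewrite in_itv /= => /negP; rewrite -ltNge => xs.
  by rewrite !gtr0_norm ?ltW // (lt_trans x0).
exists g; last first.
  by apply/funext => x; rewrite /raise (has_derivE hg); ring.
(* By g' = x g / 2 - f, polynomial multiples of g plus Schwartz functions form a class closed under
   d/dx. *)
apply: (@rschwartz_coind _ (fun w => exists (p : {poly R}), exists2 s, rschwartz s &
    w = fun x => p.[x] * g x + s x)).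
- move=> _ [p [s ss ->]]; eexists.
    apply: has_derivD; last exact: rschwartz_deriv ss.
    by apply: has_derivM hg; exact: has_deriv_horner.
  exists (p^`() + 2^-1 *: ('X * p)), (fun x => derive1 s x - p.[x] * f x).
    by apply: rschwartzB; [exact: rschwartz_derive|exact: rschwartz_horner].
  apply/funext => x; rewrite hornerD hornerZ hornerM hornerX.
  by generalize_derive; ring.
- move=> _ [p [s ss ->]]; apply: rapidD; last exact: rschwartz_rapid.
  exact: rapid_horner.
- exists 1, (fun=> 0); first exact: rschwartz0.
  by apply/funext => x; rewrite hornerC mul1r addr0.
Qed.

#[local] Opaque inner raise lower.

Lemma inner_lower_raise u : rschwartz u ->
  inner (raise 2^-1 u) (raise 2^-1 u) = inner (lower 2^-1 u) (lower 2^-1 u) + inner u u.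
Proof.
move=> su; have sr := rschwartz_raise 2^-1 su; have sl := rschwartz_lower 2^-1 su.
rewrite (inner_raise _ su sr) lower_raise_comm //.
rewrite (innerDr su (rschwartz_raise 2^-1 sl) su); congr (_ + _).
by rewrite innerC (inner_raise _ sl su).
Qed.

(* By induction on [n]: [f = raise g] with [g] orthogonal to one function less, and
   [lower raise = raise lower + 1] increases the gap by [1]. *)
Lemma spectral_gap n f : rschwartz f -> (forall j, (j < n)%N -> inner f (h j) = 0) ->
  n%:R * inner f f <= inner (lower 2^-1 f) (lower 2^-1 f).
Proof.
elim: n f => [|n IH] f sf f0; first by rewrite mul0r inner_ge0.
have [g sg gf] := raise_surjective sf (f0 0%N isT).
have sr := rschwartz_raise 2^-1 sg; have slf := rschwartz_lower 2^-1 sf.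
have hg : n%:R * inner g g <= inner (lower 2^-1 g) (lower 2^-1 g).
  (* sqrt(j + 1) <g, h_j> = <g, lower h_(j+1)> = <raise g, h_(j+1)> = <f, h_(j+1)> = 0. *)
  apply: IH => // j jn; apply: (mulfI (sqrtn_neq0 R j)).
  have sh := rschwartz_hermite R; rewrite mulr0 -(innerZr _ sg (sh j)) -lower_hermiteS.
  by rewrite -(inner_raise _ sg (sh j.+1)) gf f0.
have e1 := inner_lower_raise sg; rewrite gf in e1.
have e2 : inner f f = inner g (lower 2^-1 f) by rewrite -{1}gf (inner_raise _ sg sf).
have cs := le_trans (ler_norm _) (cauchy_schwarz sg slf).
have h3 : inner f f ^+ 2 <= inner g g * inner (lower 2^-1 f) (lower 2^-1 f).
  rewrite -(sqr_l2norm g) -(sqr_l2norm (lower 2^-1 f)) -exprMn.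
  apply: lerXn2r; rewrite ?nnegrE; [exact: inner_ge0| |rewrite e2; exact: cs].
  exact: mulr_ge0 (l2norm_ge0 _) (l2norm_ge0 _).
have a0 := inner_ge0 f; have b0 := inner_ge0 g; have c0 := inner_ge0 (lower 2^-1 f).
move: a0 b0 c0 h3 hg e1 {cs e2}.
move: (inner f f) (inner g g) (inner (lower 2^-1 f) _) (inner (lower 2^-1 g) _).
move=> a b c d a0 b0 c0 h3 hg e1.
have [a_0|an0] := eqVneq a 0; first by rewrite a_0 mulr0.
have ap : 0 < a by rewrite lt_neqAle eq_sym an0.
have n1b : n.+1%:R * b <= a by rewrite e1 -natr1 mulrDl mul1r lerD2r.
(* After multiplication by a the claim is the chain (n + 1) a^2 <= (n + 1) b c <= a c. *)
rewrite -(ler_pM2l ap) mulrCA -expr2.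
apply: le_trans (ler_wpM2l (ler0n _ _) h3) _.
by rewrite mulrA; exact: ler_wpM2r c0 _ _ n1b.
Qed.

(** * Convergence of Hermite expansions in the norms of S *)

Lemma scontinuous_ext (U V : (R -> R) -> R -> R) : (forall u, rschwartz u -> U u = V u) ->
  scontinuous U -> scontinuous V.
Proof.
move=> UV [sU dU]; split=> [u su|m]; first by rewrite -UV //; exact: sU.
by apply: dominated_le (dU m) _ => u su; rewrite UV.
Qed.

(** This is A + 1, whose eigenvalue j + 1 at h_j is nonzero also for j = 0. *)
Definition hermite_op u : R -> R := fun x => raise 2^-1 (lower 2^-1 u) x + u x.

Lemma rschwartz_hermite_op u : rschwartz u -> rschwartz (hermite_op u).
Proof. by move=> su; apply: rschwartzD => //; apply/rschwartz_raise/rschwartz_lower. Qed.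

(** The continuity of the ladder operators was obtained for c = 1, so the operator is rewritten in
    terms of x and d/dx. *)
Lemma scontinuous_raise_lower : scontinuous (fun u : R -> R => raise 2^-1 (lower 2^-1 u)).
Proof.
have X := @scontinuousX R; have D := @scontinuous_derive R.
apply: scontinuous_ext (scontinuousD (scontinuousD (scontinuousZ (4^-1) (scontinuous_comp X X))
  (scontinuousZ (-1) (scontinuous_comp D D))) (scontinuousZ (- 2^-1) (@scontinuous_id R))) => u su.
by apply/funext => x; rewrite raise_lower //; generalize_derive; field.
Qed.

Lemma scontinuous_hermite_op : scontinuous hermite_op.
Proof. exact: scontinuousD scontinuous_raise_lower (@scontinuous_id R). Qed.

Lemma hermite_op_hermite j : hermite_op (h j) = fun x => j.+1%:R * h j x.
Proof.
have sh := rschwartz_hermite R; rewrite /hermite_op lower_hermite.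
apply/funext => x; rewrite raiseZ // raise_hermite -[j.+1%:R]natr1 mulrDl mul1r; congr (_ + _).
by case: j => [|j]; rewrite ?sqrtr0 ?mul0r //= mulrA sqr_sqrtn.
Qed.

Lemma inner_hermite_op u v : rschwartz u -> rschwartz v ->
  inner (hermite_op u) v = inner u (hermite_op v).
Proof.
move=> su sv; have su' := rschwartz_lower 2^-1 su; have sv' := rschwartz_lower 2^-1 sv.
have su'' := rschwartz_raise 2^-1 su'; have sv'' := rschwartz_raise 2^-1 sv'.
rewrite (innerDl su'' su sv) (innerDr su sv'' sv); congr (_ + _).
by rewrite (inner_raise _ su' sv) [RHS]innerC (inner_raise _ sv' su) innerC.
Qed.

(** [hermite_op] is symmetric with eigenvalue j + 1 at h_j: its q-th power moves from h_j to [u],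
    and Cauchy-Schwarz applies with h_j of norm 1. *)
Lemma coef_decay q : dominated (fun u : R -> R => l2norm (iter q hermite_op u)) /\
  forall u j, rschwartz u ->
    j.+1%:R ^+ q * `|inner u (h j)| <= l2norm (iter q hermite_op u).
Proof.
split.
  apply: (dominated_comp (q := @l2norm R)); first exact: (@dominated_rsnorm R 0).
  elim: q => [|q IH]; first exact: scontinuous_id.
  exact: (scontinuous_comp scontinuous_hermite_op IH).
move=> u j su; have sh := rschwartz_hermite R.
have sq k : rschwartz (iter k hermite_op u).
  by elim: k => //= k; apply: rschwartz_hermite_op.
have -> : j.+1%:R ^+ q * `|inner u (h j)| = `|inner (iter q hermite_op u) (h j)|.
  rewrite -[j.+1%:R ^+ q]ger0_norm ?exprn_ge0 // -normrM; congr `|_|.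
  elim: q => [|q IH]; first by rewrite expr0 mul1r.
  rewrite /= (inner_hermite_op (sq q) (sh j)) hermite_op_hermite (innerZr _ (sq q) (sh j)).
  by rewrite -IH exprS mulrA.
apply: le_trans (cauchy_schwarz (sq q) (sh j)) _.
by rewrite [l2norm (h j)]/l2norm inner_hermite eqxx sqrtr1 mulr1.
Qed.

Lemma sum_inv_sqr_le n : \sum_(j < n) (j.+1%:R ^- 2 : R) <= 2.
Proof.
case: n => [|n]; first by rewrite big_ord0.
(* The sharper bound makes the induction telescope. *)
suff : \sum_(j < n.+1) (j.+1%:R ^- 2 : R) <= 2 - n.+1%:R^-1.
  by move=> H; apply: le_trans H _; rewrite gerBl invr_ge0.
elim: n => [|n IH]; first by rewrite big_ord1 expr1n invr1; lra.
rewrite big_ord_recr /=; apply: le_trans (lerD IH (lexx _)) _.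
rewrite -[n.+2%:R]natr1; have : 0 < n.+1%:R :> R by rewrite ltr0n.
move: (n.+1%:R : R) => a a0; rewrite -subr_ge0.
have -> : 2 - (a + 1)^-1 - (2 - a^-1 + (a + 1) ^- 2) = a^-1 * (a + 1) ^- 2.
  by field; apply/andP; split; lra.
by rewrite mulr_ge0 // invr_ge0 ?exprn_ge0; lra.
Qed.

Definition hermite_proj (n : nat) u : R -> R :=
  fun x => \sum_(j < n) inner u (h j) * h j x.

Lemma rschwartz_proj n u : rschwartz (hermite_proj n u).
Proof.
apply: (rschwartz_sum n (F := fun j x => inner u (h j) * h j x)) => i.
exact/rschwartzZ/rschwartz_hermite.
Qed.

Lemma rsnorm_sum m n (F : nat -> R -> R) : (forall i, rschwartz (F i)) ->
  rsnorm m (fun x => \sum_(i < n) F i x) <= \sum_(i < n) rsnorm m (F i).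
Proof.
move=> sF; elim: n => [|n IH].
  rewrite big_ord0 (_ : (fun x => _) = fun x => 0 * F 0%N x); last first.
    by apply/funext => x; rewrite big_ord0 mul0r.
  by rewrite rsnormZ // normr0 mul0r.
rewrite big_ord_recr /= (_ : (fun x => _) = fun x => \sum_(i < n) F i x + F n x); last first.
  by apply/funext => x; rewrite big_ord_recr.
apply: le_trans (rsnormD m (rschwartz_sum n sF) (sF n)) _.
by rewrite lerD2r.
Qed.

Lemma inner_suml n (F : nat -> R -> R) v : (forall i, rschwartz (F i)) -> rschwartz v ->
  inner (fun x => \sum_(i < n) F i x) v = \sum_(i < n) inner (F i) v.
Proof.
move=> sF sv; elim: n => [|n IH].
  rewrite big_ord0 (_ : (fun x => _) = fun x => 0 * v x); last first.
    by apply/funext => x; rewrite big_ord0 mul0r.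
  by rewrite (innerZl 0 sv sv) mul0r.
rewrite big_ord_recr /= (_ : (fun x => _) = fun x => \sum_(i < n) F i x + F n x); last first.
  by apply/funext => x; rewrite big_ord_recr.
by rewrite (innerDl (rschwartz_sum n sF) (sF n) sv) IH.
Qed.

Lemma proj_dominated m : exists C p, 0 <= C /\
  forall n u, rschwartz u -> rsnorm m (hermite_proj n u) <= C * rsnorm p u.
Proof.
have [K [K0 hK]] := rsnorm_hermite R m.
(* Decay of order m + 2 absorbs the growth (j + 1)^m of the m-th norm of h_j and leaves the summable
   factor (j + 1)^(-2), of total at most 2. *)
have [[C [p [C0 hC]]] dec] := coef_decay (m + 2).
exists (C * K * 2), p; split; first by rewrite !mulr_ge0.
move=> n u su; have sh := rschwartz_hermite R.
apply: (le_trans (rsnorm_sum m n (F := fun j x => inner u (h j) * h j x) _)).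
  by move=> i; exact/rschwartzZ/sh.
apply: (@le_trans _ _ (\sum_(j < n) (C * rsnorm p u * K) * (j.+1%:R ^- 2))).
  apply: ler_sum => j _; rewrite (rsnormZ m _ (sh j)).
  have j0 : 0 < j.+1%:R :> R by rewrite ltr0n.
  rewrite ler_pdivlMr ?exprn_gt0 //.
  apply: (@le_trans _ _ (`|inner u (h j)| * (K * j.+1%:R ^+ m) * j.+1%:R ^+ 2)).
    apply: ler_wpM2r; first by rewrite exprn_ge0 // ltW.
    exact: ler_wpM2l.
  have -> : `|inner u (h j)| * (K * j.+1%:R ^+ m) * j.+1%:R ^+ 2 =
    (j.+1%:R ^+ (m + 2) * `|inner u (h j)|) * K by rewrite exprD; ring.
  apply: ler_wpM2r => //; exact: le_trans (dec u j su) (hC u su).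
rewrite -mulr_sumr.
have CK : 0 <= C * rsnorm p u * K by rewrite !mulr_ge0 // rsnorm_ge0.
apply: le_trans (ler_wpM2l CK (sum_inv_sqr_le n)) _.
by rewrite le_eqVlt; apply/orP; left; apply/eqP; ring.
Qed.

Lemma inner_proj n u j : (j < n)%N -> rschwartz u ->
  inner (hermite_proj n u) (h j) = inner u (h j).
Proof.
move=> jn su; have sh := rschwartz_hermite R.
rewrite /hermite_proj (inner_suml n (F := fun j x => inner u (h j) * h j x) _ (sh j)); last first.
  by move=> i; exact/rschwartzZ/sh.
rewrite (bigD1 (Ordinal jn)) //= (innerZl _ (sh j) (sh j)) inner_hermite eqxx mulr1.
rewrite big1 ?addr0 // => i ij; rewrite (innerZl _ (sh i) (sh j)) inner_hermite.
have -> : (i == j :> nat) = false by apply/negbTE.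
by rewrite mulr0.
Qed.

Lemma inner_number_op1 u v : rschwartz u -> rschwartz v ->
  inner (rnumber_op1 u) v = inner u (rnumber_op1 v).
Proof.
move=> su sv; have sn := rschwartz_number_op1 su; have sm := rschwartz_number_op1 sv.
have sru := rschwartz_raise 1 su; have srv := rschwartz_raise 1 sv.
have n2 : (2 : R) != 0 by [].
apply: (mulfI n2); rewrite -(innerZl 2 sn sv) -(lower_raise1 su) innerC.
rewrite -(inner_raise 1 sv sru) -(innerZr 2 su sm) -(lower_raise1 sv).
by rewrite -(inner_raise 1 su srv) innerC.
Qed.

(** By symmetry of [N + 1], the square of the m-th norm is <(N + 1)^(2m) u, u>. *)
Lemma rsnorm_interpolation m u : rschwartz u ->
  rsnorm m u ^+ 2 <= rsnorm (m + m) u * rsnorm 0 u.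
Proof.
move=> su; rewrite /rsnorm sqr_l2norm.
have si k := rschwartz_iter_number_op1 k su.
have -> : inner (iter m (@rnumber_op1 R) u) (iter m (@rnumber_op1 R) u) =
    inner (iter (m + m) (@rnumber_op1 R) u) u.
  have E k : inner (iter (m + k) (@rnumber_op1 R) u) u =
      inner (iter m (@rnumber_op1 R) u) (iter k (@rnumber_op1 R) u).
    elim: k m => [|k IH] l; first by rewrite addn0.
    by rewrite addnS -addSn IH /= (inner_number_op1 (si l) (si k)).
  by rewrite E.
exact: le_trans (ler_norm _) (cauchy_schwarz (si _) su).
Qed.

(** The remainder r is orthogonal to h_0, ..., h_n, so (n + 1) |r|^2 <= <A r, r> <= |A r| |r|, and
    |r| <= |A r| / (n + 1) in L2. Interpolation with the norm of index 2m, bounded uniformly in n,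
    passes to the m-th norm. The squared form keeps the estimate free of roots. *)
Lemma proj_rate m : exists C p, 0 <= C /\ forall n u, rschwartz u ->
  rsnorm m (fun x => u x - hermite_proj n.+1 u x) ^+ 2 <= C * rsnorm p u ^+ 2 / n.+1%:R.
Proof.
have res q : exists C p, 0 <= C /\ forall n u, rschwartz u ->
    rsnorm q (fun x => u x - hermite_proj n.+1 u x) <= C * rsnorm p u.
  have [C [p [C0 hC]]] := proj_dominated q.
  exists (1 + C), (maxn q p); split; first exact: addr_ge0.
  move=> n u su; apply: le_trans (rsnormB q su (rschwartz_proj _ _)) _.
  rewrite mulrDl mul1r; apply: lerD; first by apply: rsnorm_le => //; exact: leq_maxl.
  apply: le_trans (hC _ _ su) _; apply: ler_wpM2l => //.
  by apply: rsnorm_le => //; exact: leq_maxr.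
have [B [q [B0 hB]]] := scontinuous_raise_lower.2 0%N.
have [C [p [C0 hC]]] := res q.
have [C' [p' [C'0 hC']]] := res (m + m)%N.
exists (C' * (B * C)), (maxn p p'); split; first by rewrite !mulr_ge0.
move=> n u su; have sr : rschwartz (fun x => u x - hermite_proj n.+1 u x).
  by apply: rschwartzB => //; exact: rschwartz_proj.
set r := fun x => _ in sr *.
have n0 : 0 < n.+1%:R :> R by rewrite ltr0n.
have r0 j : (j < n.+1)%N -> inner r (h j) = 0.
  move=> jn; have sh := rschwartz_hermite R j.
  have -> : r = fun x => u x + (-1) * hermite_proj n.+1 u x.
    by apply/funext => x; rewrite mulN1r.
  rewrite (innerDl su (rschwartzZ (-1) (rschwartz_proj _ _)) sh).
  by rewrite (innerZl _ (rschwartz_proj _ _) sh) inner_proj // mulN1r subrr.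
have sl := rschwartz_lower 2^-1 sr.
have srl := rschwartz_raise 2^-1 sl.
have gap := spectral_gap sr r0; rewrite -(inner_raise _ sl sr) -sqr_l2norm in gap.
have l2r : n.+1%:R * l2norm r <= B * C * rsnorm p u.
  apply: le_trans (_ : l2norm (raise 2^-1 (lower 2^-1 r)) <= _); last first.
    by apply: le_trans (hB r sr) _; rewrite -mulrA; apply: ler_wpM2l => //; exact: hC.
  have cs := le_trans gap (le_trans (ler_norm _) (cauchy_schwarz srl sr)).
  have := l2norm_ge0 r; rewrite le_eqVlt => /predU1P[r00|rp].
    by rewrite -r00 mulr0 l2norm_ge0.
  by rewrite -(ler_pM2r rp) -mulrA -expr2.
apply: le_trans (rsnorm_interpolation m sr) _.
rewrite ler_pdivlMr //.
have pu : rsnorm p u <= rsnorm (maxn p p') u by apply: rsnorm_le => //; exact: leq_maxl.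
have pu' : rsnorm p' u <= rsnorm (maxn p p') u by apply: rsnorm_le => //; exact: leq_maxr.
apply: le_trans (_ : (C' * rsnorm (maxn p p') u) * (B * C * rsnorm (maxn p p') u) <= _); last first.
  by rewrite le_eqVlt; apply/orP; left; apply/eqP; ring.
rewrite -[X in X <= _]mulrA; apply: ler_pM; rewrite ?rsnorm_ge0 //.
- by rewrite mulr_ge0 ?rsnorm_ge0 // ltW.
- by apply: le_trans (hC' n u su) _; apply: ler_wpM2l.
- rewrite mulrC; apply: le_trans l2r _; apply: ler_wpM2l => //; exact: mulr_ge0.
Qed.

End HermiteExpansion.

(** * Fourier inversion *)

Section FourierInversion.
Variable R : realType.
Implicit Types (u v w f g : R -> R).
Local Notation mu := (@lebesgue_measure R).
Local Notation h := (@rhermite R).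

(* Such an operator also commutes with the creation operator, hence is the scalar
   [c] on every Hermite function. *)
Lemma commuting_operator_scalar (T : (R -> R) -> R -> R) (c : R) : scontinuous T ->
  (forall u v, rschwartz u -> rschwartz v ->
     T (fun x => u x + v x) = fun x => T u x + T v x) ->
  (forall a u, rschwartz u -> T (fun x => a * u x) = fun x => a * T u x) ->
  (forall u, rschwartz u -> T (derive1 u) = derive1 (T u)) ->
  (forall u, rschwartz u -> T (fun x => x * u x) = fun x => x * T u x) ->
  T (h 0) = (fun x => c * h 0 x) ->
  forall u x, rschwartz u -> T u x = c * u x.
Proof.
move=> cT TD TZ Tder TX T0 u x su; have sh := rschwartz_hermite R.
have Traise v : rschwartz v -> T (raise 2^-1 v) = raise 2^-1 (T v).
  move=> sv; have sx := rschwartzX sv; have sd := rschwartz_derive sv.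
  have -> : raise 2^-1 v = fun x => 2^-1 * (x * v x) + (-1) * derive1 v x.
    by apply/funext => y; rewrite /raise; generalize_derive; ring.
  rewrite (TD _ _ (rschwartzZ _ sx) (rschwartzZ _ sd)) !TZ // TX // Tder //.
  by apply/funext => y; rewrite /raise; generalize_derive; ring.
have Th n : T (h n) = fun x => c * h n x.
  elim: n => // n IH; apply/funext => y; apply: (mulfI (sqrtn_neq0 R n)).
  have := congr1 (@^~ y) (Traise _ (sh n)).
  rewrite IH (raiseZ _ _ (sh n)) raise_hermite TZ //= => ->.
  by rewrite mulrCA.
have Tproj n v : T (hermite_proj n v) = fun x => c * hermite_proj n v x.
  elim: n => [|n IH].
    have -> : hermite_proj 0 v = fun x => 0 * h 0 x.
      by apply/funext => y; rewrite /hermite_proj big_ord0 mul0r.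
    by rewrite TZ //; apply/funext => y; rewrite !mul0r mulr0.
  have -> : hermite_proj n.+1 v = fun x => hermite_proj n v x + inner v (h n) * h n x.
    by apply/funext => y; rewrite /hermite_proj big_ord_recr.
  rewrite (TD _ _ (rschwartz_proj n v) (rschwartzZ _ (sh n))) TZ // IH Th.
  by apply/funext => y; ring.
have [A [p [A0 hA]]] := @sup_dominated R.
have [B [q [B0 hB]]] := dominatedD (dominatedZ A0 (cT.2 p))
  (dominatedZ (mulr_ge0 (normr_ge0 c) A0) (@dominated_rsnorm R p)).
have bound v : rschwartz v -> `|T v x - c * v x| <= B * rsnorm q v.
  move=> sv; apply: le_trans (hB v sv); apply: le_trans (ler_normB _ _) _.
  apply: lerD; first by apply: hA; exact: cT.1.
  by rewrite normrM -mulrA; apply: ler_wpM2l => //; exact: hA.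
have [D [r [D0 hD]]] := proj_rate R q.
apply/eqP; rewrite -subr_eq0 -sqrf_eq0; apply/eqP.
set V := T u x - c * u x.
(* [T] is the scalar c on the span of the h_j, so the value V of T - c at u does not change when a
   Hermite projection is subtracted from u, and the remainder tends to 0. *)
have key n : V ^+ 2 * n.+1%:R <= B ^+ 2 * (D * rsnorm r u ^+ 2).
  have n0 : 0 < n.+1%:R :> R by rewrite ltr0n.
  rewrite -ler_pdivlMr // -mulrA.
  have sp := rschwartz_proj n.+1 u.
  have E : V = T (fun y => u y - hermite_proj n.+1 u y) x -
      c * (u x - hermite_proj n.+1 u x).
    have -> : (fun y => u y - hermite_proj n.+1 u y) = fun y => u y + (-1) * hermite_proj n.+1 u y.
      by apply/funext => y; rewrite mulN1r.
    by rewrite (TD _ _ su (rschwartzZ _ sp)) TZ // Tproj /V; ring.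
  have b := bound _ (rschwartzB su sp); rewrite -E in b.
  apply: le_trans (_ : (B * rsnorm q (fun y => u y - hermite_proj n.+1 u y)) ^+ 2 <= _).
    rewrite -(real_normK (num_real V)); apply: lerXn2r => //; rewrite nnegrE //.
    by rewrite mulr_ge0 // rsnorm_ge0.
  by rewrite exprMn; apply: ler_wpM2l; [exact: sqr_ge0|exact: hD].
apply: (@eq0_of_decay R _ (B ^+ 2 * (D * rsnorm r u ^+ 2))) => s s0.
rewrite mulrC ger0_norm ?sqr_ge0 //.
have [n hn] : exists n, 1 + s ^+ 2 <= n.+1%:R.
  exists (Num.truncn (1 + s ^+ 2)); apply: ltW; exact: truncnS_gt.
by apply: le_trans (key n); apply: ler_wpM2l => //; exact: sqr_ge0.
Qed.

(** * Transforms of Gaussians *)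

Lemma gauss_ode w (c : R) : has_deriv w (fun x => - (2 * c * x) * w x) ->
  w = fun x => w 0 * expR (- (c * x ^+ 2)).
Proof.
move=> hw.
(* The product of w with exp(c x^2) has derivative 0. *)
have hE := @has_deriv_gauss R (- c).
have d0 : has_deriv (fun x => w x * expR (- (- c * x ^+ 2))) (fun=> 0).
  by apply: has_deriv_eq (has_derivM hw hE) _ => x; ring.
apply/funext => x.
have := is_derive_0_is_cst x 0 d0; rewrite expr0n mulr0 oppr0 expR0 mulr1 => <-.
by rewrite -mulrA -expRD (_ : _ + _ = 0) ?expR0 ?mulr1 //; ring.
Qed.

(** Turns the factor x under a transform into a derivative, so that both transforms of a Gaussian
    satisfy the equation of [gauss_ode] with constant 1 / (4 c). *)
Lemma gauss_mulX (c : R) : c != 0 -> (fun x : R => x * expR (- (c * x ^+ 2))) =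
  fun x => - (2 * c)^-1 * derive1 (fun x => expR (- (c * x ^+ 2))) x.
Proof.
move=> c0; rewrite (has_derivE (@has_deriv_gauss R c)).
by apply/funext => x; field.
Qed.

Lemma sin_transform_gauss (c : R) : 0 < c ->
  sin_transform (fun x => expR (- (c * x ^+ 2))) = fun=> 0.
Proof.
move=> c0; have sg := rschwartz_gauss c0; have sg' := rschwartz_derive sg.
have cn0 : c != 0 by rewrite gt_eqF.
rewrite (@gauss_ode (sin_transform _) (4 * c)^-1).
  apply/funext => t; rewrite (_ : sin_transform _ 0 = 0) ?mul0r //.
  rewrite /sin_transform; transitivity (\int[mu]_x (0 * expR (- (c * x ^+ 2)))).
    by apply: eq_Rintegral => x _; rewrite mul0r sin0.
  by rewrite RintegralZl ?mul0r //; exact: rschwartz_integrable.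
apply: has_deriv_eq (has_deriv_sin_transform sg) _ => t.
rewrite gauss_mulX // cos_transformZ // cos_transform_derive //.
by field.
Qed.

Lemma cos_transform_gauss (c : R) : 0 < c ->
  cos_transform (fun x => expR (- (c * x ^+ 2))) =
  fun t => Num.sqrt (pi / c) * expR (- ((4 * c)^-1 * t ^+ 2)).
Proof.
move=> c0; have sg := rschwartz_gauss c0; have sg' := rschwartz_derive sg.
have cn0 : c != 0 by rewrite gt_eqF.
rewrite (@gauss_ode (cos_transform _) (4 * c)^-1).
  apply/funext => t; congr (_ * _); rewrite -gauss_integral //.
  by apply: eq_Rintegral => x _; rewrite mul0r cos0 mul1r.
apply: has_deriv_eq (has_deriv_cos_transform sg) _ => t.
rewrite gauss_mulX // sin_transformZ // sin_transform_derive //.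
by field.
Qed.

Lemma cos_transform_cos_gauss :
  cos_transform (cos_transform (fun x : R => expR (- (4^-1 * x ^+ 2)))) =
  fun x => (2 * pi) * expR (- (4^-1 * x ^+ 2)).
Proof.
have c4 : 0 < (4^-1 : R) by rewrite invr_gt0.
have c1 : 0 < (4 * 4^-1)^-1 :> R by rewrite invr_gt0 mulr_gt0.
rewrite cos_transform_gauss //; apply/funext => t.
rewrite cos_transformZ; last exact: rschwartz_gauss.
rewrite cos_transform_gauss // mulrA; congr (_ * expR (- (_ * _))); last by field.
rewrite -sqrtrM ?divr_ge0 ?pi_ge0 // ?ltW //.
(* The cosine transform of exp(-x^2/4) is sqrt(4 pi) exp(-t^2), and that of exp(-t^2) is sqrt(pi)
   exp(-x^2/4). *)
have -> : pi / 4^-1 * (pi / (4 / 4)^-1) = (2 * pi) ^+ 2 :> R by field.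
by rewrite sqrtr_sqr ger0_norm // mulr_ge0 // pi_ge0.
Qed.

Lemma cos_transform0 t : cos_transform (fun=> 0 : R) t = 0.
Proof.
have E : (fun=> 0 : R) = fun x : R => 0 * (fun=> 0) x by apply/funext => x; rewrite mul0r.
by rewrite [X in cos_transform X]E cos_transformZ ?mul0r //; exact: rschwartz0.
Qed.

Lemma sin_transform0 t : sin_transform (fun=> 0 : R) t = 0.
Proof.
have E : (fun=> 0 : R) = fun x : R => 0 * (fun=> 0) x by apply/funext => x; rewrite mul0r.
by rewrite [X in sin_transform X]E sin_transformZ ?mul0r //; exact: rschwartz0.
Qed.

(** [E u] and [K u] are the real and imaginary parts of the transform with kernel exp(i x t) applied
    to the transform of u with kernel exp(-i t s). Inversion says that E is 2 pi and K is 0. *)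
Let E u : R -> R := fun x => cos_transform (cos_transform u) x + sin_transform (sin_transform u) x.
Let K u : R -> R := fun x => sin_transform (cos_transform u) x + (-1) * cos_transform (sin_transform u) x.

Let cE : scontinuous E.
Proof.
have c := @scontinuous_cos_transform R; have s := @scontinuous_sin_transform R.
exact: scontinuousD (scontinuous_comp c c) (scontinuous_comp s s).
Qed.

Let cK : scontinuous K.
Proof.
have c := @scontinuous_cos_transform R; have s := @scontinuous_sin_transform R.
exact: scontinuousD (scontinuous_comp s c) (scontinuousZ (-1) (scontinuous_comp c s)).
Qed.

Lemma cos_transformDE u v : rschwartz u -> rschwartz v ->
  cos_transform (fun x => u x + v x) = fun t => cos_transform u t + cos_transform v t.
Proof. by move=> su sv; apply/funext => t; rewrite cos_transformD. Qed.

Lemma sin_transformDE u v : rschwartz u -> rschwartz v ->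
  sin_transform (fun x => u x + v x) = fun t => sin_transform u t + sin_transform v t.
Proof. by move=> su sv; apply/funext => t; rewrite sin_transformD. Qed.

Lemma cos_transformZE (c : R) u : rschwartz u ->
  cos_transform (fun x => c * u x) = fun t => c * cos_transform u t.
Proof. by move=> su; apply/funext => t; rewrite cos_transformZ. Qed.

Lemma sin_transformZE (c : R) u : rschwartz u ->
  sin_transform (fun x => c * u x) = fun t => c * sin_transform u t.
Proof. by move=> su; apply/funext => t; rewrite sin_transformZ. Qed.

Lemma cos_transform_deriveE u : rschwartz u ->
  cos_transform (derive1 u) = fun t => t * sin_transform u t.
Proof. by move=> su; apply/funext => t; rewrite cos_transform_derive. Qed.

Lemma sin_transform_deriveE u : rschwartz u ->
  sin_transform (derive1 u) = fun t => (-1) * (t * cos_transform u t).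
Proof. by move=> su; apply/funext => t; rewrite sin_transform_derive // mulN1r. Qed.

Lemma cos_transformXE u : rschwartz u ->
  cos_transform (fun x => x * u x) = derive1 (sin_transform u).
Proof. by move=> su; rewrite derive1_sin_transform. Qed.

Lemma sin_transformXE u : rschwartz u ->
  sin_transform (fun x => x * u x) = fun t => (-1) * derive1 (cos_transform u) t.
Proof.
by move=> su; rewrite derive1_cos_transform //; apply/funext => t; rewrite mulN1r opprK.
Qed.

Let sc u : rschwartz u -> rschwartz (cos_transform u).
Proof. exact: rschwartz_cos_transform. Qed.
Let ss u : rschwartz u -> rschwartz (sin_transform u).
Proof. exact: rschwartz_sin_transform. Qed.

(** Each transform exchanges x and d/dx up to sign, so [E], built from two of them, commutes with
    both; the scalar is read off the Gaussian h_0. *)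
Lemma fourier_inversion_even u x : rschwartz u ->
  cos_transform (cos_transform u) x + sin_transform (sin_transform u) x = 2 * pi * u x.
Proof.
apply: (commuting_operator_scalar (T := E) (c := 2 * pi)) => //.
- move=> {}u v su sv; rewrite /E.
  rewrite (cos_transformDE su sv) (sin_transformDE su sv).
  rewrite (cos_transformDE (sc su) (sc sv)) (sin_transformDE (ss su) (ss sv)).
  by apply/funext => y; ring.
- move=> a {}u su; rewrite /E (cos_transformZE _ su) (sin_transformZE _ su).
  rewrite (cos_transformZE _ (sc su)) (sin_transformZE _ (ss su)).
  by apply/funext => y; ring.
- move=> {}u su; rewrite /E (cos_transform_deriveE su) (sin_transform_deriveE su).
  rewrite (cos_transformXE (ss su)) (sin_transformZE _ (rschwartzX (sc su))).
  rewrite (sin_transformXE (sc su)) (derive1_D (sc (sc su)) (ss (ss su))).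
  by apply/funext => y; generalize_derive; ring.
- move=> {}u su; rewrite /E (cos_transformXE su) (sin_transformXE su).
  rewrite (cos_transform_deriveE (ss su)) (sin_transformZE _ (rschwartz_derive (sc su))).
  rewrite (sin_transform_deriveE (sc su)).
  by apply/funext => y; ring.
- have c4 : 0 < (4^-1 : R) by rewrite invr_gt0.
  have sg := rschwartz_gauss c4.
  have -> : h 0 = fun x => hermite_coef R 0 * expR (- (4^-1 * x ^+ 2)).
    by rewrite rhermiteE; apply/funext => y; rewrite hornerC mul1r.
  rewrite /E (cos_transformZE _ sg) (sin_transformZE _ sg).
  rewrite (cos_transformZE _ (sc sg)) (sin_transformZE _ (ss sg)).
  rewrite cos_transform_cos_gauss sin_transform_gauss //.
  apply/funext => y.
  by rewrite sin_transform0; ring.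
Qed.

(** As for [E], with scalar 0, because the sine transform annihilates Gaussians. *)
Lemma fourier_inversion_odd u x : rschwartz u ->
  sin_transform (cos_transform u) x = cos_transform (sin_transform u) x.
Proof.
move=> su; suff : K u x = 0 * u x.
  by rewrite /K mul0r mulN1r => /eqP; rewrite subr_eq0 => /eqP.
move: u x su; apply: (commuting_operator_scalar (T := K)) => //.
- move=> u v su sv; rewrite /K.
  rewrite (cos_transformDE su sv) (sin_transformDE su sv).
  rewrite (cos_transformDE (ss su) (ss sv)) (sin_transformDE (sc su) (sc sv)).
  by apply/funext => y; ring.
- move=> a u su; rewrite /K (cos_transformZE _ su) (sin_transformZE _ su).
  rewrite (cos_transformZE _ (ss su)) (sin_transformZE _ (sc su)).
  by apply/funext => y; ring.
- move=> u su; rewrite /K (cos_transform_deriveE su) (sin_transform_deriveE su).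
  rewrite (cos_transformZE _ (rschwartzX (sc su))) (cos_transformXE (sc su)).
  rewrite (sin_transformXE (ss su)) (derive1_D (ss (sc su)) (rschwartzZ _ (sc (ss su)))).
  rewrite (derive1_Z _ (sc (ss su))).
  by apply/funext => y; generalize_derive; ring.
- move=> u su; rewrite /K (cos_transformXE su) (sin_transformXE su).
  rewrite (sin_transform_deriveE (ss su)) (cos_transformZE _ (rschwartz_derive (sc su))).
  rewrite (cos_transform_deriveE (sc su)).
  by apply/funext => y; ring.
- have c4 : 0 < (4^-1 : R) by rewrite invr_gt0.
  have c1 : 0 < (4 * 4^-1)^-1 :> R by rewrite invr_gt0 mulr_gt0.
  have sg := rschwartz_gauss c4.
  have -> : h 0 = fun x => hermite_coef R 0 * expR (- (4^-1 * x ^+ 2)).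
    by rewrite rhermiteE; apply/funext => y; rewrite hornerC mul1r.
  rewrite /K (cos_transformZE _ sg) (sin_transformZE _ sg).
  rewrite (sin_transformZE _ (sc sg)) (cos_transformZE _ (ss sg)).
  rewrite cos_transform_gauss // sin_transform_gauss // (sin_transformZE _ (rschwartz_gauss c1)).
  rewrite sin_transform_gauss //.
  apply/funext => y.
  by rewrite cos_transform0; ring.
Qed.

End FourierInversion.

(** * Complex Schwartz functions *)

#[local] Transparent derive1 Rintegral rschwartz.

Section ComplexSchwartz.
Variable R : realType.
Implicit Types (u v : R -> R) (f g k : R -> R[i]) (z w : R[i]).
Local Notation mu := (@lebesgue_measure R).

Definition reF f : R -> R := fun x => complex.Re (f x).
Definition imF f : R -> R := fun x => complex.Im (f x).

Lemma complex_ext z w : complex.Re z = complex.Re w -> complex.Im z = complex.Im w -> z = w.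
Proof. by case: z w => [a b] [c d] /= -> ->. Qed.

Lemma complexF_ext f g : reF f = reF g -> imF f = imF g -> f = g.
Proof.
by move=> /funeqP rfg /funeqP ifg; apply/funext => x; apply: complex_ext;
  [exact: rfg|exact: ifg].
Qed.

Lemma Re_add z w : complex.Re (z + w) = complex.Re z + complex.Re w.
Proof. by case: z; case: w. Qed.
Lemma Im_add z w : complex.Im (z + w) = complex.Im z + complex.Im w.
Proof. by case: z; case: w. Qed.
Lemma Re_opp z : complex.Re (- z) = - complex.Re z.
Proof. by case: z. Qed.
Lemma Im_opp z : complex.Im (- z) = - complex.Im z.
Proof. by case: z. Qed.
Lemma Re_mul z w : complex.Re (z * w) =
  complex.Re z * complex.Re w - complex.Im z * complex.Im w.
Proof. by case: z; case: w. Qed.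
Lemma Im_mul z w : complex.Im (z * w) =
  complex.Re z * complex.Im w + complex.Im z * complex.Re w.
Proof. by case: z; case: w => *; rewrite /= addrC. Qed.

Definition partsE := (Re_add, Im_add, Re_opp, Im_opp, Re_mul, Im_mul).

Lemma norm_Re_le z : `|complex.Re z| <= normc z.
Proof.
case: z => a b /=; rewrite -sqrtr_sqr; apply: ler_wsqrtr.
by rewrite lerDl sqr_ge0.
Qed.

Lemma norm_Im_le z : `|complex.Im z| <= normc z.
Proof.
case: z => a b /=; rewrite -sqrtr_sqr; apply: ler_wsqrtr.
by rewrite lerDr sqr_ge0.
Qed.

Lemma normc_ge0 z : 0 <= normc z.
Proof. by case: z => a b; exact: sqrtr_ge0. Qed.

Lemma sqr_normc z : normc z ^+ 2 = complex.Re z ^+ 2 + complex.Im z ^+ 2.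
Proof. by case: z => a b; rewrite /= sqr_sqrtr // addr_ge0 // sqr_ge0. Qed.

Lemma normc_le z : normc z <= `|complex.Re z| + `|complex.Im z|.
Proof.
rewrite -(@ler_pXn2r _ 2) ?nnegrE ?normc_ge0 ?addr_ge0 //.
rewrite sqr_normc -(real_normK (num_real (complex.Re z))) -(real_normK (num_real (complex.Im z))).
by rewrite sqrrD -addrA lerD2l lerDr mulrn_wge0 // mulr_ge0.
Qed.

Lemma reF_cderive l f : reF (iter l (@cderive R) f) = iter l (fun u => derive1 u) (reF f).
Proof. by elim: l => //= l <-. Qed.

Lemma imF_cderive l f : imF (iter l (@cderive R) f) = iter l (fun u => derive1 u) (imF f).
Proof. by elim: l => //= l <-. Qed.

Lemma schwartzP f : schwartz f <-> rschwartz (reF f) /\ rschwartz (imF f).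
Proof.
split=> [[sm bd]|[[sr br] [si bi]]].
- split; split=> [k x|l k].
  + by rewrite -reF_cderive; case: (sm k x).
  + have [M hM] := bd k l; exists M => x; apply: le_trans (hM x).
    by rewrite -reF_cderive; apply: ler_wpM2l; [exact: exprn_ge0|exact: norm_Re_le].
  + by rewrite -imF_cderive; case: (sm k x).
  + have [M hM] := bd k l; exists M => x; apply: le_trans (hM x).
    by rewrite -imF_cderive; apply: ler_wpM2l; [exact: exprn_ge0|exact: norm_Im_le].
- split=> [k x|k l].
    by split; [have := sr k x; rewrite -reF_cderive|have := si k x; rewrite -imF_cderive].
  have [M hM] := br l k; have [N hN] := bi l k; exists (M + N) => x.
  apply: le_trans (lerD (hM x) (hN x)); rewrite -mulrDr -reF_cderive -imF_cderive.
  by apply: ler_wpM2l; [exact: exprn_ge0|exact: normc_le].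
Qed.

#[local] Opaque derive1 Rintegral rschwartz.

Lemma schwartz_re f : schwartz f -> rschwartz (reF f).
Proof. by case/schwartzP. Qed.
Lemma schwartz_im f : schwartz f -> rschwartz (imF f).
Proof. by case/schwartzP. Qed.

Lemma reF_number_op1 m f : reF (iter m (@number_op1 R) f) = iter m (@rnumber_op1 R) (reF f).
Proof.
elim: m => //= m <-; apply/funext => x; rewrite /reF /rnumber_op1 /number_op1.
by rewrite !partsE /= !mul0r !subr0.
Qed.

Lemma imF_number_op1 m f : imF (iter m (@number_op1 R) f) = iter m (@rnumber_op1 R) (imF f).
Proof.
elim: m => //= m <-; apply/funext => x; rewrite /imF /rnumber_op1 /number_op1.
by rewrite !partsE /= !mul0r !addr0.
Qed.

Lemma snorm_ge0 m f : 0 <= snorm m f.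
Proof. exact: sqrtr_ge0. Qed.

Lemma sqr_snorm m f : schwartz f ->
  snorm m f ^+ 2 = rsnorm m (reF f) ^+ 2 + rsnorm m (imF f) ^+ 2.
Proof.
move=> sf; have sr := rschwartz_iter_number_op1 m (schwartz_re sf).
have si := rschwartz_iter_number_op1 m (schwartz_im sf).
rewrite sqr_sqrtr; last by apply: Rintegral_ge0 => x _; exact: sqr_ge0.
rewrite /rsnorm !sqr_l2norm /inner -RintegralD //.
- apply: eq_Rintegral => x _; rewrite sqr_normc -!expr2.
  by rewrite -reF_number_op1 -imF_number_op1.
- exact: rschwartz_integrable (rschwartzM sr sr).
- exact: rschwartz_integrable (rschwartzM si si).
Qed.

Lemma rsnorm_re_le m f : schwartz f -> rsnorm m (reF f) <= snorm m f.
Proof.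
move=> sf; rewrite -(@ler_pXn2r _ 2) ?nnegrE ?rsnorm_ge0 ?snorm_ge0 //.
by rewrite (sqr_snorm m sf) lerDl sqr_ge0.
Qed.

Lemma rsnorm_im_le m f : schwartz f -> rsnorm m (imF f) <= snorm m f.
Proof.
move=> sf; rewrite -(@ler_pXn2r _ 2) ?nnegrE ?rsnorm_ge0 ?snorm_ge0 //.
by rewrite (sqr_snorm m sf) lerDr sqr_ge0.
Qed.

Lemma snorm_le_parts m f : schwartz f -> snorm m f <= rsnorm m (reF f) + rsnorm m (imF f).
Proof.
move=> sf; have r0 := rsnorm_ge0 m (reF f); have i0 := rsnorm_ge0 m (imF f).
rewrite -(@ler_pXn2r _ 2) ?nnegrE ?addr_ge0 ?snorm_ge0 //.
by rewrite (sqr_snorm m sf) sqrrD addrAC lerDl mulrn_wge0 // mulr_ge0.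
Qed.

Lemma snorm_le m n f : (m <= n)%N -> schwartz f -> snorm m f <= snorm n f.
Proof.
move=> mn sf; rewrite -(@ler_pXn2r _ 2) ?nnegrE ?snorm_ge0 //.
rewrite (sqr_snorm m sf) (sqr_snorm n sf).
by apply: lerD; apply: lerXn2r; rewrite ?nnegrE ?rsnorm_ge0 //; apply: rsnorm_le => //;
  [exact: schwartz_re|exact: schwartz_im].
Qed.

Lemma schwartzD f g : schwartz f -> schwartz g -> schwartz (fun x => f x + g x).
Proof.
move=> /schwartzP[fr fi] /schwartzP[gr gi]; apply/schwartzP; split.
  have := rschwartzD fr gr; congr rschwartz.
  by apply/funext => x; rewrite /reF Re_add.
have := rschwartzD fi gi; congr rschwartz.
by apply/funext => x; rewrite /imF Im_add.
Qed.

Lemma schwartzM f g : schwartz f -> schwartz g -> schwartz (fun x => f x * g x).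
Proof.
move=> /schwartzP[fr fi] /schwartzP[gr gi]; apply/schwartzP; split.
  have := rschwartzB (rschwartzM fr gr) (rschwartzM fi gi); congr rschwartz.
  by apply/funext => x; rewrite /reF Re_mul.
have := rschwartzD (rschwartzM fr gi) (rschwartzM fi gr); congr rschwartz.
by apply/funext => x; rewrite /imF Im_mul.
Qed.

Lemma schwartzZ (c : R[i]) f : schwartz f -> schwartz (fun x => c * f x).
Proof.
move=> /schwartzP[fr fi]; apply/schwartzP; split.
  have := rschwartzB (rschwartzZ (complex.Re c) fr) (rschwartzZ (complex.Im c) fi).
  congr rschwartz; by apply/funext => x; rewrite /reF Re_mul.
have := rschwartzD (rschwartzZ (complex.Re c) fi) (rschwartzZ (complex.Im c) fr).
congr rschwartz; by apply/funext => x; rewrite /imF Im_mul.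
Qed.

Lemma schwartzB f g : schwartz f -> schwartz g -> schwartz (fun x => f x - g x).
Proof.
move=> sf sg; have := schwartzD sf (schwartzZ (-1) sg); congr schwartz.
by apply/funext => x; rewrite mulN1r.
Qed.

Lemma schwartz0 : schwartz (fun _ : R => 0 : R[i]).
Proof. by apply/schwartzP; split; exact: rschwartz0. Qed.

Lemma schwartz_sum n (F : nat -> R -> R[i]) : (forall i, schwartz (F i)) ->
  schwartz (fun x => \sum_(i < n) F i x).
Proof.
move=> sF; elim: n => [|n IH].
  have -> : (fun x => \sum_(i < 0) F i x) = fun=> 0 by apply/funext => x; rewrite big_ord0.
  exact: schwartz0.
have -> : (fun x => \sum_(i < n.+1) F i x) = fun x => \sum_(i < n) F i x + F n x.
  by apply/funext => x; rewrite big_ord_recr.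
exact: schwartzD.
Qed.

(** The factor 2 comes from the passage through real and imaginary parts; it does not matter for
    estimates up to constants. *)
Lemma snormD m f g : schwartz f -> schwartz g ->
  snorm m (fun x => f x + g x) <= 2 * (snorm m f + snorm m g).
Proof.
move=> sf sg; apply: le_trans (snorm_le_parts m (schwartzD sf sg)) _.
have -> : reF (fun x => f x + g x) = fun x => reF f x + reF g x.
  by apply/funext => x; rewrite /reF Re_add.
have -> : imF (fun x => f x + g x) = fun x => imF f x + imF g x.
  by apply/funext => x; rewrite /imF Im_add.
have h1 := rsnormD m (schwartz_re sf) (schwartz_re sg).
have h2 := rsnormD m (schwartz_im sf) (schwartz_im sg).
have := rsnorm_re_le m sf; have := rsnorm_re_le m sg.
have := rsnorm_im_le m sf; have := rsnorm_im_le m sg.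
move: h1 h2; move: (rsnorm m _) (rsnorm m _) (rsnorm m (reF f)) => a b c; lra.
Qed.

Lemma snormZ_real m (c : R) f : schwartz f ->
  snorm m (fun x => c%:C * f x) = `|c| * snorm m f.
Proof.
move=> sf; apply/eqP; rewrite -(@eqrXn2 _ 2) ?mulr_ge0 ?snorm_ge0 //; apply/eqP.
rewrite exprMn (sqr_snorm m (schwartzZ _ sf)) (sqr_snorm m sf).
have -> : reF (fun x => c%:C * f x) = fun x => c * reF f x.
  by apply/funext => x; rewrite /reF Re_mul /= mul0r subr0.
have -> : imF (fun x => c%:C * f x) = fun x => c * imF f x.
  by apply/funext => x; rewrite /imF Im_mul /= mul0r addr0.
rewrite (rsnormZ m c (schwartz_re sf)) (rsnormZ m c (schwartz_im sf)).
by rewrite !exprMn -mulrDr.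
Qed.

Definition ccontinuous (U : (R -> R[i]) -> R -> R[i]) :=
  (forall f, schwartz f -> schwartz (U f)) /\
  forall m, exists C p, 0 <= C /\ forall f, schwartz f -> snorm m (U f) <= C * snorm p f.

(** [A], [B], [C], [D] are the entries of [U] as a 2 x 2 matrix acting on real and imaginary
    parts. *)
Lemma ccontinuous_parts U (A B C D : (R -> R) -> R -> R) :
  scontinuous A -> scontinuous B -> scontinuous C -> scontinuous D ->
  (forall f, schwartz f -> reF (U f) = fun x => A (reF f) x + B (imF f) x) ->
  (forall f, schwartz f -> imF (U f) = fun x => C (reF f) x + D (imF f) x) ->
  ccontinuous U.
Proof.
move=> [sA cA] [sB cB] [sC cC] [sD cD] hr hi.
have sU f : schwartz f -> schwartz (U f).
  move=> sf; apply/schwartzP; rewrite hr // hi //; move: sf => /schwartzP[fr fi].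
  by split; apply: rschwartzD; [exact: sA|exact: sB|exact: sC|exact: sD].
split => // m.
have [K1 [p1 [K10 h1]]] := dominatedD (dominatedD (cA m) (cB m)) (dominatedD (cC m) (cD m)).
exists (K1 + K1), p1; split; first by rewrite addr_ge0.
move=> f sf; apply: le_trans (snorm_le_parts m (sU f sf)) _.
have fr := schwartz_re sf; have fi := schwartz_im sf.
rewrite hr // hi //.
have b1 := rsnormD m (sA _ fr) (sB _ fi); have b2 := rsnormD m (sC _ fr) (sD _ fi).
apply: le_trans (lerD b1 b2) _.
have e1 := le_trans (h1 _ fr) (ler_wpM2l K10 (rsnorm_re_le p1 sf)).
have e2 := le_trans (h1 _ fi) (ler_wpM2l K10 (rsnorm_im_le p1 sf)).
rewrite mulrDl; apply: le_trans (lerD e1 e2).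
have := rsnorm_ge0 m (A (imF f)); have := rsnorm_ge0 m (B (reF f)).
have := rsnorm_ge0 m (C (imF f)); have := rsnorm_ge0 m (D (reF f)).
move: (rsnorm m (A (reF f))) (rsnorm m (B (imF f))) (rsnorm m (C (reF f))) (rsnorm m (D (imF f))).
move: (rsnorm m (A (imF f))) (rsnorm m (B (reF f))) (rsnorm m (C (imF f))) (rsnorm m (D (reF f))).
by move=> *; lra.
Qed.

Lemma ccontinuous_comp U V : ccontinuous U -> ccontinuous V -> ccontinuous (fun f => U (V f)).
Proof.
move=> [sU cU] [sV cV]; split=> [f sf|m]; first exact/sU/sV.
have [C [p [C0 hC]]] := cU m; have [D [q [D0 hD]]] := cV p.
exists (C * D), q; split; first exact: mulr_ge0.
move=> f sf; apply: le_trans (hC _ (sV _ sf)) _; rewrite -mulrA.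
exact: ler_wpM2l (hD _ sf).
Qed.

Lemma ccontinuous_scale (c : R[i]) : ccontinuous (fun f x => c * f x).
Proof.
apply: (ccontinuous_parts (scontinuousZ (complex.Re c) (@scontinuous_id R))
  (scontinuousZ (- complex.Im c) (@scontinuous_id R))
  (scontinuousZ (complex.Im c) (@scontinuous_id R))
  (scontinuousZ (complex.Re c) (@scontinuous_id R))) => f _; apply/funext => x.
- by rewrite /reF /imF Re_mul mulNr.
- by rewrite /reF /imF Im_mul addrC.
Qed.

Lemma ccontinuous_cderive : ccontinuous (@cderive R).
Proof.
have Z := scontinuousZ 0 (@scontinuous_id R).
apply: (ccontinuous_parts (@scontinuous_derive R) Z Z (@scontinuous_derive R)) => f _;
  apply/funext => x; rewrite mul0r ?addr0 ?add0r //.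
Qed.

Definition creflect f : R -> R[i] := fun x => f (- x).

Lemma ccontinuous_creflect : ccontinuous creflect.
Proof.
have Z := scontinuousZ 0 (@scontinuous_id R).
apply: (ccontinuous_parts (@scontinuous_opp R) Z Z (@scontinuous_opp R)) => f _;
  apply/funext => x; rewrite mul0r ?addr0 ?add0r //.
Qed.

Definition cbicontinuous (Q : (R -> R[i]) -> (R -> R[i]) -> R -> R[i]) :=
  (forall f g, schwartz f -> schwartz g -> schwartz (Q f g)) /\
  forall m, exists C p, 0 <= C /\ forall f g, schwartz f -> schwartz g ->
    snorm m (Q f g) <= C * (snorm p f * snorm p g).

Lemma cbicontinuous_mul : cbicontinuous (fun f g x => f x * g x).
Proof.
split=> [f g|m]; first exact: schwartzM.
have [C [p [C0 hC]]] := bidominatedM R m.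
exists (4 * C), p; split; first exact: mulr_ge0.
move=> f g sf sg; apply: le_trans (snorm_le_parts m (schwartzM sf sg)) _.
have fr := schwartz_re sf; have fi := schwartz_im sf.
have gr := schwartz_re sg; have gi := schwartz_im sg.
have -> : reF (fun x => f x * g x) = fun x => reF f x * reF g x - imF f x * imF g x.
  by apply/funext => x; rewrite /reF Re_mul.
have -> : imF (fun x => f x * g x) = fun x => reF f x * imF g x + imF f x * reF g x.
  by apply/funext => x; rewrite /imF Im_mul.
apply: le_trans (lerD (rsnormB m (rschwartzM fr gr) (rschwartzM fi gi))
  (rsnormD m (rschwartzM fr gi) (rschwartzM fi gr))) _.
have b u v : rschwartz u -> rschwartz v -> rsnorm p u <= snorm p f ->
    rsnorm p v <= snorm p g ->
    rsnorm m (fun x => u x * v x) <= C * (snorm p f * snorm p g).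
  move=> su sv hu hv; apply: le_trans (hC u v su sv) _; apply: ler_wpM2l => //.
  by apply: ler_pM => //; exact: rsnorm_ge0.
have rf := rsnorm_re_le p sf; have rg := rsnorm_re_le p sg.
have jf := rsnorm_im_le p sf; have jg := rsnorm_im_le p sg.
apply: le_trans (lerD (lerD (b _ _ fr gr rf rg) (b _ _ fi gi jf jg))
  (lerD (b _ _ fr gi rf jg) (b _ _ fi gr jf rg))) _.
by rewrite le_eqVlt; apply/orP; left; apply/eqP; ring.
Qed.

Lemma cbicontinuous_comp U Q V W : ccontinuous U -> cbicontinuous Q -> ccontinuous V ->
  ccontinuous W -> cbicontinuous (fun f g => U (Q (V f) (W g))).
Proof.
move=> [sU cU] [sQ cQ] [sV cV] [sW cW]; split=> [f g sf sg|m].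
  by apply: sU; apply: sQ; [exact: sV|exact: sW].
have [C [p [C0 hC]]] := cU m; have [D [q [D0 hD]]] := cQ p.
have [V1 [v [V0 hV]]] := cV q; have [W1 [w [W0 hW]]] := cW q.
exists (C * (D * (V1 * W1))), (maxn v w); split; first by rewrite !mulr_ge0.
move=> f g sf sg; apply: le_trans (hC _ (sQ _ _ (sV _ sf) (sW _ sg))) _.
rewrite -mulrA; apply: ler_wpM2l => //.
apply: le_trans (hD _ _ (sV _ sf) (sW _ sg)) _.
rewrite -mulrA; apply: ler_wpM2l => //; rewrite mulrACA.
apply: ler_pM; rewrite ?snorm_ge0 //.
  apply: le_trans (hV _ sf) _; apply: ler_wpM2l => //.
  by apply: snorm_le => //; exact: leq_maxl.
apply: le_trans (hW _ sg) _; apply: ler_wpM2l => //.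
by apply: snorm_le => //; exact: leq_maxr.
Qed.

End ComplexSchwartz.

Ltac generalize_transforms :=
  repeat match goal with
  | |- context [cos_transform ?u ?t] => move: (cos_transform u t) => ?
  | |- context [sin_transform ?u ?t] => move: (sin_transform u t) => ?
  end.

(** * The complex Fourier transform *)

Section ComplexFourier.
Variable R : realType.
Implicit Types (u v : R -> R) (f g k : R -> R[i]) (z w : R[i]).
Local Notation mu := (@lebesgue_measure R).
Local Notation ct := (@cos_transform R).
Local Notation st := (@sin_transform R).
Local Notation c0 := ((Num.sqrt (2 * pi))^-1 : R).

Lemma sqrt2pi_gt0 : 0 < Num.sqrt (2 * pi) :> R.
Proof. by rewrite sqrtr_gt0 mulr_gt0 // pi_gt0. Qed.

Lemma sqr_sqrt2pi : Num.sqrt (2 * pi) * Num.sqrt (2 * pi) = 2 * pi :> R.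
Proof. by rewrite -expr2 sqr_sqrtr // mulr_ge0 // pi_ge0. Qed.

Lemma inv_sqrt2piK : c0 * c0 * (2 * pi) = 1.
Proof.
rewrite -[X in _ * X]sqr_sqrt2pi; move: (Num.sqrt _) sqrt2pi_gt0 => s s0.
by field; rewrite gt_eqF.
Qed.

Lemma fourier_parts f t : schwartz f -> fourier f t =
  (c0 * (ct (reF f) t + st (imF f) t)) +i* (c0 * (ct (imF f) t - st (reF f) t)).
Proof.
move=> sf; have sr := schwartz_re sf; have si := schwartz_im sf.
have ic u (su : rschwartz u) := rschwartz_integrable (rschwartz_cosM t su).
have iss u (su : rschwartz u) := rschwartz_integrable (rschwartz_sinM t su).
rewrite /fourier; apply: complex_ext; rewrite !partsE /= mul0r ?subr0 ?addr0; congr (_ * _).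
  rewrite /cos_transform /sin_transform -RintegralD //; try exact: ic; try exact: iss.
  by apply: eq_Rintegral => x _; rewrite Re_mul /= mulNr opprK.
rewrite /cos_transform /sin_transform -RintegralB //; try exact: ic; try exact: iss.
by apply: eq_Rintegral => x _; rewrite Im_mul /= mulNr.
Qed.

Lemma inv_fourier_parts f t : schwartz f -> inv_fourier f t =
  (c0 * (ct (reF f) t - st (imF f) t)) +i* (c0 * (ct (imF f) t + st (reF f) t)).
Proof.
move=> sf; have sr := schwartz_re sf; have si := schwartz_im sf.
have ic u (su : rschwartz u) := rschwartz_integrable (rschwartz_cosM t su).
have iss u (su : rschwartz u) := rschwartz_integrable (rschwartz_sinM t su).
rewrite /inv_fourier; apply: complex_ext; rewrite !partsE /= mul0r ?subr0 ?addr0; congr (_ * _).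
  rewrite /cos_transform /sin_transform -RintegralB //; try exact: ic; try exact: iss.
  by apply: eq_Rintegral => x _; rewrite Re_mul.
rewrite /cos_transform /sin_transform -RintegralD //; try exact: ic; try exact: iss.
by apply: eq_Rintegral => x _; rewrite Im_mul.
Qed.

Lemma ccontinuous_fourier : ccontinuous (@fourier R).
Proof.
have cc := scontinuousZ c0 (@scontinuous_cos_transform R).
have cs := scontinuousZ c0 (@scontinuous_sin_transform R).
have cs' := scontinuousZ (- c0) (@scontinuous_sin_transform R).
apply: (ccontinuous_parts cc cs cs' cc) => f sf; apply/funext => x.
  by rewrite /reF fourier_parts //= mulrDr.
by rewrite /imF fourier_parts //= mulrBr mulNr addrC.
Qed.

Lemma ccontinuous_inv_fourier : ccontinuous (@inv_fourier R).
Proof.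
have cc := scontinuousZ c0 (@scontinuous_cos_transform R).
have cs := scontinuousZ c0 (@scontinuous_sin_transform R).
have cs' := scontinuousZ (- c0) (@scontinuous_sin_transform R).
apply: (ccontinuous_parts cc cs' cs cc) => f sf; apply/funext => x.
  by rewrite /reF inv_fourier_parts //= mulrBr mulNr.
by rewrite /imF inv_fourier_parts //= mulrDr addrC.
Qed.

Lemma schwartz_fourier f : schwartz f -> schwartz (fourier f).
Proof. exact: ccontinuous_fourier.1. Qed.

Lemma schwartz_inv_fourier f : schwartz f -> schwartz (inv_fourier f).
Proof. exact: ccontinuous_inv_fourier.1. Qed.

Lemma schwartz_cderive f : schwartz f -> schwartz (cderive f).
Proof. exact: (@ccontinuous_cderive R).1. Qed.

Lemma schwartz_creflect f : schwartz f -> schwartz (creflect f).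
Proof. exact: (@ccontinuous_creflect R).1. Qed.

Lemma reF_fourier f : schwartz f ->
  reF (fourier f) = fun t => c0 * (ct (reF f) t + st (imF f) t).
Proof. by move=> sf; apply/funext => t; rewrite /reF fourier_parts. Qed.

Lemma imF_fourier f : schwartz f ->
  imF (fourier f) = fun t => c0 * (ct (imF f) t + (-1) * st (reF f) t).
Proof. by move=> sf; apply/funext => t; rewrite /imF fourier_parts // mulN1r. Qed.

Lemma reF_inv_fourier f : schwartz f ->
  reF (inv_fourier f) = fun t => c0 * (ct (reF f) t + (-1) * st (imF f) t).
Proof. by move=> sf; apply/funext => t; rewrite /reF inv_fourier_parts // mulN1r. Qed.

Lemma imF_inv_fourier f : schwartz f ->
  imF (inv_fourier f) = fun t => c0 * (ct (imF f) t + st (reF f) t).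
Proof. by move=> sf; apply/funext => t; rewrite /imF inv_fourier_parts. Qed.

Lemma inv_fourierE f t : inv_fourier f t = fourier f (- t).
Proof.
rewrite /inv_fourier /fourier; congr (_ * cintegral _).
by apply/funext => x; rewrite mulNr cosN sinN opprK.
Qed.

Let sc u : rschwartz u -> rschwartz (ct u).
Proof. exact: rschwartz_cos_transform. Qed.
Let ss u : rschwartz u -> rschwartz (st u).
Proof. exact: rschwartz_sin_transform. Qed.

(** In each part the even inversion formula returns 2 pi times the function, which [c0 * c0]
    normalises, while the odd one cancels the cross terms. *)
Lemma fourierK f : schwartz f -> inv_fourier (fourier f) = f.
Proof.
move=> sf; have sr := schwartz_re sf; have si := schwartz_im sf.
have sF := schwartz_fourier sf.
have [crr cri cii cir] : [/\ rschwartz (ct (reF f)), rschwartz (st (reF f)),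
  rschwartz (ct (imF f)) & rschwartz (st (imF f))] by split; [exact: sc|exact: ss|exact: sc|exact: ss].
have s1 := rschwartzD crr cir; have s2 := rschwartzD cii (rschwartzZ (-1) cri).
have cp := inv_sqrt2piK.
apply: complexF_ext.
  rewrite reF_inv_fourier // reF_fourier // imF_fourier //; apply/funext => t.
  rewrite (cos_transformZ _ _ s1) (sin_transformZ _ _ s2) (cos_transformD t crr cir).
  rewrite (sin_transformD t cii (rschwartzZ (-1) cri)) (sin_transformZ _ _ cri).
  have e1 := fourier_inversion_even t sr; have e2 := fourier_inversion_odd t si.
  rewrite e2; transitivity (c0 * c0 * (ct (ct (reF f)) t + st (st (reF f)) t)).
    by generalize_transforms; ring.
  by rewrite e1 mulrA cp mul1r.
rewrite imF_inv_fourier // reF_fourier // imF_fourier //; apply/funext => t.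
rewrite (cos_transformZ _ _ s2) (sin_transformZ _ _ s1) (sin_transformD t crr cir).
rewrite (cos_transformD t cii (rschwartzZ (-1) cri)) (cos_transformZ _ _ cri).
have e1 := fourier_inversion_even t si; have e2 := fourier_inversion_odd t sr.
rewrite e2; transitivity (c0 * c0 * (ct (ct (imF f)) t + st (st (imF f)) t)).
    by generalize_transforms; ring.
by rewrite e1 mulrA cp mul1r.
Qed.

Lemma inv_fourierK f : schwartz f -> fourier (inv_fourier f) = f.
Proof.
move=> sf; have sr := schwartz_re sf; have si := schwartz_im sf.
have sF := schwartz_inv_fourier sf.
have [crr cri cii cir] : [/\ rschwartz (ct (reF f)), rschwartz (st (reF f)),
  rschwartz (ct (imF f)) & rschwartz (st (imF f))] by split; [exact: sc|exact: ss|exact: sc|exact: ss].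
have s1 := rschwartzD crr (rschwartzZ (-1) cir); have s2 := rschwartzD cii cri.
have cp := inv_sqrt2piK.
apply: complexF_ext.
  rewrite reF_fourier // reF_inv_fourier // imF_inv_fourier //; apply/funext => t.
  rewrite (cos_transformZ _ _ s1) (sin_transformZ _ _ s2) (cos_transformD t crr (rschwartzZ (-1) cir)).
  rewrite (sin_transformD t cii cri) (cos_transformZ _ _ cir).
  have e1 := fourier_inversion_even t sr; have e2 := fourier_inversion_odd t si.
  rewrite e2; transitivity (c0 * c0 * (ct (ct (reF f)) t + st (st (reF f)) t)).
    by generalize_transforms; ring.
  by rewrite e1 mulrA cp mul1r.
rewrite imF_fourier // reF_inv_fourier // imF_inv_fourier //; apply/funext => t.
rewrite (cos_transformZ _ _ s2) (sin_transformZ _ _ s1).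
rewrite (sin_transformD t crr (rschwartzZ (-1) cir)) (cos_transformD t cii cri) (sin_transformZ _ _ cir).
have e1 := fourier_inversion_even t si; have e2 := fourier_inversion_odd t sr.
rewrite e2; transitivity (c0 * c0 * (ct (ct (imF f)) t + st (st (imF f)) t)).
    by generalize_transforms; ring.
by rewrite e1 mulrA cp mul1r.
Qed.

Lemma fourier_inj f g : schwartz f -> schwartz g -> fourier f = fourier g -> f = g.
Proof. by move=> sf sg e; rewrite -(fourierK sf) e fourierK. Qed.

Lemma creflect_fourier f : creflect (fourier f) = inv_fourier f.
Proof. by apply/funext => x; rewrite inv_fourierE. Qed.

Lemma creflect_inv_fourier f : creflect (inv_fourier f) = fourier f.
Proof. by apply/funext => x; rewrite /creflect inv_fourierE opprK. Qed.

Lemma fourier_fourier f : schwartz f -> fourier (fourier f) = creflect f.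
Proof. by move=> sf; rewrite -creflect_inv_fourier fourierK. Qed.

Lemma fourier_reflect f : schwartz f -> fourier (creflect f) = inv_fourier f.
Proof.
move=> sf; rewrite -fourier_fourier // fourier_fourier ?creflect_fourier //.
exact: schwartz_fourier.
Qed.

Lemma inv_fourier_reflect f : schwartz f -> inv_fourier (creflect f) = fourier f.
Proof. by move=> sf; rewrite -fourier_fourier // fourierK //; exact: schwartz_fourier. Qed.

Lemma fourier_cderive f t : schwartz f -> fourier (cderive f) t = (0 +i* t) * fourier f t.
Proof.
move=> sf; have sr := schwartz_re sf; have si := schwartz_im sf.
rewrite !fourier_parts //; last exact: schwartz_cderive.
have -> : reF (cderive f) = derive1 (reF f) by [].
have -> : imF (cderive f) = derive1 (imF f) by [].
rewrite (cos_transform_derive t sr) (cos_transform_derive t si).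
rewrite (sin_transform_derive t sr) (sin_transform_derive t si).
by apply: complex_ext; rewrite !partsE /=; ring.
Qed.

Lemma pairing_parts f g : schwartz f -> schwartz g ->
  pairing f g = (inner (reF f) (reF g) - inner (imF f) (imF g)) +i*
                (inner (reF f) (imF g) + inner (imF f) (reF g)).
Proof.
move=> sf sg; have fr := schwartz_re sf; have fi := schwartz_im sf.
have gr := schwartz_re sg; have gi := schwartz_im sg.
rewrite /pairing /cintegral; apply: complex_ext => /=.
  rewrite /inner -RintegralB //; try by apply: rschwartz_integrable; exact: rschwartzM.
  by apply: eq_Rintegral => x _; rewrite Re_mul.
rewrite /inner -RintegralD //; try by apply: rschwartz_integrable; exact: rschwartzM.
by apply: eq_Rintegral => x _; rewrite Im_mul.
Qed.

Lemma pairingC f g : pairing f g = pairing g f.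
Proof. by congr cintegral; apply/funext => x; rewrite mulrC. Qed.

Lemma inner_ct u v : rschwartz u -> rschwartz v -> inner u (ct v) = inner (ct u) v.
Proof. exact: cos_transform_sym. Qed.
Lemma inner_st u v : rschwartz u -> rschwartz v -> inner u (st v) = inner (st u) v.
Proof. exact: sin_transform_sym. Qed.

Lemma inner_lin (a b : R) (u v w : R -> R) : rschwartz u -> rschwartz v -> rschwartz w ->
  inner u (fun x => a * (v x + b * w x)) = a * (inner u v + b * inner u w).
Proof.
move=> su sv sw; rewrite (innerZr _ su (rschwartzD sv (rschwartzZ b sw))).
by rewrite (innerDr su sv (rschwartzZ b sw)) (innerZr _ su sw).
Qed.

(** The explicit factor 1 gives the shape that [inner_lin] expects. *)
Lemma reF_fourier' f : schwartz f ->
  reF (fourier f) = fun t => c0 * (ct (reF f) t + 1 * st (imF f) t).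
Proof. by move=> sf; rewrite reF_fourier //; apply/funext => t; rewrite mul1r. Qed.

(** The pairing is bilinear, without conjugation, and expands into real inner products, where the
    symmetry of the cosine and sine transforms applies. *)
Lemma pairing_fourier f g : schwartz f -> schwartz g ->
  pairing f (fourier g) = pairing (fourier f) g.
Proof.
move=> sf sg; have fr := schwartz_re sf; have fi := schwartz_im sf.
have gr := schwartz_re sg; have gi := schwartz_im sg.
rewrite (pairing_parts sf (schwartz_fourier sg)) (pairing_parts (schwartz_fourier sf) sg).
rewrite !(innerC _ (reF g)) !(innerC _ (imF g)).
rewrite (reF_fourier' sf) (reF_fourier' sg) (imF_fourier sf) (imF_fourier sg).
have E a b (u v w : R -> R) (su : rschwartz u) (sv : rschwartz v) (sw : rschwartz w) :=
  inner_lin a b su (sc sv) (ss sw).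
rewrite (E c0 1 _ _ _ fr gr gi) (E c0 (-1) _ _ _ fi gi gr) (E c0 (-1) _ _ _ fr gi gr).
rewrite (E c0 1 _ _ _ fi gr gi) (E c0 1 _ _ _ gr fr fi) (E c0 (-1) _ _ _ gi fi fr).
rewrite (E c0 (-1) _ _ _ gr fi fr) (E c0 1 _ _ _ gi fr fi).
rewrite (inner_ct gr fr) (inner_ct gr fi) (inner_ct gi fr) (inner_ct gi fi).
rewrite (inner_st gr fr) (inner_st gr fi) (inner_st gi fr) (inner_st gi fi).
rewrite !(innerC _ (reF f)) !(innerC _ (imF f)).
repeat match goal with |- context [inner ?a ?b] => move: (inner a b) => ? end.
by apply: complex_ext => /=; ring.
Qed.

End ComplexFourier.

(** * Convolution *)

Section Convolution.
Variable R : realType.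
Implicit Types (u v : R -> R) (f g k : R -> R[i]) (z w c : R[i]).
Local Notation mu := (@lebesgue_measure R).
Local Notation c0 := ((Num.sqrt (2 * pi))^-1 : R).
Local Notation s2p := (Num.sqrt (2 * pi) : R).

Lemma cintegral_linear c f g : schwartz f -> schwartz g ->
  cintegral (fun x => c * f x + g x) = c * cintegral f + cintegral g.
Proof.
move=> /schwartzP[fr fi] /schwartzP[gr gi].
have E (a b : R) (u v w : R -> R) : rschwartz u -> rschwartz v -> rschwartz w ->
    \int[mu]_x (a * u x + b * v x + w x) =
    a * (\int[mu]_x u x) + b * (\int[mu]_x v x) + \int[mu]_x w x.
  move=> su sv sw; have sau := rschwartzZ a su; have sbv := rschwartzZ b sv.
  rewrite RintegralD //; try exact: rschwartz_integrable.
    by rewrite RintegralD ?RintegralZl //; exact: rschwartz_integrable.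
  by apply: rschwartz_integrable; exact: rschwartzD.
apply: complex_ext; rewrite !partsE /=.
  rewrite -mulNr -(E _ _ _ _ _ fr fi gr); apply: eq_Rintegral => x _.
  by rewrite !partsE mulNr.
rewrite -(E _ _ _ _ _ fi fr gi); apply: eq_Rintegral => x _.
by rewrite !partsE.
Qed.

Lemma schwartz_expiM (t : R) f : schwartz f ->
  schwartz (fun x => (cos (t * x) +i* sin (t * x)) * f x).
Proof.
move=> /schwartzP[fr fi]; apply/schwartzP; split.
  have := rschwartzB (rschwartz_cosM t fr) (rschwartz_sinM t fi); congr rschwartz.
  by apply/funext => x; rewrite /reF Re_mul.
have := rschwartzD (rschwartz_cosM t fi) (rschwartz_sinM t fr); congr rschwartz.
by apply/funext => x; rewrite /imF Im_mul.
Qed.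

Lemma schwartz_shift (t : R) f : schwartz f -> schwartz (fun x => f (t - x)).
Proof.
by move=> /schwartzP[fr fi]; apply/schwartzP; split;
  [exact: (rschwartz_reflect t fr)|exact: (rschwartz_reflect t fi)].
Qed.

Lemma inv_fourier_linear c f g : schwartz f -> schwartz g ->
  inv_fourier (fun x => c * f x + g x) = fun t => c * inv_fourier f t + inv_fourier g t.
Proof.
move=> sf sg; apply/funext => t; rewrite /inv_fourier mulrCA -mulrDr; congr (_ * _).
rewrite -(cintegral_linear c (schwartz_expiM t sf) (schwartz_expiM t sg)).
by congr cintegral; apply/funext => x; rewrite mulrDr mulrCA.
Qed.

Lemma fourier_linear c f g : schwartz f -> schwartz g ->
  fourier (fun x => c * f x + g x) = fun t => c * fourier f t + fourier g t.
Proof. by move=> sf sg; rewrite -!creflect_inv_fourier inv_fourier_linear. Qed.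

Lemma linear_scale (U : (R -> R[i]) -> R -> R[i]) :
  (forall c f g, schwartz f -> schwartz g ->
     U (fun x => c * f x + g x) = fun t => c * U f t + U g t) ->
  forall c f, schwartz f -> U (fun x => c * f x) = fun t => c * U f t.
Proof.
move=> lU c f sf; have s0 := schwartz0 R.
have U0 : U (fun=> 0) = fun=> 0.
  have E : (fun x : R => 0 : R[i]) = fun x => (-1) * (fun=> 0) x + (fun=> 0) x.
    by apply/funext => x; rewrite mulr0 addr0.
  by rewrite {1}E lU //; apply/funext => t; rewrite mulN1r addNr.
have E : (fun x => c * f x) = fun x => c * f x + (fun=> 0) x.
  by apply/funext => x; rewrite addr0.
by rewrite E lU // U0; apply/funext => t; rewrite addr0.
Qed.

Lemma inv_fourierZ c f : schwartz f ->
  inv_fourier (fun x => c * f x) = fun t => c * inv_fourier f t.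
Proof. by apply: linear_scale; exact: inv_fourier_linear. Qed.

Lemma sqrt2piVK : c0%:C * s2p%:C = 1 :> R[i].
Proof. by rewrite -rmorphM /= mulVf ?rmorph1 // gt_eqF // sqrt2pi_gt0. Qed.

Lemma fourier_expiM (t x : R) f : schwartz f ->
  fourier (fun s => (cos (t * s) +i* sin (t * s)) * f s) x = inv_fourier f (t - x).
Proof.
move=> sf; rewrite /fourier /inv_fourier; congr (_ * cintegral _).
apply/funext => s; rewrite mulrA; congr (_ * _).
rewrite mulrBl cosB sinB.
by apply: complex_ext; rewrite !partsE /=; ring.
Qed.

(** For fixed t, inversion shows that x -> f(t - x) is the Fourier transform of s -> exp(i t s) F
    f(s); [pairing_fourier] then moves the transform onto g. The right-hand side is the termwise
    form of the convolution of the algebra. *)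
Lemma convolutionE f g : schwartz f -> schwartz g ->
  convolution f g = inv_fourier (fun s => s2p%:C * fourier f s * fourier g s).
Proof.
move=> sf sg; have sFf := schwartz_fourier sf; have sFg := schwartz_fourier sg.
apply/funext => t.
have -> : inv_fourier (fun s => s2p%:C * fourier f s * fourier g s) t =
    s2p%:C * inv_fourier (fun s => fourier f s * fourier g s) t.
  have -> : (fun s => s2p%:C * fourier f s * fourier g s) =
      fun s => s2p%:C * (fourier f s * fourier g s).
    by apply/funext => s; rewrite mulrA.
  by rewrite (inv_fourierZ _ (schwartzM sFf sFg)).
rewrite {1}/inv_fourier mulrA (mulrC s2p%:C) sqrt2piVK mul1r.
have sU := schwartz_expiM t sFf.
have -> : cintegral (fun x => (cos (t * x) +i* sin (t * x)) * (fourier f x * fourier g x)) =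
    pairing (fun s => (cos (t * s) +i* sin (t * s)) * fourier f s) (fourier g).
  by congr cintegral; apply/funext => s; rewrite mulrA.
rewrite (pairing_fourier sU sg) /pairing; congr cintegral; apply/funext => x.
by rewrite fourier_expiM // fourierK.
Qed.

Lemma schwartz_fourier_prod f g : schwartz f -> schwartz g ->
  schwartz (fun s => s2p%:C * f s * g s).
Proof. by move=> sf sg; apply: schwartzM => //; exact: schwartzZ. Qed.

Lemma schwartz_convolution f g : schwartz f -> schwartz g -> schwartz (convolution f g).
Proof.
move=> sf sg; rewrite (convolutionE sf sg); apply: schwartz_inv_fourier.
by apply: schwartz_fourier_prod; exact: schwartz_fourier.
Qed.

Lemma fourier_convolution f g : schwartz f -> schwartz g ->
  fourier (convolution f g) = fun s => s2p%:C * fourier f s * fourier g s.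
Proof.
move=> sf sg; rewrite (convolutionE sf sg) inv_fourierK //.
by apply: schwartz_fourier_prod; exact: schwartz_fourier.
Qed.

Lemma convolutionC f g : schwartz f -> schwartz g -> convolution f g = convolution g f.
Proof.
move=> sf sg; rewrite (convolutionE sf sg) (convolutionE sg sf); congr inv_fourier; apply/funext => s.
by rewrite mulrAC.
Qed.

(** On the Fourier side this is associativity of multiplication, which spares a triple integral. *)
Lemma convolutionA f g k : schwartz f -> schwartz g -> schwartz k ->
  convolution (convolution f g) k = convolution f (convolution g k).
Proof.
move=> sf sg sk; have sfg := schwartz_convolution sf sg; have sgk := schwartz_convolution sg sk.
rewrite (convolutionE sfg sk) (convolutionE sf sgk) (fourier_convolution sf sg)
  (fourier_convolution sg sk).
by congr inv_fourier; apply/funext => s; ring.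
Qed.

Lemma cderive_convolution f g : schwartz f -> schwartz g ->
  cderive (convolution f g) = convolution (cderive f) g.
Proof.
move=> sf sg; have sfg := schwartz_convolution sf sg; have sf' := schwartz_cderive sf.
apply: fourier_inj; [exact: schwartz_cderive|exact: schwartz_convolution|].
rewrite (fourier_convolution sf' sg); apply/funext => s.
by rewrite (fourier_cderive _ sfg) (fourier_cderive _ sf) (fourier_convolution sf sg); ring.
Qed.

(** The transform applied twice is a reflection, and the inverse transform of a reflected function
    is its transform. *)
Lemma fourier_mul f g : schwartz f -> schwartz g ->
  fourier (fun x => f x * g x) = fun t => c0%:C * convolution (fourier f) (fourier g) t.
Proof.
move=> sf sg; have sFf := schwartz_fourier sf; have sFg := schwartz_fourier sg.
have sfg := schwartzM sf sg.
rewrite (convolutionE sFf sFg) (fourier_fourier sf) (fourier_fourier sg).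
have -> : (fun s => s2p%:C * creflect f s * creflect g s) =
    fun s => s2p%:C * creflect (fun x => f x * g x) s.
  by apply/funext => s; rewrite -mulrA.
rewrite inv_fourierZ; last exact: schwartz_creflect.
by rewrite inv_fourier_reflect //; apply/funext => t; rewrite mulrA sqrt2piVK mul1r.
Qed.

Lemma cbicontinuous_convolution : cbicontinuous (@convolution R).
Proof.
have cU := ccontinuous_comp (@ccontinuous_inv_fourier R) (ccontinuous_scale s2p%:C).
have [sQ cQ] := cbicontinuous_comp cU (@cbicontinuous_mul R) (@ccontinuous_fourier R)
  (@ccontinuous_fourier R).
have E f g : schwartz f -> schwartz g -> convolution f g =
    inv_fourier (fun x => s2p%:C * (fourier f x * fourier g x)).
  move=> sf sg; rewrite (convolutionE sf sg); congr inv_fourier.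
  by apply/funext => s; rewrite mulrA.
split=> [f g sf sg|m]; first by rewrite E //; exact: sQ.
have [C [p [C0 h]]] := cQ m; exists C, p; split => // f g sf sg.
by rewrite E //; exact: h.
Qed.

Lemma pairing_linear c f g k : schwartz f -> schwartz g -> schwartz k ->
  pairing (fun x => c * f x + g x) k = c * pairing f k + pairing g k.
Proof.
move=> sf sg sk; rewrite /pairing -(cintegral_linear c (schwartzM sf sk) (schwartzM sg sk)).
by congr cintegral; apply/funext => x; rewrite mulrDl mulrA.
Qed.

Lemma convolution_linear c f g k : schwartz f -> schwartz g -> schwartz k ->
  convolution f (fun x => c * g x + k x) = fun t => c * convolution f g t + convolution f k t.
Proof.
move=> sf sg sk; apply/funext => t; have sft := schwartz_shift t sf.
rewrite /convolution -(cintegral_linear c (schwartzM sft sg) (schwartzM sft sk)).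
by congr cintegral; apply/funext => x; rewrite mulrDr mulrCA.
Qed.

Lemma pairing_inv_fourier f g : schwartz f -> schwartz g ->
  pairing (inv_fourier f) g = pairing f (inv_fourier g).
Proof.
move=> sf sg; rewrite -{1}(inv_fourierK sg) pairing_fourier ?inv_fourierK //.
  exact: schwartz_inv_fourier.
exact: schwartz_inv_fourier.
Qed.

(** Both sides are the pairing of F f with sqrt(2 pi) (F g) (F^-1 k); reflecting g exchanges F g and
    F^-1 g. This is the duality behind [distribution_convolution]. *)
Lemma pairing_convolution f g k : schwartz f -> schwartz g -> schwartz k ->
  pairing (convolution f g) k = pairing f (convolution (creflect g) k).
Proof.
move=> sf sg sk; have sFf := schwartz_fourier sf; have sFg := schwartz_fourier sg.
have sk' := schwartz_inv_fourier sk; have sg' := schwartz_creflect sg.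
have sH := schwartz_fourier_prod sFg sk'.
rewrite (convolutionE sf sg) (pairing_inv_fourier (schwartz_fourier_prod sFf sFg) sk).
transitivity (pairing (fourier f) (fun s => s2p%:C * fourier g s * inv_fourier k s)).
  by congr cintegral; apply/funext => s; ring.
rewrite -(pairing_fourier sf sH); congr pairing.
rewrite (convolutionE sg' sk) -(inv_fourier_reflect sH); congr inv_fourier.
rewrite (fourier_reflect sg); apply/funext => s.
by rewrite -(creflect_fourier g) -(creflect_inv_fourier k).
Qed.

End Convolution.

(** * Operations on classes *)

Section TemperedClasses.
Variable R : realType.
Implicit Types (phi psi : R -> R[i]) (f g k : nat -> R -> R[i]) (a : nat -> R) (c : R[i]).
Local Notation s2p := (Num.sqrt (2 * pi) : R).
Local Notation c0 := ((Num.sqrt (2 * pi))^-1 : R).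

(** Since all weights occur, summability and boundedness agree: one more power of n + 1 pays for the
    convergent series of (n + 1)^(-2). *)
Lemma seq_sP a : seq_s a <-> forall m, exists C, forall n, n.+1%:R ^+ m * `|a n| <= C.
Proof.
have sq m n : n.+1%:R ^+ (2 * m) * `|a n| ^+ 2 = (n.+1%:R ^+ m * `|a n|) ^+ 2.
  by rewrite exprMn mulnC exprM.
have nd m : nondecreasing_seq (series (fun n => n.+1%:R ^+ (2 * m) * `|a n| ^+ 2)).
  apply: nondecreasing_series => n _ _; rewrite sq; exact: sqr_ge0.
split=> [h m|h m].
  have := h m; set S := series _ => cS; exists (1 + limn S) => n.
  have t0 : 0 <= n.+1%:R ^+ m * `|a n| by rewrite mulr_ge0 // exprn_ge0.
  have ts : (n.+1%:R ^+ m * `|a n|) ^+ 2 <= limn S.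
    apply: le_trans (nondecreasing_cvgn_le (nd m) cS n.+1).
    rewrite /S seriesEord /= big_ord_recr /= sq lerDr.
    by apply: sumr_ge0 => i _; rewrite sq; exact: sqr_ge0.
  (* The inequality t <= 1 + t^2 avoids a square root in the bound. *)
  apply: le_trans (_ : 1 + (n.+1%:R ^+ m * `|a n|) ^+ 2 <= _); last by rewrite lerD2l.
  by move: (n.+1%:R ^+ m * `|a n|) t0 {ts} => t t0; nra.
have [C hC] := h m.+1; apply: nondecreasing_is_cvgn; first exact: nd.
exists (C ^+ 2 * 2) => _ [n _ <-]; rewrite seriesEord /=.
apply: le_trans (_ : \sum_(j < n) C ^+ 2 * (j.+1%:R ^- 2) <= _); last first.
  by rewrite -mulr_sumr; apply: ler_wpM2l (sum_inv_sqr_le R n); exact: sqr_ge0.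
apply: ler_sum => j _; rewrite sq ler_pdivlMr ?exprn_gt0 // -exprMn.
have e0 : 0 <= j.+1%:R ^+ m * `|a j| * j.+1%:R by rewrite !mulr_ge0 // exprn_ge0.
have hj : j.+1%:R ^+ m * `|a j| * j.+1%:R <= C by rewrite mulrAC -exprSr.
by apply: lerXn2r; rewrite ?nnegrE //; exact: le_trans hj.
Qed.

Lemma H_sP f : H_s f <-> (forall n, schwartz (f n)) /\
  forall m q, exists C, forall n, n.+1%:R ^+ q * snorm m (f n) <= C.
Proof.
split=> [[sf h]|[sf h]]; split => // m; last first.
  apply/seq_sP => q; have [C hC] := h m q; exists C => n.
  by rewrite ger0_norm ?snorm_ge0.
move=> q; have [C hC] := (seq_sP _).1 (h m) q; exists C => n.
by have := hC n; rewrite ger0_norm ?snorm_ge0.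
Qed.

Lemma H_s'P f : H_s' f <-> (forall n, schwartz (f n)) /\
  forall m, exists C q, 0 <= C /\ forall n, snorm m (f n) <= C * n.+1%:R ^+ q.
Proof.
split=> [[sf h]|[sf h]]; split => // m; have [C [q hC]] := h m; exists C, q.
  have hC' n : snorm m (f n) <= C * n.+1%:R ^+ q.
    by have := hC n; rewrite ger0_norm ?snorm_ge0.
  split => //; have := hC' 0%N; rewrite expr1n mulr1; apply: le_trans.
  exact: snorm_ge0.
by move=> n; rewrite ger0_norm ?snorm_ge0 //; exact: hC.2.
Qed.

Lemma H_s_map U f : ccontinuous U -> H_s f -> H_s (fun n => U (f n)).
Proof.
move=> [sU cU] /H_sP[sf h]; apply/H_sP; split=> [n|m q]; first exact: sU.
have [C [p [C0 hC]]] := cU m; have [D hD] := h p q; exists (C * D) => n.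
apply: le_trans (_ : n.+1%:R ^+ q * (C * snorm p (f n)) <= _).
  by apply: ler_wpM2l (hC _ (sf n)); exact: exprn_ge0.
by rewrite mulrCA; apply: ler_wpM2l.
Qed.

Lemma H_s'_map U f : ccontinuous U -> H_s' f -> H_s' (fun n => U (f n)).
Proof.
move=> [sU cU] /H_s'P[sf h]; apply/H_s'P; split=> [n|m]; first exact: sU.
have [C [p [C0 hC]]] := cU m; have [D [q [D0 hD]]] := h p; exists (C * D), q.
split=> [|n]; first exact: mulr_ge0.
by apply: le_trans (hC _ (sf n)) _; rewrite -mulrA; apply: ler_wpM2l.
Qed.

Lemma H_s'_bimap Q f g : cbicontinuous Q -> H_s' f -> H_s' g ->
  H_s' (fun n => Q (f n) (g n)).
Proof.
move=> [sQ cQ] /H_s'P[sf hf] /H_s'P[sg hg]; apply/H_s'P; split=> [n|m]; first exact: sQ.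
have [C [p [C0 hC]]] := cQ m; have [D [q [D0 hD]]] := hf p; have [E [r [E0 hE]]] := hg p.
exists (C * (D * E)), (q + r)%N; split=> [|n]; first by rewrite !mulr_ge0.
apply: le_trans (hC _ _ (sf n) (sg n)) _; rewrite -mulrA; apply: ler_wpM2l => //.
by rewrite exprD mulrACA; apply: ler_pM; rewrite ?snorm_ge0.
Qed.

(** Negligible sequences form an ideal: the growth (n + 1)^q of [g] is absorbed by the decay of [f]
    at order r + q. *)
Lemma H_s_bimapl Q f g : cbicontinuous Q -> H_s f -> H_s' g ->
  H_s (fun n => Q (f n) (g n)).
Proof.
move=> [sQ cQ] /H_sP[sf hf] /H_s'P[sg hg]; apply/H_sP; split=> [n|m r]; first exact: sQ.
have [C [p [C0 hC]]] := cQ m; have [E [q [E0 hE]]] := hg p; have [D hD] := hf p (r + q)%N.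
exists (C * (D * E)) => n.
have e q' : 0 <= n.+1%:R ^+ q' :> R by exact: exprn_ge0.
apply: le_trans (ler_wpM2l (e r) (hC _ _ (sf n) (sg n))) _.
rewrite mulrCA; apply: ler_wpM2l => //.
apply: le_trans (_ : n.+1%:R ^+ r * (snorm p (f n) * (E * n.+1%:R ^+ q)) <= _).
  by apply: (ler_wpM2l (e r)); apply: ler_wpM2l; [exact: snorm_ge0|exact: hE].
have -> : n.+1%:R ^+ r * (snorm p (f n) * (E * n.+1%:R ^+ q)) =
  n.+1%:R ^+ (r + q) * snorm p (f n) * E by rewrite exprD; ring.
by apply: ler_wpM2r.
Qed.

Lemma H_s_bimapr Q f g : cbicontinuous Q -> H_s' f -> H_s g ->
  H_s (fun n => Q (f n) (g n)).
Proof.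
move=> [sQ cQ] hf hg; have cQ' : cbicontinuous (fun phi psi => Q psi phi).
  split=> [phi psi s1 s2|m]; first exact: sQ.
  have [C [p [C0 hC]]] := cQ m; exists C, p; split => // phi psi s1 s2.
  by rewrite [snorm p phi * _]mulrC; exact: hC.
exact: (H_s_bimapl cQ' hg hf).
Qed.

Lemma H_sD f g : H_s f -> H_s g -> H_s (fun n x => f n x + g n x).
Proof.
move=> /H_sP[sf hf] /H_sP[sg hg]; apply/H_sP; split=> [n|m q]; first exact: schwartzD.
have [C hC] := hf m q; have [D hD] := hg m q; exists (2 * (C + D)) => n.
have e : 0 <= n.+1%:R ^+ q :> R by exact: exprn_ge0.
apply: le_trans (ler_wpM2l e (snormD m (sf n) (sg n))) _.
by rewrite mulrCA mulrDr; apply: ler_wpM2l => //; apply: lerD.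
Qed.

Lemma H_sZ c f : H_s f -> H_s (fun n x => c * f n x).
Proof. exact: (H_s_map (ccontinuous_scale c)). Qed.

Lemma H_s_H_s' f : H_s f -> H_s' f.
Proof.
move=> /H_sP[sf hf]; apply/H_s'P; split => // m; have [C hC] := hf m 0%N.
exists C, 0%N; split=> [|n]; last by have := hC n; rewrite expr0 mul1r mulr1.
by apply: le_trans (hC 0%N); rewrite expr0 mul1r snorm_ge0.
Qed.

Lemma H_s'D f g : H_s' f -> H_s' g -> H_s' (fun n x => f n x + g n x).
Proof.
move=> /H_s'P[sf hf] /H_s'P[sg hg]; apply/H_s'P; split=> [n|m]; first exact: schwartzD.
have [C [p [C0 hC]]] := hf m; have [D [q [D0 hD]]] := hg m.
exists (2 * (C + D)), (p + q)%N; split=> [|n]; first by rewrite mulr_ge0 // addr_ge0.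
apply: le_trans (snormD m (sf n) (sg n)) _; rewrite -mulrA; apply: ler_wpM2l => //.
have n1 : 1 <= n.+1%:R :> R by rewrite ler1n.
rewrite mulrDl; apply: lerD.
  apply: le_trans (hC n) _; apply: ler_wpM2l => //.
  by rewrite ler_weXn2l // leq_addr.
apply: le_trans (hD n) _; apply: ler_wpM2l => //.
by rewrite ler_weXn2l // leq_addl.
Qed.

(** * Classes and independence of representatives *)

Lemma tclass_mem f : (forall n, schwartz (f n)) -> tclass f f.
Proof.
move=> sf; rewrite /tclass /=.
have -> : (fun n x => f n x - f n x) = fun n x => 0%:C * f n x.
  by apply/funext => n; apply/funext => x; rewrite subrr mul0r.
apply/H_sP; split=> [n|m q]; first exact: schwartzZ.
by exists 0 => n; rewrite snormZ_real // normr0 mul0r mulr0.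
Qed.

Lemma tclass_eq f g : H_s (fun n x => f n x - g n x) -> tclass f = tclass g.
Proof.
move=> h; apply/seteqP; split=> k /= hk.
  have := H_sD hk h; congr H_s; apply/funext => n; apply/funext => x; ring.
have := H_sD hk (H_sZ (-1) h); congr H_s; apply/funext => n; apply/funext => x; ring.
Qed.

Lemma tclass_H_s' f g : H_s' f -> tclass f g -> H_s' g.
Proof.
move=> hf /H_s_H_s' hg; have := H_s'D hf hg; congr H_s'.
by apply/funext => n; apply/funext => x; ring.
Qed.

(** Linearity turns U g - U f into U (g - f), negligible by continuity, so the union over the
    representatives is a single coset. *)
Lemma tlift1_tclass U f : ccontinuous U ->
  (forall c phi psi, schwartz phi -> schwartz psi ->
     U (fun x => c * phi x + psi x) = fun t => c * U phi t + U psi t) ->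
  H_s' f -> tlift1 (fun f n => U (f n)) (tclass f) = tclass (fun n => U (f n)).
Proof.
move=> cU lU hf; have sf := hf.1.
have E g : tclass f g -> tclass (fun n => U (g n)) = tclass (fun n => U (f n)).
  move=> fg; have sg := (tclass_H_s' hf fg).1; apply: tclass_eq.
  have := H_s_map cU fg; congr H_s; apply/funext => n.
  have -> : (fun x => g n x - f n x) = fun x => (-1) * f n x + g n x.
    by apply/funext => x; rewrite mulN1r addrC.
  by rewrite lU //; apply/funext => x; rewrite mulN1r addrC.
apply/seteqP; split=> [k [g fg]|k hk]; first by rewrite E.
by exists f; [exact: tclass_mem|exact: hk].
Qed.

Lemma tmul_tclass f g : H_s' f -> H_s' g ->
  tmul (tclass f) (tclass g) = tclass (fun n x => f n x * g n x).
Proof.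
move=> hf hg; have cM := @cbicontinuous_mul R.
apply/seteqP; split=> [k [f' ff' [g' gg']]|k hk]; last first.
  exists f; first exact: tclass_mem hf.1.
  by exists g; [exact: tclass_mem hg.1|exact: hk].
suff <- : tclass (fun n x => f' n x * g' n x) = tclass (fun n x => f n x * g n x) by [].
apply: tclass_eq.
(* f' g' - f g = (f' - f) g' + f (g' - g). *)
have := H_sD (H_s_bimapl cM ff' (tclass_H_s' hg gg')) (H_s_bimapr cM hf gg').
by congr H_s; apply/funext => n; apply/funext => x; ring.
Qed.

Lemma tfourier_tclass f : H_s' f -> tfourier (tclass f) = tclass (fun n => fourier (f n)).
Proof.
move=> hf; apply: (tlift1_tclass (@ccontinuous_fourier R)) => //.
exact: fourier_linear.
Qed.

Lemma tinv_fourier_tclass f : H_s' f ->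
  tinv_fourier (tclass f) = tclass (fun n => inv_fourier (f n)).
Proof.
move=> hf; apply: (tlift1_tclass (@ccontinuous_inv_fourier R)) => //.
exact: inv_fourier_linear.
Qed.

Lemma tscale_tclass c f : H_s' f -> tscale c (tclass f) = tclass (fun n x => c * f n x).
Proof.
move=> hf; apply: (tlift1_tclass (ccontinuous_scale c)) => //.
by move=> d phi psi _ _; apply/funext => x; ring.
Qed.

Lemma cderive_linear c phi psi : schwartz phi -> schwartz psi ->
  cderive (fun x => c * phi x + psi x) = fun t => c * cderive phi t + cderive psi t.
Proof.
move=> /schwartzP[pr pi] /schwartzP[qr qi].
have E (a b : R) (u v w : R -> R) : rschwartz u -> rschwartz v -> rschwartz w ->
    derive1 (fun x => a * u x + b * v x + w x) =
    fun x => a * derive1 u x + b * derive1 v x + derive1 w x.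
  move=> su sv sw; apply: has_derivE.
  exact: has_derivD (has_derivD (has_derivZ a (rschwartz_deriv su))
    (has_derivZ b (rschwartz_deriv sv))) (rschwartz_deriv sw).
apply: complexF_ext.
  have -> : reF (cderive (fun x => c * phi x + psi x)) =
    derive1 (reF (fun x => c * phi x + psi x)) by [].
  have -> : reF (fun x => c * phi x + psi x) =
    fun x => complex.Re c * reF phi x + (- complex.Im c) * imF phi x + reF psi x.
    by apply/funext => x; rewrite /reF !partsE mulNr.
  by rewrite (E _ _ _ _ _ pr pi qr); apply/funext => x; rewrite /reF !partsE mulNr.
have -> : imF (cderive (fun x => c * phi x + psi x)) =
  derive1 (imF (fun x => c * phi x + psi x)) by [].
have -> : imF (fun x => c * phi x + psi x) =
  fun x => complex.Re c * imF phi x + complex.Im c * reF phi x + imF psi x.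
  by apply/funext => x; rewrite /imF !partsE.
by rewrite (E _ _ _ _ _ pi pr qi); apply/funext => x; rewrite /imF !partsE.
Qed.

Lemma tderive_tclass f : H_s' f -> tderive (tclass f) = tclass (fun n => cderive (f n)).
Proof.
move=> hf; apply: (tlift1_tclass (@ccontinuous_cderive R)) => //.
exact: cderive_linear.
Qed.

Lemma H_s'_fourier f : H_s' f -> H_s' (fun n => fourier (f n)).
Proof. exact: (H_s'_map (@ccontinuous_fourier R)). Qed.

Lemma H_s'_cderive f : H_s' f -> H_s' (fun n => cderive (f n)).
Proof. exact: (H_s'_map (@ccontinuous_cderive R)). Qed.

Lemma H_s'_scale c f : H_s' f -> H_s' (fun n x => c * f n x).
Proof. exact: (H_s'_map (ccontinuous_scale c)). Qed.

Lemma H_s'_mul f g : H_s' f -> H_s' g -> H_s' (fun n x => f n x * g n x).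
Proof. exact: (H_s'_bimap (@cbicontinuous_mul R)). Qed.

Lemma H_s'_convolution f g : H_s' f -> H_s' g -> H_s' (fun n => convolution (f n) (g n)).
Proof. exact: (H_s'_bimap (@cbicontinuous_convolution R)). Qed.

Lemma H_s'_schwartz f n : H_s' f -> schwartz (f n).
Proof. by case. Qed.

Lemma teq_tclass f g : H_s' f -> f = g -> teq (tclass f) (tclass g).
Proof. by move=> hf <-; split => //; exists f. Qed.

#[local] Opaque tclass tfourier tinv_fourier tscale tmul tderive H_s'
  fourier inv_fourier convolution.

(** Each operation in the definition may be carried out on representatives, and the outcome is
    termwise the right-hand side of [convolutionE]. *)
Lemma tconv_tclass f g : H_s' f -> H_s' g ->
  tconv (tclass f) (tclass g) = tclass (fun n => convolution (f n) (g n)).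
Proof.
move=> hf hg; have hFf := H_s'_fourier hf; have hFg := H_s'_fourier hg.
have hs := H_s'_scale s2p%:C hFf; have hm := H_s'_mul hs hFg.
transitivity (tinv_fourier (tclass (fun n x => s2p%:C * fourier (f n) x * fourier (g n) x))).
  congr tinv_fourier.
  transitivity (tmul (tclass (fun n x => s2p%:C * fourier (f n) x)) (tclass (fun n => fourier (g n)))).
    congr tmul; last exact: tfourier_tclass hg.
    transitivity (tscale s2p%:C (tclass (fun n => fourier (f n)))).
      congr tscale; exact: tfourier_tclass hf.
    exact: (tscale_tclass s2p%:C hFf).
  exact: (tmul_tclass hs hFg).
transitivity (tclass (fun n => inv_fourier (fun x => s2p%:C * fourier (f n) x * fourier (g n) x))).
  exact: (tinv_fourier_tclass hm).
congr tclass.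
by apply/funext => n; rewrite (convolutionE (H_s'_schwartz n hf) (H_s'_schwartz n hg)).
Qed.

Lemma tderive_iter alpha f : H_s' f ->
  H_s' (fun n => iter alpha (@cderive R) (f n)) /\
  iter alpha (@tderive R) (tclass f) = tclass (fun n => iter alpha (@cderive R) (f n)).
Proof.
move=> hf; elim: alpha => [//|alpha [hd IH]]; split; first exact: H_s'_cderive.
transitivity (tderive (tclass (fun n => iter alpha (@cderive R) (f n)))).
  by rewrite iterS; congr tderive; exact: IH.
exact: (tderive_tclass hd).
Qed.

Lemma iter_cderive_convolution alpha phi psi : schwartz phi -> schwartz psi ->
  iter alpha (@cderive R) (convolution phi psi) = convolution (iter alpha (@cderive R) phi) psi.
Proof.
move=> sp sq; elim: alpha => [//|alpha IH]; rewrite !iterS IH cderive_convolution //.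
by elim: alpha {IH} => [//|alpha IH]; rewrite iterS; exact: schwartz_cderive.
Qed.

End TemperedClasses.

(** * Tempered distributions and association *)

Section Distributions.
Variable R : realType.
Implicit Types (phi psi : R -> R[i]) (T : (R -> R[i]) -> R[i]) (b : nat -> R[i]).
Local Notation h := (@hermite R).

Lemma reF_hermite j : reF (h j) = rhermite j.
Proof. by []. Qed.

Lemma imF_hermite j : imF (h j) = fun=> 0.
Proof. by []. Qed.

Lemma schwartz_hermite j : schwartz (h j).
Proof.
apply/schwartzP; rewrite reF_hermite imF_hermite; split; first exact: rschwartz_hermite.
exact: rschwartz0.
Qed.

Lemma pairing_hermite phi j : schwartz phi ->
  pairing phi (h j) = inner (reF phi) (rhermite j) +i* inner (imF phi) (rhermite j).
Proof.
move=> sp; have pr := schwartz_re sp; have pi := schwartz_im sp.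
rewrite (pairing_parts sp (schwartz_hermite j)) reF_hermite imF_hermite.
by rewrite (inner0r pr) (inner0r pi) subr0 add0r.
Qed.

(** Serves both as the representative of the image of [phi] under iota and as the Hermite projection
    of test functions. *)
Definition cproj n phi : R -> R[i] := fun x => \sum_(j < n.+1) pairing phi (h j) * h j x.

Lemma reF_sum n b : reF (fun x => \sum_(j < n) b j * h j x) =
  fun x => \sum_(j < n) complex.Re (b j) * rhermite j x.
Proof.
apply/funext => x; elim: n => [|n IH]; first by rewrite /reF !big_ord0.
rewrite /reF !big_ord_recr /= Re_add; congr (_ + _); first exact: IH.
by rewrite Re_mul /= mulr0 subr0.
Qed.

Lemma imF_sum n b : imF (fun x => \sum_(j < n) b j * h j x) =
  fun x => \sum_(j < n) complex.Im (b j) * rhermite j x.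
Proof.
apply/funext => x; elim: n => [|n IH]; first by rewrite /imF !big_ord0.
rewrite /imF !big_ord_recr /= Im_add; congr (_ + _); first exact: IH.
by rewrite Im_mul /= mulr0 add0r.
Qed.

Lemma reF_cproj n phi : schwartz phi -> reF (cproj n phi) = hermite_proj n.+1 (reF phi).
Proof.
move=> sp; rewrite /cproj (reF_sum n.+1 (fun j => pairing phi (h j))).
by apply/funext => x; apply: eq_bigr => j _; rewrite pairing_hermite.
Qed.

Lemma imF_cproj n phi : schwartz phi -> imF (cproj n phi) = hermite_proj n.+1 (imF phi).
Proof.
move=> sp; rewrite /cproj (imF_sum n.+1 (fun j => pairing phi (h j))).
by apply/funext => x; apply: eq_bigr => j _; rewrite pairing_hermite.
Qed.

Lemma schwartz_cproj n phi : schwartz (cproj n phi).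
Proof.
apply: (schwartz_sum n.+1 (F := fun j x => pairing phi (h j) * h j x)) => i.
exact/schwartzZ/schwartz_hermite.
Qed.

Lemma cproj_bounded m : exists C p, 0 <= C /\
  forall n phi, schwartz phi -> snorm m (cproj n phi) <= C * snorm p phi.
Proof.
have [C [p [C0 hC]]] := proj_dominated R m; exists (2 * C), p; split; first exact: mulr_ge0.
move=> n phi sp; apply: le_trans (snorm_le_parts m (schwartz_cproj n phi)) _.
rewrite reF_cproj // imF_cproj //.
have h1 := le_trans (hC n.+1 _ (schwartz_re sp)) (ler_wpM2l C0 (rsnorm_re_le p sp)).
have h2 := le_trans (hC n.+1 _ (schwartz_im sp)) (ler_wpM2l C0 (rsnorm_im_le p sp)).
by apply: le_trans (lerD h1 h2) _; rewrite -mulrA mulr2n mulrDl mul1r.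
Qed.

Lemma cproj_rate m : exists C p, 0 <= C /\ forall n phi, schwartz phi ->
  snorm m (fun x => phi x - cproj n phi x) <= C * snorm p phi / Num.sqrt n.+1%:R.
Proof.
have [C [p [C0 hC]]] := proj_rate R m; exists (Num.sqrt C), p; split; first exact: sqrtr_ge0.
move=> n phi sp; have sc := schwartz_cproj n phi; have sd := schwartzB sp sc.
rewrite -(@ler_pXn2r _ 2) ?nnegrE ?snorm_ge0 //; last first.
  by rewrite !mulr_ge0 ?sqrtr_ge0 ?snorm_ge0 // invr_ge0 sqrtr_ge0.
rewrite (sqr_snorm m sd) !exprMn exprVn (sqr_snorm p sp) (sqr_sqrtr C0) (sqr_sqrtr (ler0n R n.+1)).
have -> : reF (fun x => phi x - cproj n phi x) =
    fun x => reF phi x - hermite_proj n.+1 (reF phi) x.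
  by rewrite -reF_cproj //; apply/funext => x; rewrite /reF !partsE.
have -> : imF (fun x => phi x - cproj n phi x) =
    fun x => imF phi x - hermite_proj n.+1 (imF phi) x.
  by rewrite -imF_cproj //; apply/funext => x; rewrite /imF !partsE.
rewrite mulrDr mulrDl; apply: lerD; apply: hC; [exact: schwartz_re|exact: schwartz_im].
Qed.

Lemma snorm_subC m phi psi : schwartz phi -> schwartz psi ->
  snorm m (fun x => phi x - psi x) = snorm m (fun x => psi x - phi x).
Proof.
move=> sp sq; have := snormZ_real m (-1) (schwartzB sp sq).
rewrite normrN1 mul1r => <-; congr snorm; apply/funext => x.
by rewrite rmorphN1 mulN1r opprB.
Qed.

Lemma snorm_hermite m : exists C, 0 <= C /\
  forall j, snorm m (h j) <= C * j.+1%:R ^+ m.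
Proof.
have [C [C0 hC]] := rsnorm_hermite R m; exists C; split => // j; apply: le_trans (hC j).
apply: le_trans (snorm_le_parts m (schwartz_hermite j)) _.
rewrite reF_hermite imF_hermite.
have -> : (fun=> 0 : R) = fun x : R => 0 * rhermite j x by apply/funext => x; rewrite mul0r.
by rewrite (rsnormZ m 0 (rschwartz_hermite R j)) normr0 mul0r addr0.
Qed.

Lemma H_s'_hermite_series b :
  (exists C p, 0 <= C /\ forall j, normc (b j) <= C * snorm p (h j)) ->
  H_s' (fun n x => \sum_(j < n.+1) b j * h j x).
Proof.
move=> [C [p [C0 hC]]]; apply/H_s'P; have sh n : schwartz (fun x => \sum_(j < n.+1) b j * h j x).
  apply: (schwartz_sum n.+1 (F := fun j x => b j * h j x)) => i.
  exact/schwartzZ/schwartz_hermite.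
split => // m; have [K [K0 hK]] := rsnorm_hermite R m; have [D [D0 hD]] := snorm_hermite p.
(* The exponent collects p from the coefficients, m from the m-th norm of h_j and 1 from the number
   of terms. *)
exists (2 * (C * D * K)), (p + m).+1; split; first by rewrite !mulr_ge0.
move=> n; apply: le_trans (snorm_le_parts m (sh n)) _.
rewrite reF_sum imF_sum.
have bound (a : nat -> R) : (forall j, `|a j| <= normc (b j)) ->
    rsnorm m (fun x => \sum_(j < n.+1) a j * rhermite j x) <= C * D * K * n.+1%:R ^+ (p + m).+1.
  move=> ha; apply: le_trans (rsnorm_sum m n.+1 (F := fun j x => a j * rhermite j x) _) _.
    by move=> i; exact/rschwartzZ/rschwartz_hermite.
  apply: le_trans (_ : \sum_(j < n.+1) C * D * K * n.+1%:R ^+ (p + m) <= _); last first.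
    by rewrite sumr_const card_ord -[leLHS]mulr_natr exprSr mulrA lexx.
  apply: ler_sum => j _; rewrite (rsnormZ m _ (rschwartz_hermite R j)).
  have jn : j.+1%:R <= n.+1%:R :> R by rewrite ler_nat.
  have e q : j.+1%:R ^+ q <= n.+1%:R ^+ q :> R by apply: lerXn2r; rewrite ?nnegrE ?ler0n.
  have -> : C * D * K * n.+1%:R ^+ (p + m) = (C * (D * n.+1%:R ^+ p)) * (K * n.+1%:R ^+ m).
    by rewrite exprD; ring.
  apply: ler_pM => //; first exact: rsnorm_ge0.
    apply: le_trans (ha j) (le_trans (hC j) _); apply: ler_wpM2l => //.
    by apply: le_trans (hD j) _; apply: ler_wpM2l.
  by apply: le_trans (hK j) _; apply: ler_wpM2l.
have h1 := bound (fun j => complex.Re (b j)) (fun j => norm_Re_le (b j)).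
have h2 := bound (fun j => complex.Im (b j)) (fun j => norm_Im_le (b j)).
by apply: le_trans (lerD h1 h2) _; rewrite -[leRHS]mulrA mulr2n mulrDl mul1r.
Qed.

(** * Tempered distributions as bounded functionals *)

Lemma tempered0 T : tempered_distribution T -> T (fun=> 0) = 0.
Proof.
move=> [lT _]; have s0 := schwartz0 R; have := lT (-1) _ _ s0 s0.
have -> : (fun x : R => -1 * (fun=> 0 : R[i]) x + (fun=> 0) x) = fun=> 0.
  by apply/funext => x; rewrite mulr0 addr0.
by rewrite mulN1r addNr.
Qed.

Lemma temperedZ T c phi : tempered_distribution T -> schwartz phi ->
  T (fun x => c * phi x) = c * T phi.
Proof.
move=> hT sp; have := hT.1 c _ _ sp (schwartz0 R); rewrite (tempered0 hT) addr0 => <-.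
by congr T; apply/funext => x; rewrite addr0.
Qed.

Lemma temperedB T phi psi : tempered_distribution T -> schwartz phi -> schwartz psi ->
  T (fun x => phi x - psi x) = T phi - T psi.
Proof.
move=> hT sp sq; have := hT.1 (-1) _ _ sq sp; rewrite mulN1r addrC => <-.
by congr T; apply/funext => x; rewrite mulN1r addrC.
Qed.

Lemma tempered_sum T n b (F : nat -> R -> R[i]) : tempered_distribution T ->
  (forall j, schwartz (F j)) ->
  T (fun x => \sum_(j < n) b j * F j x) = \sum_(j < n) b j * T (F j).
Proof.
move=> hT sF; elim: n => [|n IH].
  rewrite big_ord0.
  have -> : (fun x => \sum_(j < 0) b j * F j x) = fun=> 0 by apply/funext => x; rewrite big_ord0.
  exact: tempered0.
rewrite big_ord_recr /= -IH addrC -(hT.1 _ _ _ (sF n)).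
  by congr T; apply/funext => x; rewrite big_ord_recr /= addrC.
by apply: (schwartz_sum n (F := fun j x => b j * F j x)) => i; exact/schwartzZ/sF.
Qed.

Lemma tempered_bounded T : tempered_distribution T -> exists C p, 0 <= C /\
  forall phi, schwartz phi -> normc (T phi) <= C * snorm p phi.
Proof.
move=> hT; have [_ cT] := hT.
have [m [d d0 hd]] := cT _ (schwartz0 R) 1 ltr01.
exists d^-1, m; split; first by rewrite invr_ge0 ltW.
move=> phi sp; rewrite mulrC ler_pdivlMr //; apply/ler_addgt0Pr => e e0.
have s0 := snorm_ge0 m phi; have se : 0 < snorm m phi + e by rewrite ltr_wpDl.
(* The scaling that brings phi within distance d of 0; the positive e keeps the denominator nonzero
   when the norm vanishes. *)
pose l := d / (snorm m phi + e); have l0 : 0 < l by rewrite divr_gt0.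
have := hd (fun x => l%:C * phi x) (schwartzZ _ sp).
have -> : normc (T (fun x => l%:C * phi x) - T (fun=> 0)) = l * normc (T phi).
  rewrite (tempered0 hT) subr0 (temperedZ _ hT sp) ComplexField.Normc.normcM.
  by rewrite /= expr0n addr0 sqrtr_sqr gtr0_norm.
move=> hl; have {}hl : l * normc (T phi) < 1.
  apply: hl => k km.
  have -> : (fun x => l%:C * phi x - 0) = fun x => l%:C * phi x.
    by apply/funext => x; rewrite subr0.
  rewrite snormZ_real // gtr0_norm //.
  apply: (@le_lt_trans _ _ (l * snorm m phi)).
    by apply: ler_wpM2l; [exact: ltW|exact: snorm_le].
  by rewrite /l mulrAC ltr_pdivrMr // ltr_pM2l // ltrDl.
apply: ltW; move: hl; rewrite /l mulrAC ltr_pdivrMr // mul1r.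
by rewrite mulrC.
Qed.

Lemma pairing_sum n b (F : nat -> R -> R[i]) psi : (forall j, schwartz (F j)) ->
  schwartz psi -> pairing (fun x => \sum_(j < n) b j * F j x) psi =
  \sum_(j < n) b j * pairing (F j) psi.
Proof.
move=> sF sp; elim: n => [|n IH].
  rewrite big_ord0; have s0 := schwartz0 R.
  have -> : (fun x : R => \sum_(j < 0) b j * F j x) = fun x => (-1) * F 0%N x + F 0%N x.
    by apply/funext => x; rewrite big_ord0 mulN1r addNr.
  by rewrite (pairing_linear _ (sF 0%N) (sF 0%N) sp) mulN1r addNr.
rewrite big_ord_recr /= -IH addrC -(pairing_linear (b n) (sF n) _ sp).
  by congr pairing; apply/funext => x; rewrite big_ord_recr /= addrC.
by apply: (schwartz_sum n (F := fun j x => b j * F j x)) => i; exact/schwartzZ/sF.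
Qed.

Lemma convolution_sum n b (F : nat -> R -> R[i]) psi : (forall j, schwartz (F j)) ->
  schwartz psi -> convolution psi (fun x => \sum_(j < n) b j * F j x) =
  fun t => \sum_(j < n) b j * convolution psi (F j) t.
Proof.
move=> sF sp; elim: n => [|n IH].
  have -> : (fun x : R => \sum_(j < 0) b j * F j x) = fun x => (-1) * F 0%N x + F 0%N x.
    by apply/funext => x; rewrite big_ord0 mulN1r addNr.
  rewrite (convolution_linear _ sp (sF 0%N) (sF 0%N)); apply/funext => t.
  by rewrite big_ord0 mulN1r addNr.
have -> : (fun x => \sum_(j < n.+1) b j * F j x) =
    fun x => b n * F n x + \sum_(j < n) b j * F j x.
  by apply/funext => x; rewrite big_ord_recr /= addrC.
rewrite (convolution_linear _ sp (sF n)) ?IH.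
  by apply/funext => t; rewrite big_ord_recr /= addrC.
by apply: (schwartz_sum n (F := fun j x => b j * F j x)) => i; exact/schwartzZ/sF.
Qed.

Lemma convolutionB phi psi k : schwartz phi -> schwartz psi -> schwartz k ->
  convolution k (fun x => phi x - psi x) = fun t => convolution k phi t - convolution k psi t.
Proof.
move=> sp sq sk.
have -> : (fun x => phi x - psi x) = fun x => (-1) * psi x + phi x.
  by apply/funext => x; rewrite mulN1r addrC.
by rewrite (convolution_linear _ sk sq sp); apply/funext => t; rewrite mulN1r addrC.
Qed.

(** Hermite truncation is self-dual: it passes from [T] to the test function. *)
Lemma pairing_series_tempered T n psi : tempered_distribution T -> schwartz psi ->
  pairing (fun x => \sum_(j < n.+1) T (h j) * h j x) psi = T (cproj n psi).
Proof.
move=> hT sp; rewrite (pairing_sum n.+1 (fun j => T (h j)) schwartz_hermite sp).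
rewrite /cproj (tempered_sum n.+1 (fun j => pairing psi (h j)) hT schwartz_hermite).
by apply: eq_bigr => j _; rewrite mulrC pairingC.
Qed.

Section Association.
Variables (T : (R -> R[i]) -> R[i]) (phi : R -> R[i]).
Hypotheses (hT : tempered_distribution T) (sphi : schwartz phi).

Let f n := convolution (fun x => \sum_(j < n.+1) T (h j) * h j x) (cproj n phi).
Let g n x := \sum_(j < n.+1) distribution_convolution T phi (h j) * h j x.

Lemma H_s'_tempered : H_s' (fun n x => \sum_(j < n.+1) T (h j) * h j x).
Proof.
apply: (H_s'_hermite_series (b := fun j => T (h j))).
have [C [p [C0 hC]]] := tempered_bounded hT; exists C, p; split => // j.
exact: hC (schwartz_hermite j).
Qed.

Lemma H_s'_cproj : H_s' (fun n => cproj n phi).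
Proof.
apply/H_s'P; split=> [n|m]; first exact: schwartz_cproj.
have [C [p [C0 hC]]] := cproj_bounded m; exists (C * snorm p phi), 0%N.
split=> [|n]; first by rewrite mulr_ge0 // snorm_ge0.
by rewrite expr0 mulr1; exact: hC.
Qed.

Lemma H_s'_distribution_convolution : H_s' g.
Proof.
apply: (H_s'_hermite_series (b := fun j => distribution_convolution T phi (h j))).
have [C [p [C0 hC]]] := tempered_bounded hT.
have [D [q [D0 hD]]] := (@cbicontinuous_convolution R).2 p.
have sr := schwartz_creflect sphi.
exists (C * (D * snorm q (creflect phi))), q; split=> [|j].
  by rewrite !mulr_ge0 // snorm_ge0.
apply: le_trans (hC _ (schwartz_convolution sr (schwartz_hermite j))) _.
rewrite -!mulrA; apply: ler_wpM2l => //; exact: hD sr (schwartz_hermite j).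
Qed.

(* With [P_n = cproj n] and [g~ x = g (- x)], the two pairings are the values of [T] at
   [P_n (psi * (P_n phi)~)] and at [phi~ * P_n psi], both close to [psi * phi~]. *)
Lemma association_rate psi : schwartz psi -> exists K, forall n,
  normc (pairing (fun x => f n x - g n x) psi) <= K / Num.sqrt n.+1%:R.
Proof.
move=> sp; have sr := schwartz_creflect sphi.
have sTn n := H_s'_schwartz n H_s'_tempered.
have sPn n := schwartz_cproj n phi.
have srPn n := schwartz_creflect (sPn n).
pose chi := convolution psi (creflect phi).
pose chin n := convolution psi (creflect (cproj n phi)).
have schi : schwartz chi by exact: schwartz_convolution.
have schin n : schwartz (chin n) by exact: schwartz_convolution.
have sg n : schwartz (g n) by exact: H_s'_schwartz n H_s'_distribution_convolution.
have sf n : schwartz (f n) by exact: schwartz_convolution.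
pose gn n := convolution (creflect phi) (cproj n psi).
have sgn n : schwartz (gn n) by exact: schwartz_convolution sr (schwartz_cproj n psi).
have Ef n : pairing (f n) psi = T (cproj n (chin n)).
  rewrite /f (pairing_convolution (sTn n) (sPn n) sp) (convolutionC (srPn n) sp).
  exact: pairing_series_tempered hT (schin n).
have Eg n : pairing (g n) psi = T (gn n).
  rewrite /g (pairing_sum n.+1 (fun j => distribution_convolution T phi (h j)) schwartz_hermite sp).
  rewrite /gn /cproj (convolution_sum n.+1 (fun j => pairing psi (h j)) schwartz_hermite sr).
  have sF j := schwartz_convolution sr (schwartz_hermite j).
  rewrite (tempered_sum n.+1 (fun j => pairing psi (h j)) hT sF).
  by apply: eq_bigr => j _; rewrite mulrC pairingC.
have Efg n : pairing (fun x => f n x - g n x) psi = T (fun x => cproj n (chin n) x - gn n x).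
  have -> : (fun x => f n x - g n x) = fun x => (-1) * g n x + f n x.
    by apply/funext => x; rewrite mulN1r addrC.
  rewrite (pairing_linear _ (sg n) (sf n) sp) Ef Eg mulN1r addrC.
  by rewrite (temperedB hT (schwartz_cproj n (chin n)) (sgn n)).
have [C [p [C0 hC]]] := tempered_bounded hT.
have [C1 [p1 [C10 h1]]] := cproj_rate p.
have [C2 [p2 [C20 h2]]] := (@cbicontinuous_convolution R).2 p1.
have [C3 [p3 [C30 h3]]] := (@ccontinuous_creflect R).2 p2.
have [C4 [p4 [C40 h4]]] := cproj_bounded p3.
have [C5 [p5 [C50 h5]]] := (@cbicontinuous_convolution R).2 p.
have [C6 [p6 [C60 h6]]] := (@ccontinuous_creflect R).2 p5.
have [C7 [p7 [C70 h7]]] := cproj_rate p6.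
have [C8 [p8 [C80 h8]]] := cproj_rate p5.
(* Errors of three replacements: the outer P_n is dropped, P_n phi becomes phi, and P_n psi becomes
   psi. Each one gains (n + 1)^(-1/2); in [B1] this uses that P_n phi is bounded uniformly in n. The
   factors 2 of the total come from [snormD]. *)
pose B1 := C1 * (C2 * (snorm p2 psi * (C3 * (C4 * snorm p4 phi)))).
pose B2 := C5 * (snorm p5 psi * (C6 * (C7 * snorm p7 phi))).
pose B3 := C5 * (snorm p5 (creflect phi) * (C8 * snorm p8 psi)).
exists (C * (2 * (2 * (B1 + B2) + B3))) => n.
have s0 : 0 <= (Num.sqrt n.+1%:R)^-1 :> R by rewrite invr_ge0 sqrtr_ge0.
have b1 : snorm p (fun x => cproj n (chin n) x - chin n x) <= B1 / Num.sqrt n.+1%:R.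
  rewrite (snorm_subC p (schwartz_cproj n _) (schin n)).
  apply: le_trans (h1 n _ (schin n)) _; apply: ler_wpM2r => //; apply: ler_wpM2l => //.
  apply: le_trans (h2 _ _ sp (srPn n)) _; apply: ler_wpM2l => //.
  apply: ler_wpM2l; first exact: snorm_ge0.
  by apply: le_trans (h3 _ (sPn n)) _; apply: ler_wpM2l => //; exact: h4.
have b2 : snorm p (fun x => chin n x - chi x) <= B2 / Num.sqrt n.+1%:R.
  have -> : (fun x => chin n x - chi x) =
      convolution psi (creflect (fun x => cproj n phi x - phi x)).
    by rewrite -(convolutionB (srPn n) sr sp).
  have sd := schwartzB (sPn n) sphi.
  apply: le_trans (h5 _ _ sp (schwartz_creflect sd)) _.
  rewrite /B2 -!mulrA; apply: ler_wpM2l => //; apply: ler_wpM2l; first exact: snorm_ge0.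
  apply: le_trans (h6 _ sd) _; apply: ler_wpM2l => //.
  by rewrite (snorm_subC _ (sPn n) sphi) mulrA; exact: h7.
have b3 : snorm p (fun x => chi x - gn n x) <= B3 / Num.sqrt n.+1%:R.
  have sd := schwartzB sp (schwartz_cproj n psi).
  have -> : (fun x => chi x - gn n x) =
      convolution (creflect phi) (fun x => psi x - cproj n psi x).
    by rewrite (convolutionB sp (schwartz_cproj n psi) sr) /chi (convolutionC sp sr).
  apply: le_trans (h5 _ _ sr sd) _.
  rewrite /B3 -!mulrA; apply: ler_wpM2l => //; apply: ler_wpM2l; first exact: snorm_ge0.
  by rewrite mulrA; exact: h8.
have sd1 := schwartzB (schwartz_cproj n (chin n)) (schin n).
have sd2 := schwartzB (schin n) schi.
have sd3 := schwartzB schi (sgn n).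
rewrite Efg -mulrA; apply: le_trans (hC _ (schwartzB (schwartz_cproj n (chin n)) (sgn n))) _.
apply: ler_wpM2l => //.
have -> : (fun x => cproj n (chin n) x - gn n x) =
    fun x => ((cproj n (chin n) x - chin n x) + (chin n x - chi x)) + (chi x - gn n x).
  by apply/funext => x; rewrite !subrKA.
apply: le_trans (snormD p (schwartzD sd1 sd2) sd3) _; rewrite -mulrA; apply: ler_wpM2l => //.
rewrite mulrDl; apply: lerD => //.
apply: le_trans (snormD p sd1 sd2) _; rewrite -mulrA; apply: ler_wpM2l => //.
by rewrite mulrDl; apply: lerD.
Qed.

Lemma cvg_rate (a : nat -> R) (K : R) : (forall n, 0 <= a n) ->
  (forall n, a n <= K / Num.sqrt n.+1%:R) -> a @ \oo --> (0 : R).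
Proof.
move=> a0 aK; apply/cvgrPdist_lt => e e0; near=> n.
rewrite sub0r normrN ger0_norm //; apply: le_lt_trans (aK n) _.
have s0 : 0 < Num.sqrt (n.+1%:R : R) by rewrite sqrtr_gt0 ltr0n.
rewrite ltr_pdivrMr // -ltr_pdivrMl //; apply: le_lt_trans (ler_norm _) _.
rewrite -sqrtr_sqr ltr_sqrt ?ltr0n //.
apply: (@lt_le_trans _ _ n%:R); last by rewrite ler_nat.
by near: n; exact: nbhs_infty_gtr.
Unshelve. all: by end_near. Qed.

Lemma association : tassociated
  (tconv (tiota T) (tiota (distribution_of phi))) (tiota (distribution_convolution T phi)).
Proof.
exists f, g; split.
- exact: H_s'_convolution H_s'_tempered H_s'_cproj.
- exact: H_s'_distribution_convolution.
- exact: tconv_tclass H_s'_tempered H_s'_cproj.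
- by [].
move=> psi sp; have [K hK] := association_rate sp.
by apply: (cvg_rate (K := K)) => n; [exact: normc_ge0|exact: hK].
Qed.

End Association.
End Distributions.

#[local] Opaque tclass tfourier tinv_fourier tscale tmul tderive H_s'
  fourier inv_fourier convolution tconv.

(** * Identities of convolution and Fourier transform in the algebra *)

Section TemperedConvolution.
Variable R : realType.
Implicit Types f g k : nat -> R -> R[i].

(** Reduces an identity of the algebra to an equality of representatives; [f] in [H_s'] makes both
    sides elements of the algebra. *)
Lemma teq_eq f g (X Y : set (nat -> R -> R[i])) :
  H_s' f -> f = g -> X = tclass f -> Y = tclass g -> teq X Y.
Proof. by move=> hf fg -> ->; exact: teq_tclass. Qed.

Lemma teq_conv f g : H_s' f -> H_s' g ->
  teq (tconv (tclass f) (tclass g)) (tclass (fun n => convolution (f n) (g n))).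
Proof.
move=> hf hg; apply: (teq_eq (H_s'_convolution hf hg) erefl) => //.
exact: (tconv_tclass hf hg).
Qed.

Lemma teq_convC f g : H_s' f -> H_s' g ->
  teq (tconv (tclass f) (tclass g)) (tconv (tclass g) (tclass f)).
Proof.
move=> hf hg.
apply: (teq_eq (H_s'_convolution hf hg) _ (tconv_tclass hf hg) (tconv_tclass hg hf)).
by apply/funext => n; exact: (convolutionC (H_s'_schwartz n hf) (H_s'_schwartz n hg)).
Qed.

Lemma teq_derive_conv alpha f g : H_s' f -> H_s' g ->
  teq (iter alpha (@tderive R) (tconv (tclass f) (tclass g)))
      (tconv (iter alpha (@tderive R) (tclass f)) (tclass g)).
Proof.
move=> hf hg; have [hd Ed] := tderive_iter alpha hf.
have [hc Ec] := tderive_iter alpha (H_s'_convolution hf hg).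
apply: (teq_eq hc).
- apply/funext => n.
  exact: (iter_cderive_convolution alpha (H_s'_schwartz n hf) (H_s'_schwartz n hg)).
- by rewrite (tconv_tclass hf hg).
- by rewrite Ed; exact: (tconv_tclass hd hg).
Qed.

Lemma teq_convA f g k : H_s' f -> H_s' g -> H_s' k ->
  teq (tconv (tconv (tclass f) (tclass g)) (tclass k))
      (tconv (tclass f) (tconv (tclass g) (tclass k))).
Proof.
move=> hf hg hk; have hfg := H_s'_convolution hf hg; have hgk := H_s'_convolution hg hk.
apply: (teq_eq (H_s'_convolution hfg hk)).
- apply/funext => n.
  exact: (convolutionA (H_s'_schwartz n hf) (H_s'_schwartz n hg) (H_s'_schwartz n hk)).
- by rewrite (tconv_tclass hf hg); exact: (tconv_tclass hfg hk).
- transitivity (tconv (tclass f) (tclass (fun n => convolution (g n) (k n)))).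
    congr tconv; exact: (tconv_tclass hg hk).
  exact: (tconv_tclass hf hgk).
Qed.

Lemma teq_fourier_mul f g : H_s' f -> H_s' g ->
  teq (tfourier (tmul (tclass f) (tclass g)))
      (tscale ((Num.sqrt (2 * pi))^-1)%:C
         (tconv (tfourier (tclass f)) (tfourier (tclass g)))).
Proof.
move=> hf hg; have hm := H_s'_mul hf hg.
have hFf := H_s'_fourier hf; have hFg := H_s'_fourier hg.
apply: (teq_eq (H_s'_fourier hm)).
- apply/funext => n.
  exact: (fourier_mul (H_s'_schwartz n hf) (H_s'_schwartz n hg)).
- by rewrite (tmul_tclass hf hg); exact: (tfourier_tclass hm).
- have E : tconv (tfourier (tclass f)) (tfourier (tclass g)) =
      tclass (fun n => convolution (fourier (f n)) (fourier (g n))).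
    transitivity (tconv (tclass (fun n => fourier (f n))) (tclass (fun n => fourier (g n)))).
      congr tconv; [exact: (tfourier_tclass hf)|exact: (tfourier_tclass hg)].
    exact: (tconv_tclass hFf hFg).
  by rewrite E; exact: (tscale_tclass _ (H_s'_convolution hFf hFg)).
Qed.

Lemma teq_fourier_conv f g : H_s' f -> H_s' g ->
  teq (tfourier (tconv (tclass f) (tclass g)))
      (tmul (tscale (Num.sqrt (2 * pi))%:C (tfourier (tclass f))) (tfourier (tclass g))).
Proof.
move=> hf hg; have hc := H_s'_convolution hf hg.
have hFf := H_s'_fourier hf; have hFg := H_s'_fourier hg.
have hs := H_s'_scale (Num.sqrt (2 * pi))%:C hFf.
apply: (teq_eq (H_s'_fourier hc)).
- apply/funext => n.
  exact: (fourier_convolution (H_s'_schwartz n hf) (H_s'_schwartz n hg)).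
- by rewrite (tconv_tclass hf hg); exact: (tfourier_tclass hc).
- have E : tscale (Num.sqrt (2 * pi))%:C (tfourier (tclass f)) =
      tclass (fun n x => (Num.sqrt (2 * pi))%:C * fourier (f n) x).
    transitivity (tscale (Num.sqrt (2 * pi))%:C (tclass (fun n => fourier (f n)))).
      congr tscale; exact: (tfourier_tclass hf).
    exact: (tscale_tclass _ hFf).
  rewrite E; transitivity (tmul (tclass (fun n x => (Num.sqrt (2 * pi))%:C * fourier (f n) x))
    (tclass (fun n => fourier (g n)))).
    congr tmul; exact: (tfourier_tclass hg).
  exact: (tmul_tclass hs hFg).
Qed.

End TemperedConvolution.

Theorem theorem5p2 (R : realType) :
  (forall f g : nat -> R -> R[i], H_s' f -> H_s' g ->
     teq (tconv (tclass f) (tclass g))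
         (tclass (fun n => convolution (f n) (g n))))
  /\
  (forall (f g k : nat -> R -> R[i]) (alpha : nat),
     H_s' f -> H_s' g -> H_s' k ->
     [/\ teq (tconv (tclass f) (tclass g)) (tconv (tclass g) (tclass f)),
         teq (iter alpha (@tderive R) (tconv (tclass f) (tclass g)))
             (tconv (iter alpha (@tderive R) (tclass f)) (tclass g)) &
         teq (tconv (tconv (tclass f) (tclass g)) (tclass k))
             (tconv (tclass f) (tconv (tclass g) (tclass k)))])
  /\
  (forall f g : nat -> R -> R[i], H_s' f -> H_s' g ->
     teq (tfourier (tmul (tclass f) (tclass g)))
         (tscale ((Num.sqrt (2 * pi))^-1)%:C
            (tconv (tfourier (tclass f)) (tfourier (tclass g)))) /\
     teq (tfourier (tconv (tclass f) (tclass g)))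
         (tmul (tscale (Num.sqrt (2 * pi))%:C (tfourier (tclass f)))
               (tfourier (tclass g))))
  /\
  (forall (T : (R -> R[i]) -> R[i]) (phi : R -> R[i]),
     tempered_distribution T -> schwartz phi ->
     tassociated
       (tconv (tiota T) (tiota (distribution_of phi)))
       (tiota (distribution_convolution T phi))).
Proof.
split; first exact: teq_conv.
split=> [f g k alpha hf hg hk|].
  by split; [exact: teq_convC|exact: teq_derive_conv|exact: teq_convA].
split=> [f g hf hg|T phi hT sphi]; last exact: association.
by split; [exact: teq_fourier_mul|exact: teq_fourier_conv].
Qed.
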